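(* Let $g:\mathbb{R}\to\mathbb{R}$ be Lipschitz continuous, $\mathbb{Z}$-periodic and such that $g(y)>0$ for every $y$, and let $u_0:\mathbb{R}^n\to\mathbb{R}$ be Lipschitz continuous. For $\varepsilon>0$ let $u^\varepsilon$ be the solution to $$u^\varepsilon_t-\varepsilon\,\Delta u^\varepsilon-g\left(\frac{u^\varepsilon}{\varepsilon}\right)=0\ \text{ in }\mathbb{R}^n\times(0,+\infty),\qquad u^\varepsilon(x,0)=u_0(x)\ \text{ in }\mathbb{R}^n.$$ Then, as $\varepsilon\to0$, $u^\varepsilon$ converges locally uniformly to the unique Lipschitz continuous viscosity solution $u$ to $$u_t-\bar c(|\nabla u|)=0\ \text{ in }\mathbb{R}^n\times(0,+\infty),\qquad u(x,0)=u_0(x)\ \text{ in }\mathbb{R}^n,$$ where $\bar c:[0,+\infty)\to[0,+\infty)$ is the effective speed defined through the cell problem in the context.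
   Context: $\nabla$ and $\Delta$ are the gradient and Laplacian in $x$. The solution $u^\varepsilon$ is the unique (classical) solution, of class $C^{2+\gamma,1+\gamma/2}$ for all $\gamma\in(0,1)$. Effective speed: for $p\in\mathbb{R}^n$, $\bar c(|p|)$ is the unique constant such that there exists a solution $\chi=\chi_p$ of the cell problem $$\chi''(z)|p|^2-\bar c(|p|)\chi'(z)+g(\chi(z))=0\ \text{ for } z\in(0,1),\qquad \chi(1)=\chi(0)+1,\qquad \chi'(0)=\chi'(1).$$ The constant depends on $p$ only through $|p|$, and $\bar c$ is a continuous function. Viscosity solutions: ''viscosity solution'' is understood in the usual sense for the Cauchy problem $u_t-\bar c(|\nabla u|)=0$, $u(\cdot,0)=u_0$ with continuous Hamiltonian. *)

(* Defs.v *)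
From HB Require Import structures.
From mathcomp Require Import all_boot all_order all_algebra.
From mathcomp Require Import all_classical all_reals all_analysis.
Set Implicit Arguments.
Unset Strict Implicit.
Unset Printing Implicit Defensive.
Import Order.TTheory GRing.Theory Num.Theory.
Import numFieldNormedType.Exports.
Local Open Scope classical_set_scope.
Local Open Scope ring_scope.

(* The library norm on 'rV[R]_n and on products is the maximum norm. It is used
   only where equivalent norms are interchangeable (topology, Lipschitz
   continuity, linear growth); lengths of gradients are Euclidean. *)
Definition enorm (R : realType) (n : nat) (x : 'rV[R]_n) : R :=
  Num.sqrt (\sum_(i < n) x 0 i ^+ 2).

(* Functions on space-time are total on R^n x R, but only their values at times
   t >= 0 carry information. *)
Definition closed_half (R : realType) (n : nat) : set ('rV[R]_n * R) :=
  [set z | 0 <= z.2].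
Definition open_half (R : realType) (n : nat) : set ('rV[R]_n * R) :=
  [set z | 0 < z.2].

Section PartialDerivatives.
Variables (R : realType) (n : nat).
Implicit Types (f : 'rV[R]_n * R -> R) (z : 'rV[R]_n * R) (i j : 'I_n).

Definition time_dir : 'rV[R]_n * R := (0, 1).
Definition space_dir i : 'rV[R]_n * R := (delta_mx 0 i, 0).

Definition dt f z : R := 'D_time_dir f z.
Definition dx i f z : R := 'D_(space_dir i) f z.
Definition grad f z : 'rV[R]_n := \row_(i < n) dx i f z.
Definition laplacian f z : R := \sum_(i < n) dx i (dx i f) z.

Definition C1_open_half f : Prop :=
  forall z, 0 < z.2 ->
    [/\ derivable f z time_dir, {for z, continuous (dt f)} &
        forall i, derivable f z (space_dir i) /\ {for z, continuous (dx i f)}].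

(* C^{2,1}: one derivative in time, two in space. *)
Definition C21_open_half f : Prop :=
  C1_open_half f /\
  forall z, 0 < z.2 -> forall i j,
    derivable (dx j f) z (space_dir i) /\ {for z, continuous (dx i (dx j f))}.

(* Hoelder continuity of exponent gamma for the parabolic distance
   |x - y| + |t - s|^(1/2), locally in R^n x (0, +oo). *)
Definition parabolic_holder_loc (gamma : R) f : Prop :=
  forall K : set ('rV[R]_n * R), compact K -> K `<=` @open_half R n ->
  exists C : R, forall z w, K z -> K w ->
    `|f z - f w| <=
      C * (enorm (z.1 - w.1) `^ gamma + `|z.2 - w.2| `^ (gamma / 2)).

(* C^{2+gamma,1+gamma/2}. For merely Lipschitz initial data this regularity can
   only hold away from t = 0, whence the local version. *)
Definition C2g_open_half (gamma : R) f : Prop :=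
  [/\ C21_open_half f, parabolic_holder_loc gamma (dt f) &
      forall i j, parabolic_holder_loc gamma (dx i (dx j f))].

Definition linear_growth f : Prop :=
  forall T : R, exists C : R, forall z,
    0 <= z.2 <= T -> `|f z| <= C * (1 + `|z.1|).

(* Classical solution of
     u_t - eps Laplacian(u) - g(u / eps) = 0,  u(., 0) = u0.
   Linear growth, uniform on bounded time intervals, selects the solution:
   without a growth condition at infinity the Cauchy problem on the whole space
   is not uniquely solvable (Tychonoff). *)
Definition classical_solution (g : R -> R) (u0 : 'rV[R]_n -> R) (eps : R) f :
    Prop :=
  [/\ {within @closed_half R n, continuous f},
      forall gamma : R, 0 < gamma < 1 -> C2g_open_half gamma f,
      linear_growth f,
      forall z, 0 < z.2 ->
        dt f z - eps * laplacian f z - g (f z / eps) = 0 &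
      forall x, f (x, 0) = u0 x].

Definition viscosity_subsolution (H : R -> R) f : Prop :=
  forall (phi : 'rV[R]_n * R -> R) z, C1_open_half phi -> 0 < z.2 ->
    (\forall w \near z, f w - phi w <= f z - phi z) ->
    dt phi z - H (enorm (grad phi z)) <= 0.

Definition viscosity_supersolution (H : R -> R) f : Prop :=
  forall (phi : 'rV[R]_n * R -> R) z, C1_open_half phi -> 0 < z.2 ->
    (\forall w \near z, f z - phi z <= f w - phi w) ->
    0 <= dt phi z - H (enorm (grad phi z)).

(* Lipschitz continuous (in space and time, up to t = 0) viscosity solution of
     u_t - H(|grad u|) = 0,  u(., 0) = u0. *)
Definition lipschitz_viscosity_solution (H : R -> R) (u0 : 'rV[R]_n -> R) f :
    Prop :=
  [/\ [lipschitz f z | z in @closed_half R n],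
      viscosity_subsolution H f,
      viscosity_supersolution H f &
      forall x, f (x, 0) = u0 x].

End PartialDerivatives.

Section EffectiveSpeed.
Variables (R : realType) (n : nat).

(* chi'(0) and chi'(1) are one-sided derivatives. When p = 0 the equation is of
   first order and, g being only Lipschitz, chi need not be twice
   differentiable; the term chi'' |p|^2 is then 0. *)
Definition cell_solution (g : R -> R) (p : 'rV[R]_n) (c : R) (chi : R -> R) :
    Prop :=
  [/\ {within `[0, 1], continuous chi},
      forall z, 0 < z < 1 ->
        derivable chi z 1 /\ (p != 0 -> derivable (derive1 chi) z 1),
      forall z, 0 < z < 1 ->
        derive1n 2 chi z * enorm p ^+ 2 - c * derive1 chi z + g (chi z) = 0,
      chi 1 = chi 0 + 1 &
      exists d : R,
        (chi h - chi 0) / h @[h --> 0^'+] --> d /\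
        (chi h - chi 1) / (h - 1) @[h --> 1^'-] --> d].

(* Only the values of cbar on [0, +oo) are constrained. *)
Definition effective_speed (g : R -> R) (cbar : R -> R) : Prop :=
  forall p : 'rV[R]_n,
    unique (fun c => exists chi, cell_solution g p c chi) (cbar (enorm p)).

End EffectiveSpeed.

(* Main.v *)
Require Import Defs.
From mathcomp Require Import all_boot all_order all_algebra.
From mathcomp Require Import all_classical all_reals all_analysis.
From mathcomp Require Import ring lra.
Import Order.TTheory GRing.Theory Num.Theory.
Import numFieldNormedType.Exports.
Set Implicit Arguments.
Unset Strict Implicit.
Unset Printing Implicit Defensive.
Local Open Scope classical_set_scope.
Local Open Scope ring_scope.

(** The solution u^eps oscillates at scale eps around its limit, the oscillation
    being given by the cell problem: the ansatz u^eps = eps chi(u / eps), with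
    u locally affine of gradient p and chi = chi_p, turns
    u_t = eps Delta u + g(u / eps) into the cell equation, with u_t = cbar(|p|).
    The proof makes this rigorous by compactness, perturbed test functions
    and uniqueness for the limit problem.

    Correctors. A solution chi of the cell problem extends to X on the whole
    line with X(z + 1) = X(z) + 1. Its derivative is positive: where it is
    extremal, chi'' = 0, hence cbar chi' = g > 0, and this fixes first the sign
    of cbar and then the one of chi' ([cell_gt0]). So X is an increasing
    bi-Lipschitz homeomorphism. Sliding one corrector under another until they
    touch compares their speeds, which shows that cbar(|p|) is continuous in p
    ([speed_comparison], [effective_speed_continuous]).

    Compactness. The term g(u / eps) is invariant under the addition of integer
    multiples of eps to u. Comparing u^eps with its own space-time translates
    plus such multiples gives a Lipschitz estimate uniform in eps up to an error
    that vanishes with eps ([shift_comparison], [heat_modulus]); explicit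
    quadratic barriers control the initial layer ([heat_barrier]). Along an
    ultrafilter of scales tending to 0 the family therefore converges uniformly
    on compact sets to a Lipschitz function u.

    Identification. Suppose that a paraboloid phi touches u from above. Because
    X is increasing, one can undo the oscillation before comparing:
    v = eps X^-1(u^eps / eps) is within O(eps) of u^eps, so v - phi has a local
    maximum near the touching point, and there u^eps is touched from above by
    eps X((phi + const) / eps). Inserting this in the equation of u^eps, the cell
    equation at gradient grad phi cancels everything but
    phi_t <= cbar(|grad phi|) and errors that vanish with eps ([corrector_touch],
    [limit_prox_sub]). Supersolutions are treated by the same argument after the
    reflection u -> - u, g -> - g(- y).

    Uniqueness. For Lipschitz functions, testing with global paraboloids is
    equivalent to the usual definition of viscosity solution
    ([viscosity_sub_prox], [prox_viscosity]), and doubling of variables yields a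
    comparison principle ([prox_comparison]). All limits along ultrafilters
    thus coincide, so the whole family converges. *)

(** * Derivatives at points touched from above *)

(** Clearing the denominator of the difference quotient makes h = 0 harmless
    and lets the estimate be used at all small h. *)
Lemma is_derive_epsP (R : realType) (V : normedModType R) (f : V -> R)
    (z v : V) (l : R) :
  is_derive z v f l <->
  forall e : R, 0 < e -> exists2 r : R, 0 < r &
    forall h : R, `|h| < r -> `|f (h *: v + z) - f z - h * l| <= e * `|h|.
Proof.
split=> [[dfz dfl] e e0|H].
  have : h^-1 *: (f (h *: v + z) - f z) @[h --> 0^'] --> l.
    by rewrite -dfl; exact: dfz.
  move/cvgrPdist_le => /(_ e e0) /nbhs_ballP[r /= r0 Hr].
  exists r => // h hr; have [->|h0] := eqVneq h 0.
    by rewrite scale0r add0r subrr mul0r subrr !normr0 mulr0.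
  have := Hr h; rewrite /ball/= sub0r normrN => /(_ hr h0).
  rewrite -(ler_pM2r (_ : 0 < `|h|)) ?normr_gt0// -normrM distrC mulrBl.
  by rewrite /GRing.scale/= mulrAC mulVf// mul1r (mulrC l).
suff Hc : h^-1 *: (f (h *: v + z) - f z) @[h --> 0^'] --> l.
  by split; [exact: cvgP Hc|exact/cvg_lim].
apply/cvgrPdist_le => e e0; have [r r0 Hr] := H e e0.
apply/nbhs_ballP; exists r => //= h; rewrite /ball/= sub0r normrN => hr h0.
have := Hr h hr; rewrite -(ler_pM2r (_ : 0 < `|h|^-1)) ?invr_gt0 ?normr_gt0//.
rewrite mulfK ?normr_eq0// -normfV -normrM mulrBl (mulrC h) mulfK// distrC.
by rewrite mulrC.
Qed.

Section Touching.
Variables (R : realType) (V : normedModType R).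
Implicit Types (f d : V -> R) (z v : V) (a b l r s t A E : R).

(** Dividing the bound by s < 0 reverses it. Contact on one side suffices,
    which matters at the final time of a space-time cylinder. *)
Lemma touch_left f z v l b E r : is_derive z v f l -> 0 < r ->
  (forall s, - r < s -> s < 0 -> f (s *: v + z) <= f z + b * s + E * s ^+ 2) ->
  b <= l.
Proof.
move=> /is_derive_epsP H r0 fle; rewrite leNgt; apply/negP => lb.
have e0 : 0 < (b - l) / 2 by lra.
have [r' r'0 Hr'] := H _ e0.
set E' := `|E| + 1.
have E'0 : 0 < E' by rewrite ltr_wpDl.
(* Small enough for the domain, for the expansion, and to make E s negligible. *)
set s := - Num.min (Num.min (r / 2) (r' / 2)) ((b - l) / 4 / E').
have s0 : s < 0.
  rewrite oppr_lt0 !lt_min ?divr_gt0//; lra.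
have sr : - r < s.
  rewrite ltrN2 !gt_min; apply/orP; left; apply/orP; left; lra.
have sr' : `|s| < r'.
  rewrite ltr0_norm// opprK !gt_min; apply/orP; left; apply/orP; right; lra.
have sE : - s * E' <= (b - l) / 4.
  by rewrite -ler_pdivlMr// opprK ge_min lexx orbT.
have := fle _ sr s0; have := Hr' _ sr'.
rewrite ler_norml (ltr0_norm s0) => /andP[+ _].
have EE : E <= E' - 1 by rewrite /E' addrK ler_norm.
nra.
Qed.

(** Contact from both sides gives both inequalities; the second one is the
    first along - v. *)
Lemma touch_first f z v l b E r : is_derive z v f l -> 0 < r ->
  (forall s, `|s| < r -> f (s *: v + z) <= f z + b * s + E * s ^+ 2) -> l = b.
Proof.
move=> fl r0 fle; apply/eqP; rewrite eq_le; apply/andP; split; last first.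
  apply: touch_left fl r0 _ => s rs s0; apply: fle.
  by rewrite ltr0_norm// ltrNl.
suff : - b <= - l by rewrite lerN2.
have fN : is_derive z (- v) f (- l).
  apply/is_derive_epsP => e e0; move/is_derive_epsP: fl => /(_ e e0)[r' r'0 Hr].
  exists r' => // h hr; have := Hr (- h); rewrite normrN => /(_ hr).
  by rewrite scalerN scaleNr mulrN mulNr.
apply: (touch_left fN r0 (E := E)) => s rs s0.
have := fle (- s); rewrite normrN ltr0_norm// ltrNl => /(_ rs).
by rewrite scalerN scaleNr sqrrN mulrN mulNr.
Qed.

Lemma is_derive_slice f z v (s l : R) :
  is_derive (s *: v + z) v f l -> is_derive s 1 (fun h : R => f (h *: v + z)) l.
Proof.
move=> /is_derive_epsP H; apply/is_derive_epsP => e e0.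
have [r r0 Hr] := H e e0; exists r => // h hr.
have -> : h *: (1 : R) + s = h + s by rewrite /GRing.scale/= mulr1.
have -> : (h + s) *: v + z = h *: v + (s *: v + z) by rewrite scalerDl addrA.
exact: Hr.
Qed.

Lemma MVT_is_derive (F dF : R -> R) (a b : R) : a < b ->
  (forall s : R, a <= s -> s <= b -> is_derive s 1 F (dF s)) ->
  exists2 s, a < s < b & F b - F a = dF s * (b - a).
Proof.
move=> ab Fd.
have Fc : {within `[a, b], continuous F}.
  apply: derivable_within_continuous => s; rewrite in_itv/= => /andP[s0 sr].
  exact: (@ex_derive _ _ _ _ _ _ _ (Fd s s0 sr)).
have [s|s + Fs] := @MVT R F dF a b ab _ Fc.
  by rewrite in_itv/= => /andP[/ltW s0 /ltW sr]; exact: Fd.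
by rewrite in_itv/= => s0r; exists s.
Qed.

Lemma MVT_slice f d z v r : 0 < r ->
  (forall s, 0 <= s -> s <= r -> is_derive (s *: v + z) v f (d (s *: v + z))) ->
  exists2 s, 0 < s < r & f (r *: v + z) - f z = d (s *: v + z) * r.
Proof.
move=> r0 fd.
have [//|s s0 sr|s sr] := @MVT_is_derive (fun h => f (h *: v + z))
    (fun s => d (s *: v + z)) 0 r.
  by apply: is_derive_slice; exact: fd.
by rewrite scale0r add0r subr0 => Fs; exists s.
Qed.

(** If l > A, then f minus the parabola has derivative at least
    (l - A) s / 2 on the right of z, so f leaves the region below the parabola.
    The derivative d of f along v has to be differentiable at z only. *)
Lemma touch_second f d z v l b A r : 0 < r ->
  (forall s, `|s| < r -> is_derive (s *: v + z) v f (d (s *: v + z))) ->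
  is_derive z v d l ->
  (forall s, `|s| < r -> f (s *: v + z) <= f z + b * s + A / 2 * s ^+ 2) ->
  l <= A.
Proof.
move=> r0 fd dl fle; rewrite leNgt; apply/negP => Al.
have db : d z = b.
  apply: (touch_first (f := f) (z := z) (v := v) (E := A / 2)) (r0) (fle).
  by have := fd 0; rewrite normr0 scale0r add0r => /(_ r0).
have e0 : 0 < (l - A) / 2 by lra.
have [r' r'0 Hr'] := (is_derive_epsP _ _ _ _).1 dl _ e0.
set t := Num.min (r / 2) (r' / 2).
have t0 : 0 < t by rewrite lt_min !divr_gt0.
have tr : t < r by rewrite gt_min; apply/orP; left; lra.
have tr' : t < r' by rewrite gt_min; apply/orP; right; lra.
pose g (s : R) := f (s *: v + z) - b * s - A / 2 * s ^+ 2.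
have gd s : 0 <= s -> s <= t ->
    is_derive s (1 : R) g (d (s *: v + z) - b - A * s).
  move=> s0 st.
  have sr : `|s| < r by rewrite ger0_norm//; exact: le_lt_trans tr.
  have Hf := is_derive_slice (fd s sr).
  move: Hf; set l0 := d _ => Hf; apply: is_derive_eq; rewrite /GRing.scale/=; lra.
have [s /andP[s0 st]] := MVT_is_derive t0 gd.
rewrite /g scale0r add0r mulr0 expr0n/= mulr0 !subr0 => gt.
have tr0 : `|t| < r by rewrite gtr0_norm.
have fle0 := fle _ tr0.
have sr' : `|s| < r' by rewrite gtr0_norm//; exact: lt_trans tr'.
have ls : 0 < (l - A) * s by rewrite mulr_gt0// subr_gt0.
have := Hr' _ sr'; rewrite db (gtr0_norm s0) ler_norml => /andP[dge _].
suff : 0 < (d (s *: v + z) - b - A * s) * t by lra.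
rewrite pmulr_lgt0//; lra.
Qed.
End Touching.

(** * Periodic functions and reflection *)

(** If u solves an equation with nonlinearity g, then - u solves the one with
    nonlinearity [reflect_fun g], with subsolutions and supersolutions
    exchanged. One-sided statements are proved for subsolutions and carried
    over in this way; the same operation turns a corrector X into the one of
    the reflected cell problem. *)
Definition reflect_fun (R : realType) (f : R -> R) (y : R) : R := - f (- y).

Section Periodic.
Variable R : realType.
Implicit Types (k X : R -> R) (y z : R).

Lemma shift_int X (n : int) z : (forall z, X (z + 1) = X z + 1) ->
  X (z + n%:~R) = X z + n%:~R.
Proof.
move=> X1; have XN m y : X (y + m%:R) = X y + m%:R.
  elim: m => [|m IH]; first by rewrite !addr0.
  by rewrite -natr1 addrA X1 IH addrA.
case: n => m; first by rewrite -pmulrn XN.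
rewrite NegzE mulrNz -pmulrn.
by apply/eqP; rewrite eq_sym subr_eq -XN subrK.
Qed.

Lemma periodic_int k (n : int) z : periodic k 1 -> k (z + n%:~R) = k z.
Proof.
move=> k1; have := @shift_int (fun z => k z + z) n z.
move=> H; have /H : forall z, k (z + 1) + (z + 1) = k z + z + 1.
  by move=> y; rewrite k1 addrA.
by rewrite -addrA => /addIr.
Qed.

Lemma sub_floor_itv z : let n := (Num.floor z)%:~R : R in 0 <= z - n < 1.
Proof.
by rewrite /= subr_ge0 floor_le ltrBlDl -[_ + 1]intrD1 floorD1_gt.
Qed.

Lemma periodic_ext k (Q : R -> Prop) : periodic k 1 ->
  (forall z, 0 <= z < 1 -> Q (k z)) -> forall z, Q (k z).
Proof.
move=> k1 H z; rewrite -(subrK (Num.floor z)%:~R z) periodic_int//.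
exact/H/sub_floor_itv.
Qed.

Lemma periodic_max k : periodic k 1 -> continuous k ->
  exists zM, forall z, k z <= k zM.
Proof.
move=> k1 kc; have [|zM _ zMP] := @EVT_max R k 0 1 ler01.
  exact: continuous_subspaceT.
exists zM; apply: (periodic_ext (Q := fun y => y <= k zM)) => // z /andP[z0 z1].
by apply: zMP; rewrite in_itv/= z0 ltW.
Qed.
End Periodic.

(** * Correctors and the comparison of their speeds *)

Section Corrector.
Variable R : realType.
Implicit Types (g X D h : R -> R) (P c C m r s y z delta A : R).

(** Supersolution P X'' <= c X' - g(X) of the cell equation with squared
    gradient P and speed c. Second-order upper jets replace X'' because X is
    merely C^{1,1} when P = 0; the slack delta absorbs the error of a
    second-order expansion at a point where X' is differentiable. Subsolutions are
    the upper correctors of [reflect_fun g] with speed - c. *)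
Record upper_corrector g P c X D C m : Prop := UpperCorrector {
  corr_shift : forall z, X (z + 1) = X z + 1;
  corr_derive : forall z, is_derive z (1 : R) X (D z);
  corr_gt0 : 0 < m;
  corr_ge : forall z, m <= D z;
  corr_jet : forall z delta, 0 < delta -> exists A,
    [/\ `|A| <= C, P * A <= c * D z - g (X z) + delta &
        exists2 r, 0 < r & forall s, `|s| < r ->
          X (z + s) <= X z + D z * s + A / 2 * s ^+ 2] }.

Lemma is_derive_continuous X D :
  (forall z, is_derive z (1 : R) X (D z)) -> continuous X.
Proof.
move=> XD z; apply: differentiable_continuous.
by apply/derivable1_diffP; exact: (@ex_derive _ _ _ _ _ _ _ (XD z)).
Qed.

Lemma derive_ge_growth X D m y z :
  (forall z, is_derive z (1 : R) X (D z)) -> (forall z, m <= D z) ->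
  y <= z -> m * (z - y) <= X z - X y.
Proof.
move=> XD mD; rewrite le_eqVlt => /predU1P[->|yz]; first by rewrite !subrr mulr0.
have [s _ ->] := MVT_is_derive yz (fun s _ _ => XD s).
by rewrite ler_pM2r// subr_gt0.
Qed.

Lemma derive_le_growth X D m y z :
  (forall z, is_derive z (1 : R) X (D z)) -> (forall z, `|D z| <= m) ->
  `|X z - X y| <= m * `|z - y|.
Proof.
move=> XD mD; wlog yz : y z / y <= z.
  by move=> H; case/orP: (le_total y z) => /H//; rewrite distrC [`|y - z|]distrC.
move: yz; rewrite le_eqVlt => /predU1P[->|yz]; first by rewrite !subrr normr0 mulr0.
have [s _ ->] := MVT_is_derive yz (fun s _ _ => XD s).
by rewrite normrM ler_wpM2r.
Qed.

(** A slope at least m > 0 makes X bijective with inverse Lipschitz of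
    constant 1 / m; the inverse commutes with integer translations, hence stays
    at bounded distance from the identity. *)
Lemma corrector_inverse g P c X D C m : upper_corrector g P c X D C m ->
  exists h, [/\ cancel h X, cancel X h, forall y, h (y + 1) = h y + 1,
    forall y z, `|h y - h z| <= `|y - z| / m &
    exists B, forall y, `|h y - y| <= B].
Proof.
case=> X1 XD m0 mD _.
have Xinc y z : y <= z -> m * (z - y) <= X z - X y.
  exact: derive_ge_growth.
have Xc : continuous X by exact: is_derive_continuous.
have Xinj : injective X.
  move=> y z Xyz; wlog yz : y z Xyz / y <= z.
    by move=> H; case/orP: (le_total y z) => /H; [exact|move=> /(_ (esym Xyz))].
  have := Xinc _ _ yz; rewrite Xyz subrr pmulr_rle0// subr_le0 => zy.
  by apply/le_anti; rewrite yz.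
have Xsurj y : exists z, X z = y.
  (* By the growth bound X passes y between - b and b. *)
  set b := `|y - X 0| / m.
  have b0 : 0 <= b by rewrite divr_ge0// ltW.
  have Xb : y <= X b.
    have := Xinc _ _ b0; rewrite subr0 /b mulrC divfK ?gt_eqF//.
    by have := ler_norm (y - X 0); lra.
  have XNb : X (- b) <= y.
    have := Xinc (- b) 0; rewrite oppr_le0 => /(_ b0).
    rewrite sub0r opprK /b mulrC divfK ?gt_eqF//.
    by have := ler_norm (- (y - X 0)); rewrite normrN; lra.
  have bb : - b <= b by lra.
  have XX := le_trans XNb Xb.
  have [||z _ <-] := @IVT R X (- b) b y bb; last by exists z.
    exact: continuous_subspaceT.
  by rewrite min_l// max_r// XNb Xb.
have [h hX] := choice Xsurj.
have Xh : cancel X h by move=> z; apply: Xinj; rewrite hX.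
have h1 y : h (y + 1) = h y + 1 by apply: Xinj; rewrite X1 !hX.
have hL y z : `|h y - h z| <= `|y - z| / m.
  wlog hyz : y z / h z <= h y.
    move=> H; case/orP: (le_total (h z) (h y)) => /H//.
    by rewrite distrC [`|z - y|]distrC.
  have := Xinc _ _ hyz; rewrite !hX => H.
  rewrite ger0_norm ?subr_ge0// ler_pdivlMr// mulrC.
  exact: le_trans H (ler_norm _).
exists h; split => //.
exists (1 / m + `|h 0| + 1).
apply: (periodic_ext (k := fun y => h y - y) (Q := fun x => `|x| <= _)).
  by move=> y; rewrite h1; lra.
move=> y /andP[y0 y1].
have := hL y 0; rewrite subr0 (ger0_norm y0) => hy.
have ym : y / m <= 1 / m by rewrite ler_pM2r ?invr_gt0// ltW.
have -> : h y - y = (h y - h 0) + h 0 - y by lra.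
apply: le_trans (ler_normB _ _) _; apply: lerD; last by rewrite ger0_norm// ltW.
apply: le_trans (ler_normD _ _) _; apply: lerD => //; exact: le_trans ym.
Qed.

Lemma quad_ge0 (a b r : R) : 0 < r ->
  (forall s, `|s| < r -> 0 <= a * s + b * s ^+ 2) -> a = 0 /\ 0 <= b.
Proof.
move=> r0 H.
have a0 : a = 0.
  have -> : a = a + 0 by rewrite addr0.
  have Hd : is_derive (0 : R) 1 (cst 0 : R -> R) 0 by exact: is_derive_cst.
  have := @touch_first _ _ (cst 0 : R -> R) 0 1 0 a b r Hd r0.
  rewrite addr0; move=> <- // s sr.
  by rewrite /cst add0r; exact: H.
split => //; have := H (r / 2).
rewrite a0 mul0r add0r pmulr_lge0 ?exprn_gt0 ?divr_gt0//; apply.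
by rewrite ger0_norm ?divr_ge0 ?ltW//; lra.
Qed.

(** Translate X2 until it touches the lower corrector Y(z) = - X1(- z) from
    above. At the contact point the slopes agree, and the curvature of Y is at
    most the one of X2. Subtracting the two cell inequalities eliminates g, and
    leaves (c1 - c2) X2' <= (P1 - P2) A with a curvature |A| <= C2. With equal
    P this is uniqueness of the speed; in general it is continuity in P. *)
Lemma speed_comparison g P1 P2 c1 c2 X1 X2 D1 D2 C1 C2 m1 m2 :
  periodic g 1 -> 0 <= P1 ->
  upper_corrector (reflect_fun g) P1 (- c1) X1 D1 C1 m1 ->
  upper_corrector g P2 c2 X2 D2 C2 m2 ->
  (c1 - c2) * m2 <= C2 * `|P1 - P2|.
Proof.
move=> g1 P10 K1 K2.
have [h [hX Xh h1 hL _]] := corrector_inverse K2.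
pose Y z := - X1 (- z).
have Y1 z : Y (z + 1) = Y z + 1.
  have := corr_shift K1 (- (z + 1)); rewrite /Y opprD subrK => ->.
  by lra.
have Yc : continuous Y.
  move=> z; apply: continuousN; apply: continuous_comp; first exact: opp_continuous.
  exact: (is_derive_continuous (corr_derive K1)).
have hc : continuous h.
  move=> y; apply/cvgrPdist_le => e e0; apply/nbhs_ballP.
  have m20 := corr_gt0 K2.
  exists (e * m2) => /=; first exact: mulr_gt0.
  move=> z; rewrite /ball/= => yz; apply: le_trans (hL _ _) _.
  by rewrite ler_pdivrMr// ltW.
(* The maximum is the smallest translation of X2 to the left that puts it
   above Y. *)
have [||zM zMP] := @periodic_max _ (fun z => h (Y z) - z).
- by move=> z; rewrite Y1 h1; lra.
- move=> z; apply: cvgB; last exact: cvg_id.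
  by apply: continuous_comp; [exact: Yc|exact: hc].
set w := h (Y zM).
have Yle s : Y (zM + s) <= X2 (w + s).
  rewrite -[Y _]hX -subr_ge0.
  have hle : h (Y (zM + s)) <= w + s by have := zMP (zM + s); rewrite -/w; lra.
  apply: le_trans (derive_ge_growth (corr_derive K2) (corr_ge K2) hle).
  by rewrite mulr_ge0 ?subr_ge0// ltW// (corr_gt0 K2).
have X2w : X2 w = Y zM by rewrite /w hX.
apply/ler_addgt0Pr => e e0; have e2 : 0 < e / 2 by lra.
have [A2 [A2C HA2 [r2 r20 Hr2]]] := corr_jet K2 w e2.
have [A1 [A1C HA1 [r1 r10 Hr1]]] := corr_jet K1 (- zM) e2.
have [] := @quad_ge0 (D2 w - D1 (- zM)) ((A1 + A2) / 2) (Num.min r1 r2).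
- by rewrite lt_min r10.
- move=> s; rewrite lt_min => /andP[sr1 sr2].
  have := Hr1 (- s); rewrite normrN => /(_ sr1).
  have := Hr2 s sr2; have := Yle s; rewrite X2w /Y opprD; lra.
move=> /eqP; rewrite subr_eq0 => /eqP D12 AA.
have AA' : 0 <= A1 + A2 by lra.
have gg : reflect_fun g (X1 (- zM)) = - g (X2 w).
  by rewrite /reflect_fun X2w /Y.
rewrite gg -D12 in HA1.
have D2m := corr_ge K2 w.
have PA : P1 * 0 <= P1 * (A1 + A2) by rewrite ler_wpM2l.
have PP : (P2 - P1) * - A2 <= `|P1 - P2| * C2.
  rewrite distrC; apply: le_trans (ler_norm _) _; rewrite normrM normrN.
  by rewrite ler_wpM2l.
have H : (c1 - c2) * D2 w <= C2 * `|P1 - P2| + e by lra.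
have C20 : 0 <= C2 * `|P1 - P2|.
  by rewrite mulr_ge0//; exact: le_trans A2C.
(* The lower bound D2 w >= m2 can be inserted only if c1 - c2 > 0. *)
have [c0|c0] := lerP (c1 - c2) 0.
  have m20 := corr_gt0 K2.
  suff : (c1 - c2) * m2 <= 0 by lra.
  by rewrite mulr_le0_ge0// ltW.
by apply: le_trans H; rewrite ler_pM2l.
Qed.
End Corrector.

(** * From the cell problem to correctors *)

Section CellProblem.
Variable R : realType.
Implicit Types (f k g X D chi : R -> R) (P c C L B M m r s h y z l e : R).

Lemma norm_le_eq (a b e : R) : `|a| <= e -> a = b -> `|b| <= e.
Proof. by move=> + <-. Qed.

Lemma norm_le_eqN (a b e : R) : `|a| <= e -> - a = b -> `|b| <= e.
Proof. by move=> + <-; rewrite normrN. Qed.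

Lemma is_derive1_epsP f z l : is_derive z (1 : R) f l <->
  forall e : R, 0 < e -> exists2 r : R, 0 < r &
    forall h : R, `|h| < r -> `|f (z + h) - f z - l * h| <= e * `|h|.
Proof.
have E (h : R) : h *: (1 : R) + z = z + h by rewrite [h *: _]mulr1 addrC.
split=> [/is_derive_epsP H|H]; last apply/is_derive_epsP.
  move=> e e0; have [r r0 Hr] := H e e0; exists r => // h /Hr.
  by rewrite E [h * l]mulrC.
move=> e e0; have [r r0 Hr] := H e e0; exists r => // h /Hr.
by rewrite E [l * h]mulrC.
Qed.

Lemma is_derive_local f k z l r : 0 < r ->
  (forall h, `|h| < r -> f (z + h) = k (z + h)) ->
  is_derive z (1 : R) k l -> is_derive z (1 : R) f l.
Proof.
move=> r0 fk /is_derive1_epsP H; apply/is_derive1_epsP => e e0.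
have [r' r'0 Hr] := H e e0; exists (Num.min r r'); first by rewrite lt_min r0.
move=> h; rewrite lt_min => /andP[hr hr'].
have := fk 0; rewrite normr0 addr0 => /(_ r0) ->.
by rewrite fk//; exact: Hr.
Qed.

Lemma is_derive_lift X z l (n : int) : (forall z, X (z + 1) = X z + 1) ->
  is_derive z (1 : R) X l -> is_derive (z + n%:~R) (1 : R) X l.
Proof.
move=> X1 /is_derive1_epsP H; apply/is_derive1_epsP => e e0.
have [r r0 Hr] := H e e0; exists r => // h hr.
by rewrite [z + _ + h]addrAC !(shift_int _ _ X1); apply: norm_le_eq (Hr h hr) _; lra.
Qed.

Lemma is_derive_refl f z l :
  is_derive (- z) (1 : R) f l -> is_derive z (1 : R) (reflect_fun f) l.
Proof.
move=> /is_derive1_epsP H; apply/is_derive1_epsP => e e0.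
have [r r0 Hr] := H e e0; exists r => // h hr.
have := Hr (- h); rewrite normrN => /(_ hr) H'.
by apply: norm_le_eqN H' _; rewrite /reflect_fun [- (z + h)]opprD; lra.
Qed.

(** A function whose derivative has a one-sided limit at an endpoint is
    differentiable there. Continuity at the endpoint is asked along some points
    only, since for the flux of the cell equation nothing better is known
    beforehand. *)
Lemma glue_right (zeta Z : R -> R) l :
  (forall s, 0 < s < 1 -> is_derive s (1 : R) zeta (Z s)) ->
  (forall e, 0 < e -> exists2 r : R, 0 < r & forall s, 0 < s < r -> `|Z s - l| <= e) ->
  (forall e, 0 < e -> exists2 s : R, 0 < s < e & `|zeta s - zeta 0| <= e) ->
  forall e, 0 < e -> exists2 r : R, 0 < r &
    forall h, 0 < h < r -> `|zeta h - zeta 0 - l * h| <= e * h.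
Proof.
move=> zd Zl z0 e e0; have [r r0 Hr] := Zl e e0.
exists (Num.min r 1); first by rewrite lt_min r0 ltr01.
move=> h; rewrite lt_min => /and3P[h0 hr h1].
apply/ler_addgt0Pr => eta eta0.
have l1 : 0 < 1 + `|l| by rewrite ltr_pwDl.
have e'0 : 0 < Num.min h (eta / (1 + `|l|)) by rewrite lt_min h0 divr_gt0.
have [x /andP[x0]] := z0 _ e'0; rewrite lt_min => /andP[xh xe].
rewrite le_min => /andP[_ xz].
have [|s /andP[xs sh] E] := @MVT_is_derive R zeta Z x h xh.
  by move=> s xs sh; apply: zd; rewrite (lt_le_trans x0)//= (le_lt_trans sh).
(* The mean value theorem is applied on [x, h], and x is a point near 0 at
   which zeta is close to its value at 0. *)
have -> : zeta h - zeta 0 - l * h = (Z s - l) * (h - x) + ((zeta x - zeta 0) - l * x) by lra.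
apply: le_trans (ler_normD _ _) _; apply: lerD.
  rewrite normrM (gtr0_norm (_ : 0 < h - x)) ?subr_gt0//.
  apply: ler_pM => //; first by rewrite subr_ge0 ltW.
    by apply: Hr; rewrite (lt_trans x0 xs) (lt_trans sh hr).
  by lra.
apply: le_trans (ler_normB _ _) _; rewrite normrM (gtr0_norm x0).
have : `|l| * x <= `|l| * (eta / (1 + `|l|)) by rewrite ler_wpM2l// ltW.
have : eta = eta / (1 + `|l|) + `|l| * (eta / (1 + `|l|)) by field; lra.
by lra.
Qed.

(** The cell equation away from the integers, for the extension X of a cell
    solution to the line. For P = 0 it is of first order, and D need not be
    differentiable. *)
Record open_cell g P c X D : Prop := OpenCell {
  oc_shift : forall z, X (z + 1) = X z + 1;
  oc_derive : forall z, is_derive z (1 : R) X (D z);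
  oc_per : periodic D 1;
  oc_ode0 : P = 0 -> forall z, 0 < z < 1 -> c * D z = g (X z);
  oc_ode : 0 < P -> forall z, 0 < z < 1 ->
     is_derive z (1 : R) D ((c * D z - g (X z)) / P) }.

Lemma open_cell_refl g P c X D : periodic g 1 -> open_cell g P c X D ->
  open_cell (reflect_fun g) P (- c) (reflect_fun X) (fun z => D (- z)).
Proof.
move=> g1 [X1 XD D1 H0 HP].
have DN z : D (- z) = D (1 - z) by rewrite -D1 addrC.
have gN z : reflect_fun g (reflect_fun X z) = - g (X (1 - z)).
  by rewrite /reflect_fun opprK addrC X1 g1.
split.
- move=> z; have := X1 (- (z + 1)).
  by rewrite opprD subrK /reflect_fun opprD => ->; lra.
- by move=> z; exact: is_derive_refl.
- by move=> z; rewrite -D1 opprD subrK.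
- move=> P0 z /andP[z0 z1]; rewrite gN DN mulNr H0//.
  by rewrite subr_gt0 z1 ltrBlDr ltrDl z0.
- move=> P0 z /andP[z0 z1]; rewrite gN DN.
  have Hz : 0 < 1 - z < 1 by rewrite subr_gt0 z1 ltrBlDr ltrDl z0.
  have /is_derive1_epsP H := HP P0 _ Hz; apply/is_derive1_epsP => e e0.
  have [r r0 Hr] := H e e0; exists r => // h hr.
  have := Hr (- h); rewrite normrN => /(_ hr) H'.
  by rewrite !DN opprD addrA; apply: norm_le_eq H' _; lra.
Qed.

Variables (g : R -> R) (L : R).
Hypothesis gL : forall y z, `|g y - g z| <= L * `|y - z|.
Hypothesis g1 : periodic g 1.

Let L0 : 0 <= L.
Proof. by have := gL 1 0; rewrite subr0 normr1 mulr1; exact: le_trans. Qed.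

Lemma comp_near0 X D e : is_derive (0 : R) (1 : R) X (D 0) -> 0 < e ->
  exists2 r : R, 0 < r & forall s, `|s| < r -> `|g (X s) - g (X 0)| <= e.
Proof.
move=> /is_derive1_epsP /(_ 1 ltr01)[r r0 Hr] e0.
have K0 : 0 < L * (1 + `|D 0|) + 1.
  by rewrite ltr_wpDl// mulr_ge0// addr_ge0.
exists (Num.min r (e / (L * (1 + `|D 0|) + 1))); first by rewrite lt_min r0 divr_gt0.
move=> s; rewrite lt_min => /andP[/Hr + se]; rewrite add0r => Xs.
apply: le_trans (gL _ _) _.
have Xs' : `|X s - X 0| <= (1 + `|D 0|) * `|s|.
  have -> : X s - X 0 = (X s - X 0 - D 0 * s) + D 0 * s by lra.
  by apply: le_trans (ler_normD _ _) _; rewrite normrM; lra.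
have H1 : L * `|X s - X 0| <= L * ((1 + `|D 0|) * `|s|) by rewrite ler_wpM2l.
have H2 : (L * (1 + `|D 0|) + 1) * `|s| <= e.
  by rewrite -ler_pdivlMl// mulrC ltW.
by have := normr_ge0 s; lra.
Qed.

(** The flux P X' - c X has derivative - g(X) inside the cell, which is
    continuous up to the boundary; so the equation persists, one-sidedly, at
    the integer 0. The reflected problem provides the other side. *)
Lemma open_cell_right P c X D : 0 < P -> open_cell g P c X D ->
  forall e, 0 < e -> exists2 r : R, 0 < r & forall h, 0 < h < r ->
    `|(P * D h - c * X h) - (P * D 0 - c * X 0) - (- g (X 0)) * h| <= e * h.
Proof.
move=> P0 [X1 XD D1 _ HP].
have X0 := XD 0.
apply: (@glue_right (fun h => P * D h - c * X h) (fun h => - g (X h))).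
- move=> s s01; have Ds := HP P0 _ s01; have Xs := XD s.
  apply: is_derive_eq; rewrite /GRing.scale/=; field; lra.
- move=> e e0; have [r r0 Hr] := comp_near0 X0 e0.
  exists r => // s /andP[s0 sr]; have := Hr s; rewrite gtr0_norm// => /(_ sr) H.
  by apply: norm_le_eqN H _; lra.
- move=> e e0.
  have K0 : 0 < P + `|c| * (1 + `|D 0|) + 1.
    by rewrite ltr_wpDl// addr_ge0 ?(ltW P0)// mulr_ge0// addr_ge0.
  have e'0 : 0 < Num.min 1 (e / (P + `|c| * (1 + `|D 0|) + 1)).
    by rewrite lt_min ltr01 divr_gt0.
  set e' := Num.min _ _ in e'0.
  have e'1 : e' <= 1 by rewrite ge_min lexx.
  have e'e : e' * (P + `|c| * (1 + `|D 0|) + 1) <= e.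
    by rewrite -ler_pdivlMr// ge_min lexx orbT.
  have [r r0 Hr] := (is_derive1_epsP _ _ _).1 X0 _ e'0.
  set h := Num.min (e' / 2) (r / 2).
  have h0 : 0 < h by rewrite lt_min !divr_gt0.
  have he : h < e' by rewrite gt_min; apply/orP; left; lra.
  have hr : h < r by rewrite gt_min; apply/orP; right; lra.
  have [s /andP[s0 sh] Xh] := MVT_is_derive h0 (fun s _ _ => XD s).
  have ee : e' <= e.
    by apply: le_trans e'e; rewrite ler_peMr ?(ltW e'0)// lerDr addr_ge0 ?(ltW P0)// mulr_ge0// addr_ge0.
  exists s; first by rewrite s0 (lt_trans sh)// (lt_le_trans he).
  have Ds : `|D s - D 0| <= e'.
    have := Hr h; rewrite gtr0_norm// add0r Xh => /(_ hr).
    by rewrite subr0 -mulrBl normrM (gtr0_norm h0) ler_pM2r.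
  have Xs : `|X s - X 0| <= (1 + `|D 0|) * e'.
    have := Hr s; rewrite gtr0_norm// add0r => /(_ (lt_trans sh hr)) H.
    have -> : X s - X 0 = (X s - X 0 - D 0 * s) + D 0 * s by lra.
    apply: le_trans (ler_normD _ _) _; rewrite normrM (gtr0_norm s0).
    have H1 : e' * s <= e' * 1 by rewrite ler_wpM2l ?(ltW e'0)//; lra.
    have H2 : `|D 0| * s <= `|D 0| * e' by rewrite ler_wpM2l//; lra.
    lra.
  have -> : P * D s - c * X s - (P * D 0 - c * X 0) = P * (D s - D 0) - c * (X s - X 0) by lra.
  apply: le_trans (ler_normB _ _) _; rewrite !normrM (gtr0_norm P0).
  have H1 : P * `|D s - D 0| <= P * e' by rewrite ler_wpM2l// ltW.
  have H2 : `|c| * `|X s - X 0| <= `|c| * ((1 + `|D 0|) * e') by rewrite ler_wpM2l.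
  lra.
Qed.

(** Although X' is not known to be continuous at 0, the mean value theorem
    provides points of the open cell, arbitrarily close to 0, at which it is
    close to its value at 0. *)
Lemma open_cell_zero c X D : open_cell g 0 c X D -> c * D 0 = g (X 0).
Proof.
move=> [X1 XD D1 H0 _]; have X0 := XD 0.
apply/eqP; rewrite -subr_eq0 -normr_le0; apply/ler_addgt0Pr => e e0.
rewrite add0r.
have K0 : 0 < `|c| + 1 by rewrite ltr_wpDl.
have e'0 : 0 < e / 2 / (`|c| + 1) by rewrite !divr_gt0.
have e20 : 0 < e / 2 by lra.
have [r r0 Hr] := (is_derive1_epsP _ _ _).1 X0 _ e'0.
have [r' r'0 Hr'] := comp_near0 X0 e20.
set h := Num.min (1 / 2) (Num.min (r / 2) (r' / 2)).
have h0 : 0 < h by rewrite !lt_min !divr_gt0.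
have h1 : h < 1 by rewrite gt_min; apply/orP; left; lra.
have hr : h < r by rewrite !gt_min; apply/orP; right; apply/orP; left; lra.
have hr' : h < r' by rewrite !gt_min; apply/orP; right; apply/orP; right; lra.
have [s /andP[s0 sh] Xh] := MVT_is_derive h0 (fun s _ _ => XD s).
have Ds : `|D s - D 0| <= e / 2 / (`|c| + 1).
  have := Hr h; rewrite gtr0_norm// add0r Xh => /(_ hr).
  by rewrite subr0 -mulrBl normrM (gtr0_norm h0) ler_pM2r.
have s01 : 0 < s < 1 by rewrite s0 (lt_trans sh).
have Es := H0 (erefl _) s s01.
have gs : `|g (X s) - g (X 0)| <= e / 2.
  by apply: Hr'; rewrite gtr0_norm// (lt_trans sh).
have -> : c * D 0 - g (X 0) = (g (X s) - g (X 0)) - c * (D s - D 0) by rewrite -Es; lra.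
apply: le_trans (ler_normB _ _) _; rewrite normrM.
have : (`|c| + 1) * `|D s - D 0| <= e / 2 by rewrite mulrC -ler_pdivlMr.
by have := normr_ge0 (D s - D 0); lra.
Qed.
End CellProblem.

Section CellExtension.
Variable R : realType.
Implicit Types (f k g X D chi : R -> R) (P c C L B M m r s h y z l e : R).

Lemma is_derive_periodic k z l (n : int) : periodic k 1 ->
  is_derive z (1 : R) k l -> is_derive (z + n%:~R) (1 : R) k l.
Proof.
move=> k1 /is_derive1_epsP H; apply/is_derive1_epsP => e e0.
have [r r0 Hr] := H e e0; exists r => // h hr.
by rewrite [z + _ + h]addrAC !periodic_int//; exact: Hr.
Qed.

Record cell g P c X D : Prop := Cell {
  ce_shift : forall z, X (z + 1) = X z + 1;
  ce_derive : forall z, is_derive z (1 : R) X (D z);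
  ce_per : periodic D 1;
  ce_ode0 : P = 0 -> forall z, c * D z = g (X z);
  ce_ode : 0 < P -> forall z,
     is_derive z (1 : R) D ((c * D z - g (X z)) / P) }.

Lemma periodic_split z : exists2 w : R, 0 <= w < 1 & exists n : int, z = w + n%:~R.
Proof.
exists (z - (Num.floor z)%:~R); first exact: sub_floor_itv.
by exists (Num.floor z); rewrite subrK.
Qed.

Lemma reflect_lipschitz g L : (forall y z, `|g y - g z| <= L * `|y - z|) ->
  forall y z, `|reflect_fun g y - reflect_fun g z| <= L * `|y - z|.
Proof.
move=> gL y z; rewrite /reflect_fun -opprD normrN; apply: le_trans (gL _ _) _.
by rewrite -opprD normrN.
Qed.

Lemma reflect_periodic g : periodic g 1 -> periodic (reflect_fun g) 1.
Proof.
by move=> g1 y; rewrite /reflect_fun -(g1 (- (y + 1))) opprD subrK.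
Qed.

Lemma reflect_funK f : reflect_fun (reflect_fun f) = f.
Proof. by apply/funext => y; rewrite /reflect_fun !opprK. Qed.

(** By periodicity only the integer 0 matters, and there the one-sided
    expansions of the flux on the two sides have the same slope - g(X 0). *)
Lemma cell_of_open g L P c X D :
  (forall y z, `|g y - g z| <= L * `|y - z|) -> periodic g 1 -> 0 <= P ->
  open_cell g P c X D -> cell g P c X D.
Proof.
move=> gL g1 P0 oc; have [X1 XD D1 H0 HP] := oc.
have gper z (n : int) : g (X (z + n%:~R)) = g (X z).
  by rewrite (shift_int _ _ X1) periodic_int.
split => // [PE z|Pgt z].
  have [w /andP[w0 w1] [n ->]] := periodic_split z.
  rewrite periodic_int// gper; move: w0; rewrite le_eqVlt => /predU1P[<-|w0].
    by rewrite PE in oc; exact: open_cell_zero oc.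
  by apply: H0; rewrite ?w0.
have [w /andP[w0 w1] [n ->]] := periodic_split z.
rewrite periodic_int// gper; apply: is_derive_periodic => //.
move: w0; rewrite le_eqVlt => /predU1P[<-|w0]; last by apply: HP; rewrite ?w0.
have Hr := open_cell_right gL Pgt oc.
have Hl := open_cell_right (reflect_lipschitz gL) Pgt (open_cell_refl g1 oc).
(* It suffices to differentiate the flux, from which D is recovered. *)
suff Hz : is_derive (0 : R) (1 : R) (fun h => P * D h - c * X h) (- g (X 0)).
  have XD0 := XD 0.
  have -> : D = fun h => (P * D h - c * X h) * P^-1 + c / P * X h.
    by apply/funext => h; field; lra.
  apply: is_derive_eq; rewrite /GRing.scale/=; field; lra.
apply/is_derive1_epsP => e e0.
have [r r0 {}Hr] := Hr e e0; have [r' r'0 {}Hl] := Hl e e0.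
exists (Num.min r r'); first by rewrite lt_min r0.
move=> h; rewrite lt_min add0r => /andP[hr hr'].
have [h0|h0|->] := ltgtP h 0.
- rewrite ltr0_norm// in hr' *.
  have := Hl (- h); rewrite hr' oppr_gt0 h0 => /(_ erefl).
  rewrite /reflect_fun !(opprK, oppr0) => H; apply: norm_le_eq H _; lra.
- by rewrite gtr0_norm// in hr *; apply: Hr; rewrite h0.
- by rewrite mulr0 !subrr !normr0 mulr0.
Qed.

Lemma cell_refl g P c X D : cell g P c X D ->
  cell (reflect_fun g) P (- c) (reflect_fun X) (fun z => D (- z)).
Proof.
move=> [X1 XD D1 H0 HP]; split.
- move=> z; have := X1 (- (z + 1)).
  by rewrite opprD subrK /reflect_fun opprD => ->; lra.
- by move=> z; exact: is_derive_refl.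
- by move=> z; rewrite -D1 opprD subrK.
- by move=> P0 z; rewrite mulNr H0// /reflect_fun opprK.
- move=> P0 z.
  have : is_derive z (1 : R) (fun y => - reflect_fun D y) (- ((c * D (- z) - g (X (- z))) / P)).
    by apply: is_deriveN; apply: is_derive_refl; exact: HP.
  have -> : (fun y => - reflect_fun D y) = fun y => D (- y).
    by apply/funext => y; rewrite /reflect_fun opprK.
  rewrite /reflect_fun !opprK -mulNr opprB mulNr.
  by rewrite [- _ + _]addrC.
Qed.

(** At an extremum of D = X' one has D' = 0, hence c D = g(X) > 0. At the
    maximum D >= 1, since D has mean 1 over a period; so c > 0, and then the
    minimum of D is positive too. *)
Lemma cell_gt0 g P c X D : (forall y, 0 < g y) -> periodic g 1 -> continuous g ->
  0 <= P -> cell g P c X D -> exists2 m, 0 < m & forall z, m <= D z.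
Proof.
move=> g0 g1 gc P0 [X1 XD D1 H0 HP].
(* The mean value theorem over one period gives a point of slope 1. *)
have [s _] := @MVT_is_derive R X D 0 1 ltr01 (fun s _ _ => XD s).
have -> : X 1 = X 0 + 1 by rewrite -X1 add0r.
rewrite addrAC subrr add0r subr0 mulr1 => Ds.
move: P0; rewrite le_eqVlt => /predU1P[P0|P0].
  have {}H0 := H0 (esym P0).
  have c0 : 0 < c by have := g0 (X s); rewrite -H0 -Ds mulr1.
  have [|z|zM zMP] := @periodic_max R (fun y => - g y).
  - by move=> y; rewrite g1.
  - by apply: cvgN; exact: gc.
  exists (g zM / c); first by rewrite divr_gt0.
  move=> z; rewrite ler_pdivrMr// [_ * c]mulrC H0.
  by have := zMP (X z); rewrite lerN2.
have {}HP := HP P0.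
have Dc : continuous D by exact: is_derive_continuous HP.
have [zM zMP] := periodic_max D1 Dc.
have [||zm zmP] := @periodic_max R (fun y => - D y).
- by move=> y; rewrite D1.
- by move=> y; apply: cvgN; exact: Dc.
have crit z : (forall y, D y <= D z) \/ (forall y, D z <= D y) -> c * D z = g (X z).
  move=> H; suff : (c * D z - g (X z)) / P = 0.
    move=> /eqP; rewrite mulf_eq0 invr_eq0 (gt_eqF P0) orbF subr_eq0.
    by move/eqP.
  case: H => H.
    apply: (@touch_first R _ D z 1 _ 0 0 1 (HP z) ltr01) => h _.
    by rewrite !mul0r !addr0.
  apply: oppr_inj; rewrite oppr0.
  apply: (@touch_first R _ (fun y => - D y) z 1 _ 0 0 1 _ ltr01) => h.
  by rewrite !mul0r !addr0 lerN2.
have cM := crit zM (or_introl zMP).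
have cm : c * D zm = g (X zm).
  by apply: crit; right => y; have := zmP y; rewrite lerN2.
have DM : 1 <= D zM by rewrite Ds.
have c0 : 0 < c.
  have : 0 < c * D zM by rewrite cM.
  by rewrite pmulr_lgt0// (lt_le_trans _ DM).
exists (D zm); last by move=> z; have := zmP z; rewrite lerN2.
by have : 0 < c * D zm by [rewrite cm]; rewrite pmulr_rgt0.
Qed.

(** Integrating a one-sided Lipschitz bound on the derivative around z. *)
Lemma second_order_upper X D A z r : 0 < r ->
  (forall z, is_derive z (1 : R) X (D z)) ->
  (forall s, `|s| < r -> (D (z + s) - D z) * s <= A * s ^+ 2) ->
  forall s, `|s| < r -> X (z + s) <= X z + D z * s + A / 2 * s ^+ 2.
Proof.
move=> r0 XD H.
pose G s := X (z + s) - D z * s - A / 2 * s ^+ 2.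
have Gd s : is_derive s (1 : R) G (D (z + s) - D z - A * s).
  have Xs : is_derive s (1 : R) (fun h => X (z + h)) (D (z + s)).
    apply/is_derive1_epsP => e e0.
    have [r' r'0 Hr'] := (is_derive1_epsP _ _ _).1 (XD (z + s)) e e0.
    by exists r' => // h hr; rewrite addrA; exact: Hr'.
  apply: is_derive_eq; rewrite /GRing.scale/=; lra.
have G0 : G 0 = X z by rewrite /G addr0; lra.
suff GG s : `|s| < r -> G s <= G 0 by move=> s /GG; rewrite G0 /G; lra.
move=> sr; have [s0|s0|->//] := ltgtP s 0.
  have [x /andP[x0 xs] E] := MVT_is_derive s0 (fun s _ _ => Gd s).
  have xr : `|x| < r.
    by apply: le_lt_trans sr; rewrite !ltr0_norm// lerN2 ltW.
  have := H x xr; move: E; rewrite sub0r => E Hx.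
  have : 0 <= D (z + x) - D z - A * x.
    by rewrite -(nmulr_lle0 _ xs); lra.
  by move=> Hge; have := mulr_ge0_le0 Hge (ltW s0); lra.
have [x /andP[x0 xs] E] := MVT_is_derive s0 (fun s _ _ => Gd s).
have xr : `|x| < r.
  by apply: le_lt_trans sr; rewrite !gtr0_norm// ltW.
have := H x xr; move: E; rewrite subr0 => E Hx.
have : D (z + x) - D z - A * x <= 0.
  by rewrite -(pmulr_lle0 _ x0); lra.
by move=> Hle; have := mulr_le0_ge0 Hle (ltW s0); lra.
Qed.

(** For P > 0 the curvature is (c D - g(X)) / P + delta / P, the last term
    absorbing the remainder of the expansion of D. For P = 0 one has
    D = g(X) / c, so that the Lipschitz constant L B / |c| of D is an upper
    curvature. *)
Lemma cell_upper_corrector g L M P c X D m B :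
  (forall y z, `|g y - g z| <= L * `|y - z|) -> (forall y, `|g y| <= M) ->
  0 <= P -> cell g P c X D -> 0 < m -> (forall z, m <= D z) ->
  (forall z, `|D z| <= B) -> (P = 0 -> c != 0) ->
  exists C, upper_corrector g P c X D C m.
Proof.
move=> gL gM P0 [X1 XD D1 H0 HP] m0 mD DB cn0.
move: P0; rewrite le_eqVlt => /predU1P[P0|P0].
  have {}H0 := H0 (esym P0); have {}cn0 := cn0 (esym P0).
  have L0 : 0 <= L by have := gL 1 0; rewrite subr0 normr1 mulr1; exact: le_trans.
  have B0 : 0 <= B by exact: le_trans (DB 0).
  have C0 : 0 <= L * B / `|c| by rewrite divr_ge0// mulr_ge0.
  exists (L * B / `|c|); split=> // z delta d0; exists (L * B / `|c|); split.
  - by rewrite ger0_norm.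
  - by rewrite -P0 H0 mul0r subrr add0r ltW.
  exists 1 => // s s1; apply: second_order_upper s s1 => // s _.
  apply: le_trans (ler_norm _) _; rewrite normrM -real_normK ?num_real//.
  rewrite expr2 mulrA; apply: ler_wpM2r => //.
  have -> : D (z + s) - D z = c^-1 * (g (X (z + s)) - g (X z)).
    by rewrite -!H0; field.
  rewrite normrM normfV mulrC mulrAC ler_pM2r ?invr_gt0 ?normr_gt0//.
  apply: le_trans (gL _ _) _; rewrite -mulrA ler_wpM2l//.
  by apply: le_trans (derive_le_growth _ _ XD DB) _; rewrite addrAC subrr add0r.
have {}HP := HP P0.
exists ((`|c| * B + M) / P + 1 / P); split=> // z delta d0.
set d' := Num.min delta 1.
have d'0 : 0 < d' by rewrite lt_min d0 ltr01.
have d'1 : d' <= 1 by rewrite ge_min lexx orbT.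
have d'd : d' <= delta by rewrite ge_min lexx.
set l := (c * D z - g (X z)) / P.
exists (l + d' / P); split.
- apply: le_trans (ler_normD _ _) _; apply: lerD.
    rewrite /l normrM normfV (gtr0_norm P0) ler_pM2r ?invr_gt0//.
    apply: le_trans (ler_normB _ _) _; rewrite normrM; apply: lerD => //.
    exact: ler_wpM2l.
  by rewrite ger0_norm ?ler_pM2r ?invr_gt0// divr_ge0// ltW.
- have -> : P * (l + d' / P) = c * D z - g (X z) + d' by rewrite /l; field; lra.
  by rewrite lerD2l.
have e0 : 0 < d' / P by rewrite divr_gt0.
have [r r0 Hr] := (is_derive1_epsP _ _ _).1 (HP z) _ e0.
exists r => // s sr; apply: second_order_upper s sr => // s sr.
have := Hr s sr; rewrite ler_norml => /andP[H1 H2].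
have [s0|s0] := leP 0 s.
  move: H2; rewrite (ger0_norm s0) -/l => H2.
  have : D (z + s) - D z <= (l + d' / P) * s by lra.
  by move=> /(ler_wpM2r s0); rewrite expr2 mulrA.
move: H1; rewrite (ltr0_norm s0) -/l => H1.
have : (l + d' / P) * s <= D (z + s) - D z by lra.
by move=> /(ler_wnM2r (ltW s0)); rewrite expr2 mulrA.
Qed.
End CellExtension.

Section CellSolution.
Variables (R : realType) (n : nat).
Implicit Types (f k g X D chi : R -> R) (P c C L B M m r s h y z l e d : R) (p : 'rV[R]_n).

(** The extension of chi from [0, 1] to the line for which
    X(z + 1) = X(z) + 1. *)
Definition lift_extension chi z : R :=
  chi (z - (Num.floor z)%:~R) + (Num.floor z)%:~R.

Lemma lift_extension_shift chi z :
  lift_extension chi (z + 1) = lift_extension chi z + 1.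
Proof.
rewrite /lift_extension -[1]/(1%:~R) floorDrz ?intr_int// floor1 intrD.
by rewrite opprD addrACA subrr addr0 addrA.
Qed.

Lemma lift_extension_right chi z : chi 1 = chi 0 + 1 -> 0 <= z <= 1 ->
  lift_extension chi z = chi z.
Proof.
move=> chi1 /andP[z0]; rewrite le_eqVlt => /predU1P[->|z1].
  by rewrite -[1 in LHS]add0r lift_extension_shift /lift_extension floor0 subr0 addr0.
have : Num.floor z = 0 by apply/eqP; rewrite floor_eq z0.
by rewrite /lift_extension => ->; rewrite subr0 addr0.
Qed.

Lemma lift_extension_left chi z : chi 1 = chi 0 + 1 -> -1 <= z <= 0 ->
  lift_extension chi z = chi (z + 1) - 1.
Proof.
move=> chi1 /andP[z0 z1]; apply/eqP; rewrite eq_sym subr_eq.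
rewrite -lift_extension_shift lift_extension_right//.
by apply/andP; split; lra.
Qed.

Lemma enorm_eq0 p : (enorm p == 0) = (p == 0).
Proof.
rewrite /enorm sqrtr_eq0; apply/idP/eqP => [H|->]; last first.
  by rewrite big1// => i _; rewrite mxE expr0n.
apply/rowP => i; rewrite mxE; apply/eqP; rewrite -sqrf_eq0 eq_le sqr_ge0 andbT.
apply: le_trans H; rewrite (bigD1 i)//= lerDl sumr_ge0// => j _.
exact: sqr_ge0.
Qed.

(** The periodicity of chi' at the end points is what makes the extension
    differentiable at the integers. *)
Lemma open_cell_of_solution g p c chi : cell_solution g p c chi ->
  exists X D, open_cell g (enorm p ^+ 2) c X D.
Proof.
move=> [_ chid ode chi1 [d [dr dl]]].
pose X := lift_extension chi.
have X1 : forall z, X (z + 1) = X z + 1 by exact: lift_extension_shift.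
have Xin z : 0 < z < 1 -> is_derive z (1 : R) X (derive1 chi z).
  move=> /andP[z0 z1]; have [+ _] := chid z (introT andP (conj z0 z1)).
  move=> /derivableP; rewrite -derive1E; apply: (@is_derive_local _ _ _ _ _ (Num.min z (1 - z))).
    by rewrite lt_min z0 subr_gt0.
  move=> h; rewrite lt_min !ltr_norml => /andP[/andP[? ?] /andP[? ?]].
  by apply: lift_extension_right => //; apply/andP; split; lra.
have Xat0 : is_derive (0 : R) (1 : R) X d.
  apply/is_derive1_epsP => e e0.
  move/cvgrPdist_le: dr => /(_ e e0); rewrite near_withinE => /nbhs_ballP[r /= r0 Hr].
  move/cvgrPdist_le: dl => /(_ e e0); rewrite near_withinE => /nbhs_ballP[r' /= r'0 Hr'].
  exists (Num.min (Num.min r r') 1); first by rewrite !lt_min r0 r'0 ltr01.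
  have X0 : X 0 = chi 0 by rewrite /X lift_extension_right// lexx ler01.
  move=> h; rewrite !lt_min add0r => /andP[/andP[hr hr'] h1].
  have [h0|h0|->] := ltgtP h 0.
  - rewrite ltr0_norm// in h1.
    have := Hr' (1 + h); rewrite /ball/= opprD addrA subrr sub0r normrN => /(_ hr').
    have h01 : 1 + h < 1 by lra.
    move=> /(_ h01); rewrite [1 + h - 1]addrAC subrr add0r => H.
    have h0' : h != 0 by rewrite lt_eqF.
    rewrite X0 /X lift_extension_left//; last by apply/andP; split; lra.
    move: H; rewrite -(ler_pM2r (_ : 0 < `|h|)) ?normr_gt0// -normrM mulrBl divfK//.
    by move=> H; apply: norm_le_eqN H _; rewrite chi1 [h + 1]addrC; lra.
  - rewrite gtr0_norm// in h1.
    have := Hr h; rewrite /ball/= sub0r normrN => /(_ hr h0) H.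
    have h0' : h != 0 by rewrite gt_eqF.
    rewrite X0 /X lift_extension_right//; last by apply/andP; split; lra.
    move: H; rewrite -(ler_pM2r (_ : 0 < `|h|)) ?normr_gt0// -normrM mulrBl divfK//.
    by move=> H; apply: norm_le_eqN H _; lra.
  - by rewrite mulr0 !subrr !normr0 mulr0.
have Xd z : exists l, is_derive z (1 : R) X l.
  have [w /andP[w0 w1] [k ->]] := periodic_split z.
  move: w0; rewrite le_eqVlt => /predU1P[<-|w0].
    by exists d; exact: is_derive_lift.
  by exists (derive1 chi w); apply: is_derive_lift => //; apply: Xin; rewrite w0.
have [D XD] := choice Xd.
have Dder z l : is_derive z (1 : R) X l -> D z = l.
  by move=> [_ <-]; have [_ <-] := XD z.
have Din z : 0 < z < 1 -> D z = derive1 chi z by move=> /Xin /Dder.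
exists X, D; split => //.
- by move=> z; apply: Dder; rewrite -[1]/(1%:~R); exact: is_derive_lift.
- move=> P0 z z01; have := ode z z01; rewrite P0 mulr0 sub0r Din//.
  rewrite /X lift_extension_right//; first by lra.
  by case/andP: z01 => /ltW -> /ltW ->.
- move=> P0 z z01.
  have pn0 : p != 0.
    by rewrite -enorm_eq0; apply/eqP => p0; move: P0; rewrite p0 expr0n ltxx.
  have [_ /(_ pn0) /derivableP] := chid z z01.
  have := ode z z01; rewrite Din// /X lift_extension_right//; last first.
    by case/andP: z01 => /ltW -> /ltW ->.
  rewrite derive1nS derive1n1 derive1E => E.
  have -> : (c * derive1 chi z - g (chi z)) / enorm p ^+ 2 = 'D_1 (derive1 chi) z.
    have -> : c * derive1 chi z - g (chi z) = 'D_1 (derive1 chi) z * enorm p ^+ 2 by lra.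
    by rewrite mulfK// gt_eqF.
  case/andP: z01 => z0 z1.
  apply: (@is_derive_local _ _ _ _ _ (Num.min z (1 - z))).
    by rewrite lt_min z0 subr_gt0.
  move=> h; rewrite lt_min !ltr_norml => /andP[/andP[? ?] /andP[? ?]].
  by apply: Din; apply/andP; split; lra.
Qed.

Lemma continuous_of_lipschitz g L :
  (forall y z, `|g y - g z| <= L * `|y - z|) -> continuous g.
Proof.
move=> gL y; apply/cvgrPdist_le => e e0; apply/nbhs_ballP.
have L1 : 0 < `|L| + 1 by rewrite ltr_wpDl.
exists (e / (`|L| + 1)) => /=; first by rewrite divr_gt0.
move=> z; rewrite /ball/= => yz; apply: le_trans (gL _ _) _.
apply: le_trans (_ : (`|L| + 1) * `|y - z| <= _).
  by apply: ler_wpM2r => //; have := ler_norm L; lra.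
by rewrite mulrC -ler_pdivlMr// ltW.
Qed.

(** One cell solution is a corrector from above and, reflected, from below;
    this is where the positivity of g enters. *)
Lemma cell_correctors g L M p c chi :
  (forall y z, `|g y - g z| <= L * `|y - z|) -> (forall y, `|g y| <= M) ->
  periodic g 1 -> (forall y, 0 < g y) -> cell_solution g p c chi ->
  exists X D C m, upper_corrector g (enorm p ^+ 2) c X D C m /\
    upper_corrector (reflect_fun g) (enorm p ^+ 2) (- c) (reflect_fun X)
      (fun z => D (- z)) C m.
Proof.
move=> gL gM g1 g0 /open_cell_of_solution[X [D oc]].
have P0 : 0 <= enorm p ^+ 2 by exact: sqr_ge0.
have ce := cell_of_open gL g1 P0 oc.
have gc := continuous_of_lipschitz gL.
have [m m0 mD] := cell_gt0 g0 g1 gc P0 ce.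
have [B DB] : exists B, forall z, `|D z| <= B.
  move: (P0); rewrite le_eqVlt => /predU1P[E|E]; last first.
    have [zM zMP] := periodic_max (ce_per ce) (is_derive_continuous (ce_ode ce E)).
    by exists (D zM) => z; rewrite gtr0_norm// (lt_le_trans m0).
  have c0 : 0 < c.
    have := g0 (X 0); rewrite -(ce_ode0 ce (esym E)) pmulr_lgt0//.
    exact: lt_le_trans (mD 0).
  exists (M / c) => z; rewrite gtr0_norm; last exact: lt_le_trans (mD z).
  rewrite ler_pdivlMr// mulrC (ce_ode0 ce (esym E)).
  exact: le_trans (ler_norm _) (gM _).
have cn0 : enorm p ^+ 2 = 0 -> c != 0.
  move=> E; have := g0 (X 0); rewrite -(ce_ode0 ce E).
  by apply: contraTneq => ->; rewrite mul0r ltxx.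
have [C1 K1] := cell_upper_corrector gL gM P0 ce m0 mD DB cn0.
have gMr y : `|reflect_fun g y| <= M by rewrite normrN; exact: gM.
have cn0r : enorm p ^+ 2 = 0 -> - c != 0 by move=> /cn0; rewrite oppr_eq0.
have [C2 K2] := cell_upper_corrector (reflect_lipschitz gL) gMr P0 (cell_refl ce)
  m0 (fun z => mD (- z)) (fun z => DB (- z)) cn0r.
have weaken g' P' c' X' D' C C' m' : C <= C' ->
    upper_corrector g' P' c' X' D' C m' -> upper_corrector g' P' c' X' D' C' m'.
  move=> CC [X1 XD m'0 mD' J]; split => // z e e0.
  have [A [AC ? ?]] := J z e e0; exists A; split => //; exact: le_trans CC.
exists X, D, (Num.max C1 C2), m; split.
  by apply: weaken K1; rewrite le_max lexx.
by apply: weaken K2; rewrite le_max lexx orbT.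
Qed.
End CellSolution.

(** * The Euclidean pairing on space-time *)

Section Geometry.
Variables (R : realType) (n : nat).
Local Notation E := ('rV[R]_n * R)%type.
Implicit Types (x y p q : 'rV[R]_n) (z w zeta : E) (r : R).

Definition dotv p x : R := \sum_(i < n) p 0 i * x 0 i.
Definition dote zeta z : R := dotv zeta.1 z.1 + zeta.2 * z.2.

Lemma dotvC x y : dotv x y = dotv y x.
Proof. by apply: eq_bigr => i _; rewrite mulrC. Qed.
Lemma dotvDl x y p : dotv (x + y) p = dotv x p + dotv y p.
Proof. by rewrite -big_split; apply: eq_bigr => i _; rewrite mxE mulrDl. Qed.
Lemma dotvZl r x p : dotv (r *: x) p = r * dotv x p.
Proof. by rewrite mulr_sumr; apply: eq_bigr => i _; rewrite mxE mulrA. Qed.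
Lemma dotvDr x y p : dotv p (x + y) = dotv p x + dotv p y.
Proof. by rewrite ![dotv p _]dotvC dotvDl. Qed.
Lemma dotvZr r x p : dotv p (r *: x) = r * dotv p x.
Proof. by rewrite ![dotv p _]dotvC dotvZl. Qed.
Lemma dotvNl x p : dotv (- x) p = - dotv x p.
Proof. by rewrite -scaleN1r dotvZl mulN1r. Qed.
Lemma dotvNr x p : dotv p (- x) = - dotv p x.
Proof. by rewrite ![dotv p _]dotvC dotvNl. Qed.
Lemma dotv_ge0 x : 0 <= dotv x x.
Proof. by apply: sumr_ge0 => i _; rewrite -expr2 sqr_ge0. Qed.
Lemma dotv_delta p i : dotv p (delta_mx 0 i) = p 0 i.
Proof.
rewrite /dotv (bigD1 i)//= mxE !eqxx mulr1 big1 ?addr0// => j /negPf ji.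
by rewrite mxE ji andbF mulr0.
Qed.
Lemma dotv_sq x : dotv x x = enorm x ^+ 2.
Proof.
rewrite /enorm sqr_sqrtr; first by apply: eq_bigr => i _; rewrite -expr2.
by apply: sumr_ge0 => i _; exact: sqr_ge0.
Qed.

Lemma doteC z w : dote z w = dote w z.
Proof. by rewrite /dote dotvC mulrC. Qed.
Lemma doteDl z w zeta : dote (z + w) zeta = dote z zeta + dote w zeta.
Proof. by rewrite /dote dotvDl mulrDl addrACA. Qed.
Lemma doteZl r z zeta : dote (r *: z) zeta = r * dote z zeta.
Proof. by rewrite /dote dotvZl -mulrA mulrDr. Qed.
Lemma doteDr z w zeta : dote zeta (z + w) = dote zeta z + dote zeta w.
Proof. by rewrite ![dote zeta _]doteC doteDl. Qed.
Lemma doteZr r z zeta : dote zeta (r *: z) = r * dote zeta z.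
Proof. by rewrite ![dote zeta _]doteC doteZl. Qed.
Lemma doteNl z w : dote (- z) w = - dote z w.
Proof. by rewrite -scaleN1r doteZl mulN1r. Qed.
Lemma doteNr z w : dote w (- z) = - dote w z.
Proof. by rewrite ![dote w _]doteC doteNl. Qed.
Lemma dote0r w : dote w 0 = 0.
Proof. by rewrite -(scale0r w) doteZr mul0r. Qed.

Lemma coord_le x i : `|x 0 i| <= `|x|.
Proof.
rewrite [leRHS]/Num.norm/= mx_normrE; apply/bigmax_geP; right => /=.
by exists (ord0, i).
Qed.

Lemma norm_rowP x : (0 < n)%N -> exists i, `|x| = `|x 0 i|.
Proof.
move=> n0; have [->|x0] := eqVneq x 0.
  by exists (Ordinal n0); rewrite mxE !normr0.
have [] := @mx_norm_neq0 R 1 n x; first by rewrite -normr_eq0 in x0.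
by move=> [i j] /= H; exists j; rewrite [LHS]H ord1.
Qed.

(** Lipschitz bounds are in the maximum norm, penalties and paraboloids in the
    Euclidean one; this and [dotv_le] pass between the two. *)
Lemma norm_sq_dotv x : `|x| ^+ 2 <= dotv x x.
Proof.
have [n0|] := posnP n; last first.
  move=> /(norm_rowP x)[i ->]; rewrite real_normK ?num_real//.
  by rewrite /dotv (bigD1 i)//= -expr2 lerDl sumr_ge0// => j _; rewrite -expr2 sqr_ge0.
have -> : x = 0 by apply/rowP => i; exfalso; case: i; rewrite n0.
by rewrite normr0 expr0n dotv_ge0.
Qed.

Lemma dotv_le p x : `|dotv p x| <= n%:R * `|p| * `|x|.
Proof.
apply: le_trans (ler_norm_sum _ _ _) _.
apply: le_trans (ler_sum _ (_ : forall i, true -> _ <= `|p| * `|x|)) _.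
  by move=> i _; rewrite normrM ler_pM// coord_le.
by rewrite sumr_const card_ord -mulrA mulr_natl.
Qed.

Lemma norm_prodE z : `|z| = Num.max `|z.1| `|z.2|.
Proof. by []. Qed.
Lemma prod_norm1 z : `|z.1| <= `|z|.
Proof. by rewrite [leRHS]/Num.norm/= le_max lexx. Qed.
Lemma prod_norm2 z : `|z.2| <= `|z|.
Proof. by rewrite [leRHS]/Num.norm/= le_max lexx orbT. Qed.
Lemma prod_norm_le z r : `|z.1| <= r -> `|z.2| <= r -> `|z| <= r.
Proof. by move=> ? ?; rewrite [leLHS]/Num.norm/= ge_max; apply/andP. Qed.

Lemma dote_ge0 z : 0 <= dote z z.
Proof. by rewrite addr_ge0 ?dotv_ge0// -expr2 sqr_ge0. Qed.

Lemma norm_sq_dote z : `|z| ^+ 2 <= dote z z.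
Proof.
have [zz|/ltW zz] := leP `|z.1| `|z.2|.
  have -> : `|z| = `|z.2| by rewrite norm_prodE max_r.
  by rewrite real_normK ?num_real// /dote expr2 lerDr dotv_ge0.
have -> : `|z| = `|z.1| by rewrite norm_prodE max_l.
by apply: le_trans (norm_sq_dotv _) _; rewrite lerDl -expr2 sqr_ge0.
Qed.

Lemma dote_le zeta z : `|dote zeta z| <= n.+1%:R * `|zeta| * `|z|.
Proof.
apply: le_trans (ler_normD _ _) _; rewrite -natr1 !mulrDl mul1r; apply: lerD.
  apply: le_trans (dotv_le _ _) _; rewrite -!mulrA ler_wpM2l//.
  by rewrite ler_pM// prod_norm1.
by rewrite normrM ler_pM// prod_norm2.
Qed.

Lemma compact_box z r : compact [set w : E | `|w - z| <= r].
Proof.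
have cl (V : normedModType R) (x : V) : closed [set y : V | `|y - x| <= r].
  apply: (@preimage_closed _ _ (fun y : V => `|y - x|) [set y : R | y <= r]).
    move=> y _; apply: cvg_norm; apply: cvgB; [exact: cvg_id|exact: cvg_cst].
  exact: closed_le.
have -> : [set w : E | `|w - z| <= r] =
    [set x | `|x - z.1| <= r] `*` [set t | `|t - z.2| <= r].
  apply/seteqP; split => w /=.
    by move=> H; split; [exact: le_trans (prod_norm1 (w - z)) H|exact: le_trans (prod_norm2 (w - z)) H].
  by move=> [H1 H2]; exact: (prod_norm_le (z := w - z)).
apply: compact_setX.
  apply: bounded_closed_compact; last exact: cl.
  exists (`|z.1| + r); split; first exact: num_real.
  move=> M rM x /= xr; rewrite -(subrK z.1 x); apply: le_trans (ler_normD _ _) _.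
  by rewrite addrC; apply: le_trans (ltW rM); rewrite lerD2l.
have -> : [set t | `|t - z.2| <= r] = `[z.2 - r, z.2 + r]%classic.
  by apply/seteqP; split => t /=; rewrite in_itv/= ler_distl.
exact: segment_compact.
Qed.

Section Cvg.
Variables (T : Type) (F : set_system T).
Context {FF : Filter F}.
Implicit Types f g : T -> 'rV[R]_n.

Lemma cvg_coord f x i : f t @[t --> F] --> x -> f t 0 i @[t --> F] --> x 0 i.
Proof.
apply: (@continuous_cvg _ _ _ F FF f (fun z : 'rV[R]_n => z 0 i) x).
exact: coord_continuous.
Qed.

Lemma cvg_pr1 (h : T -> E) z : h t @[t --> F] --> z -> (h t).1 @[t --> F] --> z.1.
Proof.
by apply: (@continuous_cvg _ _ _ F FF h fst z); exact: cvg_fst.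
Qed.

Lemma cvg_pr2 (h : T -> E) z : h t @[t --> F] --> z -> (h t).2 @[t --> F] --> z.2.
Proof.
by apply: (@continuous_cvg _ _ _ F FF h snd z); exact: cvg_snd.
Qed.

Lemma cvg_dotv f g x y : f i @[i --> F] --> x -> g i @[i --> F] --> y ->
  dotv (f i) (g i) @[i --> F] --> dotv x y.
Proof.
move=> fx gy.
apply: (@cvg_big _ _ +%R 0 xpredT (@add_continuous R) T F (index_enum 'I_n)
  (fun i t => f t 0 i * g t 0 i) (fun i => x 0 i * y 0 i)) => i _.
by apply: cvgM; exact: cvg_coord.
Qed.

Lemma cvg_dote (f g : T -> E) z w : f i @[i --> F] --> z -> g i @[i --> F] --> w ->
  dote (f i) (g i) @[i --> F] --> dote z w.
Proof.
move=> fz gw; apply: cvgD.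
  by apply: cvg_dotv; exact: cvg_pr1.
by apply: cvgM; exact: cvg_pr2.
Qed.
End Cvg.
End Geometry.

(** * Viscosity solutions tested with paraboloids *)

Section Prox.
Variables (R : realType) (n : nat).
Local Notation E := ('rV[R]_n * R)%type.
Implicit Types (x y p q : 'rV[R]_n) (z w v zeta : E) (r s K L : R) (u f : E -> R).

(** Subsolution of u_t = F(grad u), tested with paraboloids that touch u from
    above globally: the differentials of such paraboloids form the proximal
    superdifferential of u. Global contact with explicit test functions is
    convenient for doubling variables and for perturbed test functions.
    Supersolutions are the functions whose opposite is a [prox_sub] for
    p |-> - F(- p). *)
Definition prox_sub (F : 'rV[R]_n -> R) u : Prop :=
  forall z zeta K, 0 < z.2 ->
    (forall w, 0 <= w.2 ->
       u w <= u z + dote zeta (w - z) + K * dote (w - z) (w - z)) ->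
    zeta.2 <= F zeta.1.

Definition lip_half L u : Prop :=
  forall z w, 0 <= z.2 -> 0 <= w.2 -> `|u z - u w| <= L * `|z - w|.

Definition paraboloid zeta K z w : R :=
  dote zeta (w - z) + K * dote (w - z) (w - z).

Lemma is_derive_quadratic f z v (l k : R) :
  (forall h : R, f (h *: v + z) = f z + h * l + h ^+ 2 * k) ->
  is_derive z v f l.
Proof.
move=> H; apply/is_derive_epsP => e e0; have k0 : 0 < `|k| + 1 by rewrite ltr_wpDl.
exists (e / (`|k| + 1)) => [|h hr]; first by rewrite divr_gt0.
have -> : f (h *: v + z) - f z - h * l = h ^+ 2 * k by rewrite H; lra.
rewrite normrM normrX expr2 mulrC mulrA ler_wpM2r//.
have : (`|k| + 1) * `|h| <= e by rewrite mulrC -ler_pdivlMr// ltW.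
by have := normr_ge0 h; lra.
Qed.

Lemma is_derive_paraboloid zeta K z1 z v :
  is_derive z v (paraboloid zeta K z1) (dote zeta v + 2 * K * dote (z - z1) v).
Proof.
apply: (@is_derive_quadratic _ _ _ _ (K * dote v v)) => h.
have E0 : h *: v + z - z1 = h *: v + (z - z1) by rewrite addrA.
rewrite /paraboloid E0; move: (z - z1) => a.
rewrite !(doteDl, doteDr, doteZl, doteZr) (doteC v a); lra.
Qed.

Lemma dote_time zeta : dote zeta (time_dir R n) = zeta.2.
Proof.
rewrite /dote/= mulr1 /dotv big1 ?add0r// => i _; by rewrite mxE mulr0.
Qed.

Lemma dote_space zeta i : dote zeta (space_dir R i) = zeta.1 0 i.
Proof. by rewrite /dote/= mulr0 addr0 dotv_delta. Qed.

Lemma dt_paraboloid zeta K z1 :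
  dt (paraboloid zeta K z1) = fun z => zeta.2 + 2 * K * (z.2 - z1.2).
Proof.
apply/funext => z; rewrite /dt.
by have [_ ->] := is_derive_paraboloid zeta K z1 z (time_dir R n); rewrite !dote_time.
Qed.

Lemma dx_paraboloid zeta K z1 i :
  dx i (paraboloid zeta K z1) = fun z => zeta.1 0 i + 2 * K * (z.1 - z1.1) 0 i.
Proof.
apply/funext => z; rewrite /dx.
by have [_ ->] := is_derive_paraboloid zeta K z1 z (space_dir R i); rewrite !dote_space.
Qed.

Lemma grad_paraboloid zeta K z : grad (paraboloid zeta K z) z = zeta.1.
Proof.
by apply/rowP => i; rewrite mxE dx_paraboloid subrr mxE mulr0 addr0.
Qed.

Lemma paraboloid_C1 zeta K z1 : C1_open_half (paraboloid zeta K z1).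
Proof.
move=> z _; split.
- exact: (@ex_derive _ _ _ _ _ _ _ (is_derive_paraboloid zeta K z1 z _)).
- rewrite dt_paraboloid => w; apply: cvgD; first exact: cvg_cst.
  apply: cvgM; first exact: cvg_cst.
  by apply: cvgB; [apply: cvg_pr2; exact: cvg_id|exact: cvg_cst].
move=> i; split.
  exact: (@ex_derive _ _ _ _ _ _ _ (is_derive_paraboloid zeta K z1 z _)).
rewrite dx_paraboloid => w; apply: cvgD; first exact: cvg_cst.
apply: cvgM; first exact: cvg_cst.
by apply: cvg_coord; apply: cvgB; [apply: cvg_pr1; exact: cvg_id|exact: cvg_cst].
Qed.

Lemma near_open_half z (P : E -> Prop) : 0 < z.2 -> (forall w, 0 <= w.2 -> P w) ->
  \forall w \near z, P w.
Proof.
move=> z0 HP; apply/nbhs_ballP; exists z.2 => //= w [_ zw]; apply: HP.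
move: zw; rewrite /ball/= => zw; have := ler_norm (z.2 - w.2); lra.
Qed.

Lemma viscosity_sub_prox (H : R -> R) u : viscosity_subsolution H u ->
  prox_sub (fun p => H (enorm p)) u.
Proof.
move=> uH z zeta K z0 uz.
have := uH (paraboloid zeta K z) z (paraboloid_C1 zeta K z) z0.
rewrite grad_paraboloid dt_paraboloid subrr mulr0 addr0 subr_le0; apply.
apply: near_open_half => // w w0; have := uz w w0.
by rewrite /paraboloid subrr !dote0r; lra.
Qed.

Lemma viscosity_super_prox (H : R -> R) u : viscosity_supersolution H u ->
  prox_sub (fun p => - H (enorm (- p))) (fun w => - u w).
Proof.
move=> uH z zeta K z0 uz.
have := uH (paraboloid (- zeta) (- K) z) z (paraboloid_C1 _ _ z) z0.
rewrite grad_paraboloid dt_paraboloid subrr mulr0 addr0 /= => Hz.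
suff : 0 <= - zeta.2 - H (enorm (- zeta.1)) by lra.
apply: Hz; apply: near_open_half => // w w0; have := uz w w0.
by rewrite /paraboloid subrr !dote0r doteNl; lra.
Qed.
End Prox.

Section FirstOrderExpansion.
Variables (R : realType) (n : nat).
Local Notation E := ('rV[R]_n * R)%type.
Implicit Types (x y p q : 'rV[R]_n) (z w v zeta : E) (r s e K L : R) (u f phi : E -> R).

Lemma row_norm_le x r : 0 <= r -> (forall i, `|x 0 i| <= r) -> `|x| <= r.
Proof.
move=> r0 xr; have [n0|/(norm_rowP x)[i ->]//] := posnP n.
have -> : x = 0 by apply/rowP => i; exfalso; case: i; rewrite n0.
by rewrite normr0.
Qed.

Lemma is_derive_scale_dir f z v (c l : R) :
  is_derive z v f l -> is_derive z (c *: v) f (c * l).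
Proof.
move=> /is_derive_epsP H; apply/is_derive_epsP => e e0.
have c0 : 0 < `|c| + 1 by rewrite ltr_wpDl.
have e'0 : 0 < e / (`|c| + 1) by rewrite divr_gt0.
have [r r0 Hr] := H _ e'0.
exists (r / (`|c| + 1)); first by rewrite divr_gt0.
move=> h hr; rewrite scalerA mulrA.
have ch : `|h * c| <= (`|c| + 1) * `|h|.
  by rewrite normrM mulrDl mul1r mulrC lerDl.
apply: le_trans (Hr _ _) _.
  by apply: le_lt_trans ch _; rewrite mulrC -ltr_pdivlMr.
rewrite mulrAC ler_pdivrMr// -mulrA; apply: ler_wpM2l; first exact: ltW.
by rewrite [leRHS]mulrC.
Qed.

Lemma increment_le f (a v : E) (l e : R) :
  (forall s, 0 <= s -> s <= 1 -> exists2 k, is_derive (s *: v + a) v f k & `|k - l| <= e) ->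
  `|f (v + a) - f a - l| <= e.
Proof.
move=> H.
have [||s /andP[s0 s1]] := @MVT_slice _ _ f (fun w => 'D_v f w) a v 1.
- exact: ltr01.
- by move=> s s0 s1; have [k [fk <-] _] := H s s0 s1; exact: derivableP.
rewrite scale1r mulr1 => ->.
by have [k [_ ->] ?] := H s (ltW s0) (ltW s1).
Qed.

(** Continuity of the partial derivatives gives differentiability in the sense
    of Frechet: join z to w by moving the time first and then one space
    coordinate after the other, and apply the mean value theorem to each step. *)
Lemma C1_first_order phi z e : C1_open_half phi -> 0 < z.2 -> 0 < e ->
  exists2 r, 0 < r & forall w, `|w - z| < r ->
    `|phi w - phi z - dote (grad phi z, dt phi z) (w - z)| <= e * `|w - z|.
Proof.
move=> phiC z0 e0; have [_ dtc dxc] := phiC z z0.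
have e'0 : 0 < e / n.+1%:R by rewrite divr_gt0.
set e' := e / _ in e'0.
have : \forall w \near z, `|dt phi w - dt phi z| <= e' /\
    forall i, `|dx i phi w - dx i phi z| <= e'.
  apply: filterI.
    move/cvgrPdist_le: dtc => /(_ _ e'0); apply: filterS => w.
    by rewrite distrC.
  apply: (@filter_forall _ _ (fun i w => `|dx i phi w - dx i phi z| <= e') (nbhs z)) => i.
  have [_ +] := dxc i.
  move=> /cvgrPdist_le/(_ _ e'0); apply: filterS => w.
  by rewrite distrC.
move=> /nbhs_ballP[r0 /= r00 Hr0].
have {}Hr0 w : `|w - z| < r0 -> `|dt phi w - dt phi z| <= e' /\
    forall i, `|dx i phi w - dx i phi z| <= e'.
  by move=> wz; apply: Hr0; rewrite -ball_normE /ball_/= distrC.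
exists (Num.min r0 z.2); first by rewrite lt_min r00.
move=> w; rewrite lt_min => /andP[wr0 wz2].
set h := w - z.
have pos w' : `|w' - z| <= `|h| -> 0 < w'.2.
  move=> H; have := le_lt_trans H wz2 => {}H.
  have := le_lt_trans (prod_norm2 (w' - z)) H; rewrite ltr_norml => /andP[+ _].
  by rewrite /=; lra.
(* After the move in time, k coordinates have been moved. *)
pose pk k : E := (\row_j (if (j < k)%N then w.1 0 j else z.1 0 j), w.2).
have p0 : pk 0%N = h.2 *: time_dir R n + z.
  congr (_, _) => /=; last by rewrite [_ *: _]mulr1 subrK.
  by apply/rowP => j; rewrite scaler0 add0r mxE.
have pn : pk n = w.
  rewrite [RHS]surjective_pairing; congr (_, _).
  by apply/rowP => j; rewrite mxE ltn_ord.
have pS (k : 'I_n) : pk k.+1 = h.1 0 k *: space_dir R k + pk k.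
  congr (_, _) => /=; last by rewrite scaler0 add0r.
  apply/rowP => j; rewrite !mxE eqxx /= ltnS leq_eqVlt -val_eqE /=.
  have [jk|jk] /= := eqVneq (j : nat) k; last by rewrite mulr0 add0r.
  have -> : j = k by exact: val_inj.
  by rewrite ltnn mulr1 subrK.
have hn i : `|h.1 0 i| <= `|h| by apply: le_trans (coord_le _ _) (prod_norm1 h).
have timestep : `|phi (pk 0%N) - phi z - h.2 * dt phi z| <= e' * `|h|.
  rewrite p0; apply: increment_le => s s0 s1.
  have sz : `|s *: (h.2 *: time_dir R n) + z - z| <= `|h|.
    rewrite addrK; apply: prod_norm_le => /=.
      by rewrite !scaler0 normr0.
    rewrite normrM [_ *: _]mulr1 (ger0_norm s0).
    by apply: le_trans (prod_norm2 h); rewrite ler_piMl.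
  exists (h.2 * dt phi (s *: (h.2 *: time_dir R n) + z)).
    have [d _ _] := phiC _ (pos _ sz).
    by apply: is_derive_scale_dir; exact: derivableP.
  have [H _] := Hr0 _ (le_lt_trans sz wr0).
  rewrite -mulrBr normrM mulrC; apply: ler_pM => //; exact: prod_norm2.
have spacestep (k : 'I_n) :
    `|phi (pk k.+1) - phi (pk k) - h.1 0 k * dx k phi z| <= e' * `|h|.
  rewrite pS; apply: increment_le => s s0 s1.
  have sz : `|s *: (h.1 0 k *: space_dir R k) + pk k - z| <= `|h|.
    apply: prod_norm_le => /=; last first.
      by rewrite !scaler0 add0r; exact: (prod_norm2 h).
    apply: row_norm_le => // j; rewrite !mxE eqxx /= -val_eqE /=.
    have [jk|jk] /= := eqVneq (j : nat) k.
      have -> : j = k by exact: val_inj.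
      rewrite ltnn mulr1 addrK normrM (ger0_norm s0).
      by have := hn k; rewrite !mxE; apply: le_trans; rewrite ler_piMl.
    rewrite !mulr0 add0r; case: ifP => _; last by rewrite subrr normr0.
    by have := hn j; rewrite !mxE.
  exists (h.1 0 k * dx k phi (s *: (h.1 0 k *: space_dir R k) + pk k)).
    have [_ _ /(_ k)[d _]] := phiC _ (pos _ sz).
    by apply: is_derive_scale_dir; exact: derivableP.
  have [_ /(_ k) H] := Hr0 _ (le_lt_trans sz wr0).
  rewrite -mulrBr normrM mulrC; apply: ler_pM => //; exact: hn.
have tele : \sum_(i < n) (phi (pk i.+1) - phi (pk i)) = phi (pk n) - phi (pk 0%N).
  rewrite -(big_mkord xpredT (fun i => phi (pk i.+1) - phi (pk i))).
  by rewrite telescope_sumr.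
have -> : phi w - phi z - dote (grad phi z, dt phi z) h =
   (phi (pk 0%N) - phi z - h.2 * dt phi z) +
   \sum_(i < n) (phi (pk i.+1) - phi (pk i) - h.1 0 i * dx i phi z).
  rewrite sumrB tele pn /dote /dotv /=.
  under [X in _ - (X + _)]eq_bigr do rewrite mxE mulrC.
  by rewrite (mulrC (dt phi z)); lra.
apply: le_trans (ler_normD _ _) _.
have -> : e * `|h| = e' * `|h| + \sum_(i < n) e' * `|h|.
  have -> : e = e' * n.+1%:R by rewrite divfK ?pnatr_eq0.
  by rewrite sumr_const card_ord -mulrS mulrAC mulr_natr.
apply: lerD => //; apply: le_trans (ler_norm_sum _ _ _) _.
by apply: ler_sum => i _; exact: spacestep.
Qed.

End FirstOrderExpansion.

Section ProxViscosity.
Variables (R : realType) (n : nat).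
Local Notation E := ('rV[R]_n * R)%type.
Implicit Types (x y p q : 'rV[R]_n) (z w v zeta : E) (r s e K L : R) (u f phi : E -> R).

Lemma closed_closed_half : closed (@closed_half R n).
Proof.
apply: (@preimage_closed _ _ snd [set y : R | 0 <= y]); last exact: closed_ge.
by move=> y _; exact: cvg_snd.
Qed.

Lemma box_max f z0 r : 0 <= r -> 0 <= z0.2 ->
  {within @closed_half R n, continuous f} ->
  exists zb, [/\ `|zb - z0| <= r, 0 <= zb.2 &
    forall w, `|w - z0| <= r -> 0 <= w.2 -> f w <= f zb].
Proof.
move=> r0 z00 fc; pose A := [set w | `|w - z0| <= r] `&` @closed_half R n.
have cA : compact A.
  by apply: compact_closedI; [exact: compact_box|exact: closed_closed_half].
have A0 : A !=set0 by exists z0; split => //=; rewrite subrr normr0.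
have [|zb + H] := @compact_EVT_max _ R f A A0 cA.
  by apply: continuous_subspaceW fc => w [].
rewrite inE => -[zr zp]; exists zb; split => // w wr w0; apply: H.
by rewrite inE; split.
Qed.

(** Continuity on the closed half-space, freed from the subspace topology. *)
Lemma within_half_epsP f : {within @closed_half R n, continuous f} <->
  forall z, 0 <= z.2 -> forall e, 0 < e -> exists2 r, 0 < r &
    forall w, 0 <= w.2 -> `|w - z| < r -> `|f w - f z| <= e.
Proof.
split => [/subspace_continuousP H z z0 e e0|H].
  have /cvgrPdist_le/(_ e e0) := H z z0.
  rewrite near_withinE => /nbhs_ballP[r /= r0 Hr]; exists r => // w w0 wz.
  by rewrite distrC; apply: Hr => //; rewrite -ball_normE /ball_/= distrC.
apply/subspace_continuousP => z z0; apply/cvgrPdist_le => e e0.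
have [r r0 Hr] := H z z0 e e0.
rewrite near_withinE; apply/nbhs_ballP; exists r => //= w.
by rewrite -ball_normE /ball_/= distrC => wz w0; rewrite distrC; exact: Hr.
Qed.

Lemma lip_half_continuous L u : lip_half L u ->
  {within @closed_half R n, continuous u}.
Proof.
move=> uL; apply/within_half_epsP => z z0 e e0.
have L0 : 0 < `|L| + 1 by rewrite ltr_wpDl.
exists (e / (`|L| + 1)) => [|w w0 wz]; first by rewrite divr_gt0.
apply: le_trans (uL _ _ w0 z0) _.
have : (`|L| + 1) * `|w - z| <= e by rewrite mulrC -ler_pdivlMr// ltW.
have : L * `|w - z| <= `|L| * `|w - z| by rewrite ler_wpM2r// ler_norm.
by have := normr_ge0 (w - z); lra.
Qed.

Lemma dote_sub_continuous (zeta z0 : E) : continuous (fun w => dote zeta (w - z0)).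
Proof.
move=> w; apply: cvg_dote; first exact: cvg_cst.
by apply: cvgB; [exact: cvg_id|exact: cvg_cst].
Qed.

Lemma dote_sq_continuous (z0 : E) : continuous (fun w => dote (w - z0) (w - z0)).
Proof.
by move=> w; apply: cvg_dote; (apply: cvgB; [exact: cvg_id|exact: cvg_cst]).
Qed.

Lemma paraboloid_continuous zeta K z1 : continuous (paraboloid (R := R) (n := n) zeta K z1).
Proof.
move=> w; apply: cvgD; first exact: dote_sub_continuous.
by apply: cvgM; [exact: cvg_cst|exact: dote_sq_continuous].
Qed.

(** A paraboloid seen from another point is again a paraboloid, of the same
    opening, with its differential there as linear part. *)
Lemma paraboloid_recenter zeta K z0 z1 w :
  paraboloid zeta K z0 w = paraboloid zeta K z0 z1 +
    dote (zeta + (2 * K) *: (z1 - z0)) (w - z1) + K * dote (w - z1) (w - z1).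
Proof.
rewrite /paraboloid; have -> : w - z0 = (w - z1) + (z1 - z0) by rewrite addrA subrK.
move: (w - z1) (z1 - z0) => a b.
rewrite !(doteDl, doteDr, doteZl, doteZr) (doteC b a); lra.
Qed.

(** Contact of a paraboloid inside a ball becomes global after an increase of
    its opening, because a Lipschitz function grows linearly at most. *)
Lemma prox_sub_local F u L z zeta K r : prox_sub F u -> lip_half L u ->
  0 < z.2 -> 0 < r ->
  (forall w, 0 <= w.2 -> `|w - z| <= r ->
     u w <= u z + dote zeta (w - z) + K * dote (w - z) (w - z)) ->
  zeta.2 <= F zeta.1.
Proof.
move=> uF uL z0 r0 uw.
(* With this opening the quadratic term dominates the linear growth beyond
   distance r. *)
pose K' := (`|L| + n.+1%:R * `|zeta|) / r.
have K'0 : 0 <= K' by rewrite divr_ge0 ?(ltW r0)// addr_ge0// mulr_ge0.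
apply: (uF z zeta (`|K| + K') z0) => w w0.
have dw := dote_ge0 (w - z).
have [wr|wr] := leP `|w - z| r.
  apply: le_trans (uw w w0 wr) _; rewrite lerD2l; apply: ler_wpM2r => //.
  by rewrite -[leLHS]addr0; apply: lerD => //; exact: ler_norm.
have H1 : u w - u z <= `|L| * `|w - z|.
  apply: le_trans (ler_norm _) _; apply: le_trans (uL _ _ w0 (ltW z0)) _.
  by rewrite ler_wpM2r// ler_norm.
have H2 : - dote zeta (w - z) <= n.+1%:R * `|zeta| * `|w - z|.
  by apply: le_trans (ler_norm _) _; rewrite normrN dote_le.
have H3 : (`|L| + n.+1%:R * `|zeta|) * `|w - z| <= K' * dote (w - z) (w - z).
  apply: le_trans (_ : K' * `|w - z| ^+ 2 <= _); last first.
    by rewrite ler_wpM2l// norm_sq_dote.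
  rewrite expr2 mulrA; apply: ler_wpM2r => //.
  rewrite /K' mulrAC ler_pdivlMr// ler_wpM2l ?(ltW wr)//.
have : 0 <= `|K| * dote (w - z) (w - z) by rewrite mulr_ge0.
lra.
Qed.

(** The test function phi enters through its first-order expansion only.
    Subtracting zeta . (w - z) + k |w - z|^2 from u and maximising over a small
    ball gives a point, at distance at most d / k from z, at which a paraboloid
    with differential within 2 d of zeta touches u. Continuity of F lets d
    tend to 0. *)
Lemma prox_viscosity F u L phi z zeta : prox_sub F u -> lip_half L u ->
  {for zeta.1, continuous F} ->
  (forall e, 0 < e -> exists2 r, 0 < r & forall w, `|w - z| < r ->
    `|phi w - phi z - dote zeta (w - z)| <= e * `|w - z|) -> 0 < z.2 ->
  (\forall w \near z, u w - phi w <= u z - phi z) ->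
  zeta.2 <= F zeta.1.
Proof.
move=> uF uL Fc phiC z0 uphi; rewrite leNgt; apply/negP => dF.
have d0 : 0 < (zeta.2 - F zeta.1) / 2 by lra.
move/cvgrPdist_le: Fc => /(_ _ d0)/nbhs_ballP[rho /= rho0 Hrho].
pose d := Num.min rho ((zeta.2 - F zeta.1) / 2) / 4.
have dpos : 0 < d by rewrite divr_gt0// lt_min rho0.
have drho : 4 * d <= rho by rewrite /d mulrC divfK// ge_min lexx.
have dF2 : 4 * d <= (zeta.2 - F zeta.1) / 2.
  by rewrite /d mulrC divfK// ge_min lexx orbT.
have [r1 r10 Hr1] := phiC _ dpos.
move/nbhs_ballP: uphi => [r2 /= r20 Hr2].
pose r := Num.min (Num.min r1 r2) z.2 / 2.
have mn0 : 0 < Num.min (Num.min r1 r2) z.2 by rewrite !lt_min r10 r20.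
have r0 : 0 < r by rewrite divr_gt0.
have [rr1 rr2 rz] : [/\ r < r1, r < r2 & r < z.2].
  have : r < Num.min (Num.min r1 r2) z.2 by rewrite /r; lra.
  by rewrite !lt_min => /andP[/andP[]].
(* With this opening maximum points lie within d / k = r / 2 of z. *)
pose k := 2 * d / r.
have k0 : 0 < k by rewrite divr_gt0// mulr_gt0.
have ufc : {within @closed_half R n, continuous (fun w => u w - paraboloid zeta k z w)}.
  move=> w; apply: cvgB; first exact: (lip_half_continuous uL).
  by apply: continuous_subspaceT; exact: paraboloid_continuous.
have [zb [zbr zb0 zbM]] := box_max (ltW r0) (ltW z0) ufc.
have uw w : `|w - z| <= r -> u w <= u z + dote zeta (w - z) + d * `|w - z|.
  move=> wr; have wr1 := le_lt_trans wr rr1; have wr2 := le_lt_trans wr rr2.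
  have := Hr1 w wr1; rewrite ler_norml => /andP[_].
  have : u w - phi w <= u z - phi z.
    by apply: Hr2; rewrite -ball_normE /ball_/= distrC.
  lra.
have zbd : k * `|zb - z| <= d.
  have := zbM z; rewrite subrr normr0 (ltW r0) (ltW z0) => /(_ isT isT).
  have := uw zb zbr; rewrite /paraboloid subrr !dote0r => H1 H2.
  have [->|zz] := eqVneq `|zb - z| 0; first by rewrite mulr0 ltW.
  have zz0 : 0 < `|zb - z| by rewrite lt_neqAle eq_sym zz normr_ge0.
  rewrite -(ler_pM2r zz0) -mulrA -expr2.
  have : k * `|zb - z| ^+ 2 <= k * dote (zb - z) (zb - z).
    by rewrite ler_wpM2l ?norm_sq_dote// ltW.
  lra.
have zbr2 : `|zb - z| <= r / 2.
  have : `|zb - z| <= d / k by rewrite ler_pdivlMr// mulrC.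
  have -> // : d / k = r / 2.
  by rewrite /k; field; rewrite !gt_eqF.
have zb20 : 0 < zb.2.
  have := le_trans (prod_norm2 (zb - z)) zbr2.
  by rewrite ler_norml /= => /andP[+ _]; lra.
set zeta' := zeta + (2 * k) *: (zb - z).
have r20' : 0 < r / 2 by rewrite divr_gt0.
have : zeta'.2 <= F zeta'.1.
  apply: (prox_sub_local uF uL zb20 (K := k) r20') => w w0 wzb.
  have wz : `|w - z| <= r.
    have -> : w - z = (w - zb) + (zb - z) by rewrite addrA subrK.
    by apply: le_trans (ler_normD _ _) _; apply: le_trans (lerD wzb zbr2) _; lra.
  have := zbM w wz w0; rewrite (paraboloid_recenter zeta k z zb w) -/zeta'; lra.
have k20 : 0 < 2 * k by rewrite pmulr_rgt0.
have diff : `|(2 * k) *: (zb - z)| <= 2 * d.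
  by rewrite normrZ (gtr0_norm k20) -mulrA ler_pM2l.
have : `|F zeta.1 - F zeta'.1| <= (zeta.2 - F zeta.1) / 2.
  apply: Hrho; rewrite -ball_normE /ball_/= opprD addrA subrr sub0r normrN.
  apply: le_lt_trans (prod_norm1 ((2 * k) *: (zb - z))) _.
  by apply: le_lt_trans diff _; lra.
rewrite ler_norml => /andP[H1 _].
have := le_trans (prod_norm2 ((2 * k) *: (zb - z))) diff.
rewrite ler_norml => /andP[H2 _].
have -> : zeta'.2 = zeta.2 + ((2 * k) *: (zb - z)).2 by [].
lra.
Qed.
End ProxViscosity.

(** * Comparison of Lipschitz viscosity solutions *)

Section Comparison.
Variables (R : realType) (n : nat).
Local Notation E := ('rV[R]_n * R)%type.
Implicit Types (x y p q : 'rV[R]_n) (zeta : E) (r s e K L B : R) (u f phi : E -> R).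

(** The Hamiltonian is only continuous; comparison evaluates it at
    bounded gradients p that are perturbed by a small q. *)
Lemma uniform_continuity_bounded (F : 'rV[R]_n -> R) B e : continuous F -> 0 < e ->
  exists2 r, 0 < r & forall p q, `|p| <= B -> `|q| <= r -> `|F (p + q) - F p| <= e.
Proof.
move=> Fc e0.
have cB : compact [set p : 'rV[R]_n | `|p| <= B].
  apply: bounded_closed_compact.
    by exists B; split; [exact: num_real|move=> M BM p /= pB; exact: le_trans (ltW BM)].
  apply: (@preimage_closed _ _ (fun y : 'rV[R]_n => `|y|) [set y : R | y <= B]).
    by move=> y _; exact: norm_continuous.
  exact: closed_le.
have cover : forall p, [set p : 'rV[R]_n | `|p| <= B] p ->
    \forall p' \near p & q \near (0 : 'rV[R]_n), `|F (p' + q) - F p'| <= e.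
  move=> p pB.
  have e2 : 0 < e / 2 by rewrite divr_gt0.
  have /cvgrPdist_le/(_ _ e2)/nbhs_ballP[r /= r0 Hr] := Fc p.
  have r20 : 0 < r / 2 by rewrite divr_gt0.
  exists (ball p (r / 2), ball (0 : 'rV[R]_n) (r / 2)).
    by split; exact: nbhsx_ballx.
  move=> [p' q] [/= Hp Hq].
  rewrite -ball_normE /ball_/= in Hp; rewrite -ball_normE /ball_/= sub0r normrN in Hq.
  have H1 : `|F p - F p'| <= e / 2.
    by apply: Hr; rewrite -ball_normE /ball_/=; apply: lt_le_trans Hp _; lra.
  have H2 : `|F p - F (p' + q)| <= e / 2.
    apply: Hr; rewrite -ball_normE /ball_/= opprD addrA.
    apply: le_lt_trans (ler_normB _ _) _.
    by apply: lt_le_trans (ltrD Hp Hq) _; lra.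
  have -> : F (p' + q) - F p' = (F p - F p') - (F p - F (p' + q)) by lra.
  by apply: le_trans (ler_normB _ _) _; lra.
have := (compact_near_coveringP _).1 cB _ _
  (fun q p => `|F (p + q) - F p| <= e) (nbhs_filter (0 : 'rV[R]_n)) cover.
move=> /nbhs_ballP[r /= r0 Hr]; exists (r / 2); first by rewrite divr_gt0.
move=> p q pB qr; apply: (Hr q) => //.
by rewrite -ball_normE /ball_/= sub0r normrN; apply: le_lt_trans qr _; lra.
Qed.

Lemma eps_continuous (V : normedModType R) (f : V -> R) :
  (forall z e, 0 < e ->
    exists2 r, 0 < r & forall w, `|w - z| < r -> `|f w - f z| <= e) ->
  continuous f.
Proof.
move=> H z; apply/cvgrPdist_le => e e0; have [r r0 Hr] := H z e e0.
apply/(nbhs_ballP z); exists r => //= w.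
by rewrite -ball_normE /ball_/= => wz; rewrite distrC; apply: Hr; rewrite distrC.
Qed.

(** Reflection in time extends a function on the closed half-space
    continuously, so that maxima over products of compact sets can be taken
    without subspace topologies. *)
Lemma fold_half_continuous L u : lip_half L u ->
  continuous (fun z : E => u (z.1, `|z.2|)).
Proof.
move=> uL; apply: eps_continuous => z e e0.
have L0 : 0 < `|L| + 1 by rewrite ltr_wpDl.
exists (e / (`|L| + 1)) => /= [|w]; first by rewrite divr_gt0.
rewrite distrC => wz; rewrite distrC.
apply: le_trans (uL (z.1, `|z.2|) (w.1, `|w.2|) (normr_ge0 _) (normr_ge0 _)) _.
have zw : `|((z.1, `|z.2|) : E) - (w.1, `|w.2|)| <= `|z - w|.
  apply: prod_norm_le; first exact: (prod_norm1 (z - w)).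
  by rewrite /=; apply: le_trans (ler_dist_dist _ _) _; exact: (prod_norm2 (z - w)).
apply: le_trans (_ : (`|L| + 1) * `|z - w| <= _); last first.
  by rewrite mulrC -ler_pdivlMr// ltW.
apply: le_trans (_ : `|L| * `|((z.1, `|z.2|) : E) - (w.1, `|w.2|)| <= _).
  by rewrite ler_wpM2r// ler_norm.
by apply: ler_pM => //; lra.
Qed.

Lemma lip_half_weaken L L' u : L <= L' -> lip_half L u -> lip_half L' u.
Proof.
by move=> LL uL z w z0 w0; apply: le_trans (uL z w z0 w0) _; rewrite ler_wpM2r.
Qed.

(** Ordered initial data and Lipschitz continuity bound v z - u w by the time
    of either point: a large gap can occur at positive times only. *)
Lemma lip_gap L (v u : E -> R) : 0 <= L -> lip_half L v -> lip_half L u ->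
  (forall x, v (x, 0) <= u (x, 0)) ->
  forall z w, 0 <= z.2 -> 0 <= w.2 ->
    v z - u w <= 2 * L * z.2 + 2 * L * `|z - w| /\
    v z - u w <= 2 * L * w.2 + 2 * L * `|z - w|.
Proof.
move=> L0 vL uL vu z w z0 w0.
have H1 : v z - v (z.1, 0) <= L * z.2.
  apply: le_trans (ler_norm _) _; apply: le_trans (vL z (z.1, 0) z0 (lexx 0)) _.
  apply: ler_wpM2l => //; apply: prod_norm_le => /=.
    by rewrite subrr normr0.
  by rewrite subr0 ger0_norm.
have H2 : u (z.1, 0) - u w <= L * (`|z - w| + w.2).
  apply: le_trans (ler_norm _) _; apply: le_trans (uL (z.1, 0) w (lexx 0) w0) _.
  apply: ler_wpM2l => //; apply: prod_norm_le => /=.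
    by apply: le_trans (prod_norm1 (z - w)) _; rewrite lerDl.
  by rewrite sub0r normrN ger0_norm// lerDr.
have := vu z.1; have := prod_norm2 (z - w); rewrite ler_norml /= => /andP[H3 H4].
have H5 : L * w.2 <= L * (z.2 + `|z - w|) by apply: ler_wpM2l => //; lra.
have H6 : L * z.2 <= L * (w.2 + `|z - w|) by apply: ler_wpM2l => //; lra.
by split; lra.
Qed.

Lemma quadratic_root_bound (a b c t : R) : 0 < a -> 0 <= b -> 0 <= c -> 0 <= t ->
  a * t ^+ 2 <= b * t + c -> t <= 1 + (b + c) / a.
Proof.
move=> a0 b0 c0 t0 H; have [t1|t1] := leP t 1.
  by apply: le_trans t1 _; rewrite lerDl divr_ge0 ?addr_ge0 ?(ltW a0).
have t0' : 0 < t by exact: lt_trans t1.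
suff : t <= (b + c) / a by lra.
rewrite ler_pdivlMr// -(ler_pM2r t0') mulrC mulrA.
rewrite expr2 in H; have : c * 1 <= c * t by rewrite ler_wpM2l// ltW.
lra.
Qed.

Lemma complete_square (a b t : R) : 0 < a -> 2 * b * t - a * t ^+ 2 <= b ^+ 2 / a.
Proof.
move=> a0; rewrite ler_pdivlMr//; have := sqr_ge0 (a * t - b).
by rewrite !expr2; lra.
Qed.

(** The first term keeps the two points together, the second one localises in
    space, and the last one makes the inequality at the maximum strict. *)
Definition penalty (A be eta : R) (zw : E * E) : R :=
  A * dote (zw.1 - zw.2) (zw.1 - zw.2) + be * dotv zw.1.1 zw.1.1 +
  eta * zw.1.2 ^+ 2.

Lemma penalty_continuous (A be eta : R) : continuous (penalty A be eta).
Proof.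
move=> zw; have c1 : zw'.1 @[zw' --> zw] --> zw.1 by exact: cvg_fst.
have c2 : zw'.2 @[zw' --> zw] --> zw.2 by exact: cvg_snd.
apply: cvgD; first apply: cvgD.
- by apply: cvgM; [exact: cvg_cst|apply: cvg_dote; exact: cvgB].
- by apply: cvgM; [exact: cvg_cst|apply: cvg_dotv; exact: cvg_pr1].
- by apply: cvgM; [exact: cvg_cst|apply: cvgM; exact: cvg_pr2].
Qed.

(** The penalised difference exceeds th somewhere, and only inside a bounded
    set; its maximum over that compact set is hence global. *)
Lemma doubling_max L (v u : E -> R) (G : E * E -> R) (th Rad : R) (z0 : E) :
  lip_half L v -> lip_half L u -> continuous G ->
  (forall z w, 0 <= z.2 -> 0 <= w.2 -> th <= v z - u w - G (z, w) ->
     `|z| <= Rad /\ `|w| <= Rad) ->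
  0 <= z0.2 -> th <= v z0 - u z0 - G (z0, z0) ->
  exists z w, [/\ 0 <= z.2, 0 <= w.2 &
    forall z' w', 0 <= z'.2 -> 0 <= w'.2 ->
      v z' - u w' - G (z', w') <= v z - u w - G (z, w)].
Proof.
move=> vL uL Gc inbox z00 Hth.
pose D := [set z : E | `|z - 0| <= Rad] `&` @closed_half R n.
have cD : compact D.
  by apply: compact_closedI; [exact: compact_box|exact: closed_closed_half].
pose Psi (zw : E * E) := v (zw.1.1, `|zw.1.2|) - u (zw.2.1, `|zw.2.2|) - G zw.
have Psic : continuous Psi.
  move=> zw; apply: cvgB; last exact: Gc.
  apply: cvgB.
  - apply: (@continuous_comp _ _ _ fst (fun z : E => v (z.1, `|z.2|))).
      exact: cvg_fst.
    exact: fold_half_continuous vL _.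
  - apply: (@continuous_comp _ _ _ snd (fun z : E => u (z.1, `|z.2|))).
      exact: cvg_snd.
    exact: fold_half_continuous uL _.
have PsiE z w : 0 <= z.2 -> 0 <= w.2 -> Psi (z, w) = v z - u w - G (z, w).
  by move=> ? ?; rewrite /Psi /= !ger0_norm// -!surjective_pairing.
have [z0R _] := inbox _ _ z00 z00 Hth.
have D0 : D `*` D !=set0 by exists (z0, z0); rewrite /D /= subr0.
have [|[z w] + H] := compact_EVT_max D0 (compact_setX cD cD) (f := Psi).
  by apply: continuous_subspaceT.
rewrite inE => -[[/= _ zz] [_ ww]].
exists z, w; split => // z' w' zz' ww'; rewrite -!PsiE//.
have [HP|HP] := leP th (v z' - u w' - G (z', w')).
  have [z'R w'R] := inbox _ _ zz' ww' HP.
  by apply: H; rewrite inE /D /= !subr0.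
apply: le_trans (_ : Psi (z0, z0) <= _); last by apply: H; rewrite inE /D /= subr0.
by rewrite !PsiE//; apply: le_trans Hth; exact: ltW.
Qed.

(** At a maximum point (z, w), fixing w exhibits a paraboloid touching v at z
    from above, and fixing z one touching u at w from below. Their differentials
    differ by those of the two last terms of the penalty. *)
Lemma doubling_inequality (F : 'rV[R]_n -> R) (v u : E -> R) (A be eta : R) (z w : E) :
  prox_sub F v -> prox_sub (fun p => - F (- p)) (fun w => - u w) ->
  0 <= be -> 0 <= eta -> 0 < z.2 -> 0 < w.2 ->
  (forall z' w', 0 <= z'.2 -> 0 <= w'.2 ->
     v z' - u w' - penalty A be eta (z', w') <= v z - u w - penalty A be eta (z, w)) ->
  2 * eta * z.2 <=
    F ((2 * A) *: (z - w).1 + (2 * be) *: z.1) - F ((2 * A) *: (z - w).1).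
Proof.
move=> vF uF be0 eta0 zp wp Pmax.
pose q0 : E := (2 * A) *: (z - w).
pose qb : 'rV[R]_n := (2 * be) *: z.1.
have Hv : (q0 + (qb, 2 * eta * z.2)).2 <= F (q0 + (qb, 2 * eta * z.2)).1.
  apply: (vF z _ (A + be + eta)) => // z' zz'.
  have := Pmax z' w zz' (ltW wp); rewrite /penalty /=.
  have -> : z' - w = (z' - z) + (z - w) by rewrite addrA subrK.
  have z'E : z' = (z' - z) + z by rewrite subrK.
  have -> : dotv z'.1 z'.1 = dotv (z' - z).1 (z' - z).1 + 2 * dotv z.1 (z' - z).1 + dotv z.1 z.1.
    rewrite [in LHS]z'E; move: (z' - z) => d.
    by rewrite /= !(dotvDl, dotvDr) (dotvC d.1 z.1); ring.
  have -> : z'.2 ^+ 2 = (z' - z).2 ^+ 2 + 2 * z.2 * (z' - z).2 + z.2 ^+ 2.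
    by rewrite /=; ring.
  move: (z' - z) => d {z'E}.
  have -> : dote (q0 + (qb, 2 * eta * z.2)) d =
      2 * A * dote (z - w) d + 2 * be * dotv z.1 d.1 + 2 * eta * z.2 * d.2.
    rewrite doteDl /q0 doteZl.
    have -> : dote (qb, 2 * eta * z.2) d = dotv qb d.1 + 2 * eta * z.2 * d.2 by [].
    by rewrite /qb dotvZl; ring.
  move: (z - w) => b; rewrite !(doteDl, doteDr) (doteC d b).
  have N1 : be * dotv d.1 d.1 <= be * dote d d.
    by rewrite ler_wpM2l// /dote lerDl -expr2 sqr_ge0.
  have N2 : eta * d.2 ^+ 2 <= eta * dote d d.
    by rewrite ler_wpM2l// /dote lerDr dotv_ge0.
  clear -N1 N2; lra.
have Hu : (- q0).2 <= - F (- (- q0).1).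
  apply: (uF w _ A) => // w' ww'; have := Pmax z w' (ltW zp) ww'; rewrite /penalty /=.
  have -> : z - w' = (z - w) - (w' - w) by rewrite opprB addrA subrK.
  rewrite doteNl /q0 doteZl; move: (w' - w) (z - w) => d d'.
  by rewrite !(doteDl, doteDr, doteNl, doteNr) (doteC d d'); clear; lra.
by move: Hv Hu; rewrite /= opprK; clear; lra.
Qed.

(** Elementary estimates at points (z, w) where the penalised difference is
    still at least th / 2; here t and s are the times of z and w, e is the norm of
    z - w, N its squared Euclidean length and X the one of the position of z.
    Since A e^2 absorbs the Lipschitz loss 2 L e up to L^2 / A = th / 4, the gap
    keeps both times away from 0. *)
Lemma doubling_bounds (L A be eta th t s e X N d : R) :
  0 < L -> 0 < A -> 0 <= be -> 0 < eta -> L ^+ 2 / A = th / 4 -> 0 < th ->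
  0 <= t -> 0 <= e -> 0 <= X -> e ^+ 2 <= N ->
  d <= 2 * L * t + 2 * L * e -> d <= 2 * L * s + 2 * L * e ->
  th / 2 <= d - (A * N + be * X + eta * t ^+ 2) ->
  [/\ th / (8 * L) <= t, th / (8 * L) <= s, t <= 1 + (2 * L + th / 4) / eta,
      e <= 1 + (2 * L + L ^+ 2 / eta) / A & be * X <= L ^+ 2 / eta + th / 4].
Proof.
move=> L0 A0 be0 eta0 LA th0 t0 e0 X0 eN g1 g2 H.
have N1 : A * e ^+ 2 <= A * N by rewrite ler_wpM2l// ltW.
have N2 : 0 <= be * X by rewrite mulr_ge0.
have N3 : 0 <= eta * t ^+ 2 by rewrite mulr_ge0 ?sqr_ge0// ltW.
have S1 := complete_square L e A0; rewrite LA in S1.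
have S2 := complete_square L t eta0.
have L20 : 0 <= 2 * L by rewrite mulr_ge0// ltW.
have tsL r : th / 4 <= 2 * L * r -> th / (8 * L) <= r.
  by move=> Ht; rewrite ler_pdivrMr ?mulr_gt0//; clear -Ht; lra.
split.
- by apply: tsL; clear -H g1 N1 N2 N3 S1; lra.
- by apply: tsL; clear -H g2 N1 N2 N3 S1; lra.
- by apply: quadratic_root_bound => //; clear -H g1 N1 N2 N3 S1 th0; lra.
- apply: quadratic_root_bound => //; last by clear -H g1 N1 N2 N3 S2 th0; lra.
  by rewrite divr_ge0 ?sqr_ge0// ltW.
- by clear -H g1 N1 N2 N3 S1 S2 th0; lra.
Qed.

Lemma sqr_le_bound (a c : R) : 0 <= c -> a ^+ 2 <= c -> a <= 1 + c.
Proof.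
move=> c0; rewrite expr2 => H; have [?|a1] := leP a 1; first by lra.
have : a * 1 <= a * a by rewrite ler_wpM2l; lra.
lra.
Qed.

(** If v - u were equal to th > 0 at z0, doubling variables would give
    eta ts <= F(p + q) - F(p), where p is bounded, q = O(be^(1/2)), and ts is a
    positive lower bound for the times at the maximum. As F does not depend on
    position, A and eta remain fixed and only be tends to 0, which contradicts
    the continuity of F. *)
Lemma prox_comparison (F : 'rV[R]_n -> R) (v u : E -> R) L0 : continuous F ->
  lip_half L0 v -> lip_half L0 u ->
  prox_sub F v -> prox_sub (fun p => - F (- p)) (fun w => - u w) ->
  (forall x, v (x, 0) <= u (x, 0)) -> forall z, 0 <= z.2 -> v z <= u z.
Proof.
move=> Fc vL uL vF uF vu z0 z00; rewrite leNgt; apply/negP => uv.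
pose L := `|L0| + 1.
have Lgt : 0 < L by rewrite ltr_wpDl.
have L0L : L0 <= L by rewrite /L; have := ler_norm L0; lra.
have {}vL := lip_half_weaken L0L vL; have {}uL := lip_half_weaken L0L uL.
have gap := lip_gap (ltW Lgt) vL uL vu.
pose th := v z0 - u z0; have th0 : 0 < th by rewrite subr_gt0.
(* The value for which the Lipschitz loss L^2 / A is a quarter of th. *)
pose A := 4 * L ^+ 2 / th.
have A0 : 0 < A by rewrite divr_gt0// mulr_gt0// exprn_gt0.
have LA : L ^+ 2 / A = th / 4 by rewrite /A; field; rewrite !gt_eqF.
have above1 (a : R) : 0 <= a -> 0 < 4 * (a + 1).
  by move=> a0; rewrite mulr_gt0// ltr_wpDl.
have budget (a b : R) : 0 <= a -> 0 <= b -> b <= th / (4 * (a + 1)) -> b * a <= th / 4.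
  move=> a0 b0; rewrite ler_pdivlMr; last exact: above1.
  by clear -b0; lra.
(* At z0 itself the two remaining penalties cost at most th / 4 each. *)
pose eta := th / (4 * (z0.2 ^+ 2 + 1)).
have eta0 : 0 < eta by rewrite divr_gt0// above1// sqr_ge0.
have eta_t0 : eta * z0.2 ^+ 2 <= th / 4 by apply: budget => //; exact: sqr_ge0 || exact: ltW.
pose ts := th / (8 * L).
have ts0 : 0 < ts by rewrite divr_gt0// mulr_gt0.
pose C1 := L ^+ 2 / eta + th / 4.
have C10 : 0 < C1 by rewrite addr_gt0// divr_gt0// exprn_gt0.
pose Be := 1 + (2 * L + L ^+ 2 / eta) / A.
pose T1 := 1 + (2 * L + th / 4) / eta.
have ets0 : 0 < eta * ts by rewrite mulr_gt0.
have [rho rho0 Hrho] := uniform_continuity_bounded (2 * A * Be) Fc ets0.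
pose X0 := dotv z0.1 z0.1; have X00 : 0 <= X0 by exact: dotv_ge0.
(* The second bound makes the gradient 2 be z.1 of the localising term at most
   rho, since be |z.1|^2 <= C1. *)
pose be := Num.min (th / (4 * (X0 + 1))) (rho ^+ 2 / (4 * C1)).
have be0 : 0 < be.
  by rewrite lt_min divr_gt0 ?above1//= divr_gt0 ?exprn_gt0// mulr_gt0.
have be_X0 : be * X0 <= th / 4.
  by apply: budget => //; [exact: ltW|rewrite ge_min lexx].
have be_rho : 4 * be * C1 <= rho ^+ 2.
  have : be <= rho ^+ 2 / (4 * C1) by rewrite ge_min lexx orbT.
  by rewrite ler_pdivlMr ?mulr_gt0// mulrCA mulrA.
pose G := penalty A be eta.
have bounds z w : 0 <= z.2 -> 0 <= w.2 -> th / 2 <= v z - u w - G (z, w) ->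
    [/\ ts <= z.2, ts <= w.2, z.2 <= T1, `|z - w| <= Be & be * dotv z.1 z.1 <= C1].
  move=> zz ww H; have [gap1 gap2] := gap z w zz ww.
  exact: doubling_bounds Lgt A0 (ltW be0) eta0 LA th0 zz (normr_ge0 _)
    (dotv_ge0 _) (norm_sq_dote _) gap1 gap2 H.
have Phi0 : th / 2 <= v z0 - u z0 - G (z0, z0).
  rewrite /G /penalty /= subrr dote0r mulr0 -/X0 -/th.
  by clear -eta_t0 be_X0; lra.
have CB0 : 0 <= C1 / be by rewrite divr_ge0// ltW.
have inbox z w : 0 <= z.2 -> 0 <= w.2 -> th / 2 <= v z - u w - G (z, w) ->
    `|z| <= 1 + C1 / be + T1 + Be /\ `|w| <= 1 + C1 / be + T1 + Be.
  move=> zz ww /(bounds _ _ zz ww)[_ _ zT zwB zX].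
  have T10 : 0 <= T1 by exact: le_trans zT.
  have Be0 : 0 <= Be by exact: le_trans zwB.
  have z1 : `|z.1| <= 1 + C1 / be.
    apply: sqr_le_bound => //; apply: le_trans (norm_sq_dotv _) _.
    by rewrite ler_pdivlMr// mulrC.
  have zn : `|z| <= 1 + C1 / be + T1.
    apply: prod_norm_le; first by rewrite ler_wpDr.
    by rewrite ger0_norm// ler_wpDl// addr_ge0.
  split; first by rewrite ler_wpDr.
  by rewrite -(subKr z w); apply: le_trans (ler_normB _ _) _; exact: lerD.
have [z [w [zz ww Pmax]]] := doubling_max vL uL (@penalty_continuous A be eta)
  inbox z00 Phi0.
have [zts wts _ zwB zX] := bounds z w zz ww (le_trans Phi0 (Pmax _ _ z00 z00)).
have := doubling_inequality vF uF (ltW be0) (ltW eta0) (lt_le_trans ts0 zts)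
  (lt_le_trans ts0 wts) Pmax.
have p1 : `|(2 * A) *: (z - w).1| <= 2 * A * Be.
  have A20 : 0 < 2 * A by rewrite pmulr_rgt0.
  rewrite normrZ (gtr0_norm A20) (ler_pM2l A20).
  exact: le_trans (prod_norm1 (z - w)) zwB.
have p2 : `|(2 * be) *: z.1| <= rho.
  have be20 : 0 < 2 * be by rewrite pmulr_rgt0.
  rewrite -(@ler_pXn2r _ 2) ?nnegrE ?(ltW rho0)//.
  apply: le_trans be_rho; rewrite normrZ exprMn (gtr0_norm be20).
  have /(ler_wpM2l (ltW be0)) Hz := norm_sq_dotv z.1.
  have : be * (be * `|z.1| ^+ 2) <= be * C1.
    by rewrite ler_wpM2l ?(ltW be0)//; exact: le_trans zX.
  by clear; rewrite !expr2; lra.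
have := Hrho _ _ p1 p2; rewrite ler_norml => /andP[_ HF].
have : eta * ts <= eta * z.2 by rewrite ler_pM2l.
by move: HF ets0; clear; rewrite /=; lra.
Qed.
End Comparison.

(** * Comparison at scale eps *)

Section HeatComparison.
Variables (R : realType) (n : nat).
Local Notation E := ('rV[R]_n * R)%type.
Implicit Types (x y p q : 'rV[R]_n) (z w v zeta : E) (r s e eps K L B T tau : R)
  (u f h W : E -> R) (g : R -> R) (sig : 'I_n -> R).

(** The derivatives in the equation at scale eps, as pointwise data: tau is the
    time derivative and sig lists the pure second space derivatives. The maximum
    principle sees nothing else. *)
Definition pjet f z tau sig : Prop :=
  is_derive z (time_dir R n) f tau /\
  forall i, exists d : E -> R,
    (forall w, 0 < w.2 -> is_derive w (space_dir R i) f (d w)) /\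
    is_derive z (space_dir R i) d (sig i).

Definition heat_sub g eps f : Prop :=
  forall z, 0 < z.2 -> exists tau sig,
    pjet f z tau sig /\ tau - eps * \sum_(i < n) sig i <= g (f z / eps).

Lemma pjet_add f h z tau tau' sig sig' : pjet f z tau sig -> pjet h z tau' sig' ->
  pjet (fun w => f w + h w) z (tau + tau') (fun i => sig i + sig' i).
Proof.
move=> [ft fs] [ht hs]; split; first exact: (@is_deriveD _ _ _ f h z _ tau tau' ft ht).
move=> i; have [d [fd ds]] := fs i; have [d' [hd ds']] := hs i.
exists (fun w => d w + d' w); split; last exact: (@is_deriveD _ _ _ d d' z _ _ _ ds ds').
by move=> w w0; exact: (@is_deriveD _ _ _ f h w _ _ _ (fd w w0) (hd w w0)).
Qed.

(** Upper quadratic bound on the exponential at nonpositive arguments, used to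
    differentiate the damping factor at a maximum over past times. *)
Lemma expR_upper (y : R) : y <= 0 -> expR y <= 1 + y + y ^+ 2.
Proof.
move=> y0; have H := expR_ge1Dx (- y).
have E0 := expR_gt0 y; have EE : expR y * expR (- y) = 1 by rewrite -expRD subrr expR0.
have {}H := ler_wpM2l (ltW E0) H; rewrite EE in H; rewrite expr2.
have y1 : 0 < 1 - y by lra.
rewrite -(ler_pM2r y1); apply: le_trans H _.
have : 0 <= y * y * - y by rewrite mulr_ge0 -?expr2 ?sqr_ge0// oppr_ge0.
lra.
Qed.

Lemma cylinder_max f (Rad T : R) : 0 <= T -> T <= Rad ->
  {within @closed_half R n, continuous f} ->
  exists zb, [/\ `|zb| <= Rad, 0 <= zb.2 <= T &
    forall w, `|w| <= Rad -> 0 <= w.2 <= T -> f w <= f zb].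
Proof.
move=> T0 TR fc.
pose A := ([set w | `|w - 0| <= Rad] `&` @closed_half R n) `&` [set w : E | w.2 <= T].
have cA : compact A.
  apply: compact_closedI.
    by apply: compact_closedI; [exact: compact_box|exact: closed_closed_half].
  apply: (@preimage_closed _ _ snd [set y : R | y <= T]); last exact: closed_le.
  by move=> y _; exact: cvg_snd.
have A0 : A !=set0.
  exists 0; split => //; split; last by rewrite /closed_half /= lexx.
  by rewrite /= subrr normr0 (le_trans T0).
have [|zb + H] := @compact_EVT_max _ R f A A0 cA.
  by apply: continuous_subspaceW fc => w [[]].
rewrite inE => -[[/= zR z0] zT]; rewrite subr0 in zR.
exists zb; split => //; first by rewrite z0.
move=> w wR /andP[w0 wT]; apply: H; rewrite inE; split => //; split => //.
by rewrite /= subr0.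
Qed.

(** The exponential factor gives the zero-order term the good sign, and the
    quadratic term beats linear growth, forcing maxima to be attained. *)
Definition damped (lam be : R) W z : R :=
  W z * expR (- lam * z.2) - be * (1 + dotv z.1 z.1).

Lemma damped_continuous lam be W : {within @closed_half R n, continuous W} ->
  {within @closed_half R n, continuous (damped lam be W)}.
Proof.
move=> Wc; have c1 : continuous (fun z : E => expR (- lam * z.2)).
  move=> z; apply: (@continuous_comp _ _ _ (fun z : E => - lam * z.2) expR).
    by apply: cvgM; [exact: cvg_cst|apply: cvg_pr2; exact: cvg_id].
  exact: continuous_expR.
have c2 : continuous (fun z : E => be * (1 + dotv z.1 z.1)).
  move=> z; apply: cvgM; first exact: cvg_cst.
  apply: cvgD; first exact: cvg_cst.
  by apply: cvg_dotv; apply: cvg_pr1; exact: cvg_id.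
move=> w; apply: cvgB; last exact: (continuous_subspaceT c2).
by apply: cvgM; [exact: Wc|exact: (continuous_subspaceT c1)].
Qed.

Lemma linear_le_quadratic (C be a X y : R) : 0 < C -> 0 < be ->
  2 * C / be + 1 <= a -> a ^+ 2 <= X -> y <= C * (1 + a) -> y <= be * (1 + X).
Proof.
move=> C0 be0 aC aX yC; apply: le_trans yC _.
have a1 : 1 <= a by apply: le_trans aC; rewrite lerDr divr_ge0 ?mulr_ge0// ltW.
have W2 : be * a ^+ 2 <= be * X by rewrite ler_wpM2l// ltW.
have W3 : 2 * C + be <= be * a.
  by have := aC; rewrite -(ler_pM2l be0) mulrDr mulr1 [be * (_ / _)]mulrC divfK ?gt_eqF.
have W4 : (2 * C + be) * a <= be * a ^+ 2.
  by rewrite expr2 mulrA ler_wpM2r// (le_trans ler01).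
have W5 : C * 1 <= C * a by rewrite ler_pM2l.
have W6 : 0 <= be * a by rewrite mulr_ge0 ?(ltW be0)// (le_trans ler01).
lra.
Qed.

(** Only earlier times are compared, so z may lie on the top of the cylinder. *)
Lemma damped_max_time lam be W z tau sig : 0 <= lam -> 0 < z.2 -> 0 < W z ->
  pjet W z tau sig ->
  (forall w, 0 <= w.2 <= z.2 -> damped lam be W w <= damped lam be W z) ->
  lam * W z <= tau.
Proof.
move=> lam0 z0 Wz [Wt _] Vmax.
apply: (touch_left (E := lam ^+ 2 * W z) Wt z0) => s s1 s0.
have -> : s *: time_dir R n + z = (z.1, s + z.2).
  by congr (_, _) => /=; rewrite ?scaler0 ?add0r// [_ *: _]mulr1.
have wT : 0 <= (z.1, s + z.2).2 <= z.2.
  by rewrite /=; clear -s1 s0; apply/andP; split; lra.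
have := Vmax _ wT.
rewrite /damped /= lerD2r mulrDr expRD mulrA ler_pM2r ?expR_gt0// => H.
have H2 : W (z.1, s + z.2) <= W z * expR (lam * s).
  rewrite -(ler_pM2r (expR_gt0 (- lam * s))) -mulrA -expRD mulNr subrr expR0 mulr1.
  by rewrite -mulNr.
apply: le_trans H2 _.
have ls : lam * s <= 0 by rewrite mulr_ge0_le0// ltW.
have := expR_upper ls; rewrite -(ler_pM2l Wz) exprMn; clear; lra.
Qed.

Lemma damped_max_space lam be W z tau sig : 0 < z.2 -> pjet W z tau sig ->
  (forall w, 0 <= w.2 <= z.2 -> damped lam be W w <= damped lam be W z) ->
  forall i, sig i <= 2 * (be * expR (lam * z.2)).
Proof.
move=> z0 [_ Ws] Vmax i.
set ga := be * expR (lam * z.2).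
have [d [Wd dsig]] := Ws i.
apply: (touch_second (f := W) (d := d) (z := z) (v := space_dir R i)
  (b := ga * (2 * z.1 0 i)) (r := 1)) => // [s _|s _].
  by apply: Wd; rewrite /= scaler0 add0r.
set w := s *: space_dir R i + z.
have w2 : w.2 = z.2 by rewrite /w /= scaler0 add0r.
have wT : 0 <= w.2 <= z.2 by rewrite w2 lexx ltW.
have := Vmax w wT.
rewrite /damped w2 -(ler_pM2r (expR_gt0 (lam * z.2))).
have EE : expR (- lam * z.2) * expR (lam * z.2) = 1.
  by rewrite -expRD mulNr addrC subrr expR0.
have E1 (a k : R) : (a * expR (- lam * z.2) - be * k) * expR (lam * z.2) = a - ga * k.
  by rewrite mulrBl -mulrA EE mulr1 /ga; ring.
rewrite !E1.
have -> : dotv w.1 w.1 = dotv z.1 z.1 + 2 * z.1 0 i * s + s ^+ 2.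
  rewrite /w /= !(dotvDl, dotvDr, dotvZl, dotvZr) (dotvC (delta_mx 0 i) z.1).
  by rewrite !dotv_delta mxE !eqxx /=; ring.
by clear; lra.
Qed.

(** At a positive maximum of [damped lam be W] the time derivative is at least
    lam W, and the second derivatives are at most 2 be e^(lam t) <= 2 W. For
    lam > Lam + 2 n eps this contradicts the differential inequality. *)
Lemma max_principle W eps Lam : 0 < eps ->
  {within @closed_half R n, continuous W} ->
  (forall T, exists C, forall z, 0 <= z.2 <= T -> W z <= C * (1 + `|z.1|)) ->
  (forall x, W (x, 0) <= 0) ->
  (forall z, 0 < z.2 -> exists tau sig,
     pjet W z tau sig /\
     (0 < W z -> tau - eps * \sum_(i < n) sig i <= Lam * W z)) ->
  forall z, 0 <= z.2 -> W z <= 0.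
Proof.
move=> eps0 Wc Wgrow W0 WH z0 z00; rewrite leNgt; apply/negP => Wz0.
set T := z0.2 in z00.
have [C0 HC0] := Wgrow T.
pose C := `|C0| + 1; have Cgt : 0 < C by rewrite ltr_wpDl.
have HC w : 0 <= w.2 <= T -> W w <= C * (1 + `|w.1|).
  move=> wT; apply: le_trans (HC0 w wT) _; apply: ler_wpM2r; first by rewrite addr_ge0.
  by apply: le_trans (ler_norm C0) _; rewrite lerDl.
pose lam := `|Lam| + 2 * n%:R * eps + 1.
have ne0 : 0 <= 2 * n%:R * eps by rewrite !mulr_ge0// ltW.
have lamLam : 2 * n%:R * eps + 1 <= lam - Lam.
  by rewrite /lam; have := ler_norm Lam; clear; lra.
have lam0 : 0 <= lam by rewrite /lam !addr_ge0.
pose q0 := 1 + dotv z0.1 z0.1.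
have q00 : 0 < q0 by rewrite ltr_wpDr ?dotv_ge0.
(* Half of the damped value at z0 survives the subtraction. *)
pose be := W z0 * expR (- lam * T) / (2 * q0).
have be0 : 0 < be by rewrite divr_gt0 ?mulr_gt0 ?expR_gt0.
pose V := damped lam be W.
have Vz0 : 0 < V z0.
  have : be * (2 * q0) = W z0 * expR (- lam * T) by rewrite /be divfK// gt_eqF// mulr_gt0.
  have : 0 < be * q0 by rewrite mulr_gt0.
  by rewrite /V /damped -/q0; clear; lra.
have CB0 : 0 <= 2 * C / be by apply: divr_ge0; [apply: mulr_ge0 => //; exact: ltW|exact: ltW].
pose Rad := T + (2 * C / be + 1) + `|z0|.
have TR : T <= Rad by rewrite -[T]addr0 /Rad -addrA lerD2l !addr_ge0.
have z0R : `|z0| <= Rad by rewrite lerDr !addr_ge0.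
have [zb [_ zbT zbM]] := cylinder_max z00 TR (damped_continuous (lam := lam) (be := be) Wc).
have z0T : 0 <= z0.2 <= T by rewrite z00 lexx.
have Vzb : 0 < V zb by apply: lt_le_trans Vz0 _; exact: zbM.
(* Outside the cylinder the quadratic term exceeds the linear growth of W, so
   the damped function is nonpositive there. *)
have Vmax w : 0 <= w.2 <= T -> V w <= V zb.
  move=> wT; have [wR|wR] := leP `|w| Rad; first exact: zbM.
  apply: le_trans (ltW Vzb); rewrite subr_le0.
  have w1 : 2 * C / be + 1 <= `|w.1|.
    move: wR; rewrite norm_prodE lt_max => /orP[/ltW|].
      by apply: le_trans; rewrite /Rad addrAC lerDr addr_ge0.
    case/andP: wT => w0 wT; rewrite ger0_norm// => /lt_le_trans/(_ wT).
    by rewrite ltNge TR.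
  have W1 : W w * expR (- lam * w.2) <= C * (1 + `|w.1|).
    have Cw : 0 <= C * (1 + `|w.1|) by rewrite mulr_ge0 ?addr_ge0// ltW.
    have [Ww|Ww] := leP (W w) 0.
      apply: le_trans Cw; apply: mulr_le0_ge0 => //; exact: expR_ge0.
    apply: le_trans (HC w wT); rewrite -[leRHS]mulr1 ler_pM2l// -expR0 ler_expR.
    by rewrite mulNr oppr_le0 mulr_ge0//; case/andP: wT.
  exact: linear_le_quadratic Cgt be0 w1 (norm_sq_dotv _) W1.
have beq : be <= be * (1 + dotv zb.1 zb.1) by rewrite ler_pMr// lerDl dotv_ge0.
have WE : be < W zb * expR (- lam * zb.2).
  by move: Vzb; rewrite /V /damped subr_gt0; exact: le_lt_trans.
have Wzb : 0 < W zb by rewrite -(pmulr_lgt0 _ (expR_gt0 (- lam * zb.2))) (lt_trans be0).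
have zb0 : 0 < zb.2.
  case/andP: zbT => zb0 _; rewrite lt_neqAle zb0 andbT; apply/eqP => zE.
  have := W0 zb.1; have -> : (zb.1, 0) = zb by rewrite zE -surjective_pairing.
  by rewrite leNgt Wzb.
have Vmax' w : 0 <= w.2 <= zb.2 -> V w <= V zb.
  by move=> /andP[w0 wz]; apply: Vmax; rewrite w0 (le_trans wz)//; case/andP: zbT.
have [tau [sig [Wj /(_ Wzb) WHz]]] := WH zb zb0.
have tauge := damped_max_time lam0 zb0 Wzb Wj Vmax'.
have sigle := damped_max_space zb0 Wj Vmax'.
set ga := be * expR (lam * zb.2) in sigle.
have ga0 : 0 < ga by rewrite mulr_gt0// expR_gt0.
have sumle : \sum_(i < n) sig i <= n%:R * (2 * ga).
  apply: le_trans (ler_sum _ (fun i _ => sigle i)) _.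
  by rewrite sumr_const card_ord [leRHS]mulr_natl.
have Wga : ga <= W zb.
  have := ltW WE; rewrite -(ler_pM2r (expR_gt0 (lam * zb.2))) -/ga.
  by rewrite -mulrA -expRD mulNr addrC subrr expR0 mulr1.
have H1 : eps * \sum_(i < n) sig i <= eps * (n%:R * (2 * ga)) by rewrite ler_pM2l.
have H2 : (2 * n%:R * eps + 1) * W zb <= (lam - Lam) * W zb by rewrite ler_wpM2r// ltW.
have H3 : 2 * n%:R * eps * ga <= 2 * n%:R * eps * W zb by rewrite ler_wpM2l.
by clear -H1 H2 H3 WHz tauge Wzb; lra.
Qed.

(** The sum of a subsolution f and of the opposite h of a supersolution
    satisfies a linear inequality where it is positive, with constant L / eps by the
    Lipschitz continuity of g. *)
Lemma heat_comparison g L eps f h : 0 < eps ->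
  (forall a b : R, `|g a - g b| <= L * `|a - b|) ->
  {within @closed_half R n, continuous f} -> {within @closed_half R n, continuous h} ->
  heat_sub g eps f -> heat_sub (reflect_fun g) eps h ->
  (forall T, exists C, forall z, 0 <= z.2 <= T -> f z + h z <= C * (1 + `|z.1|)) ->
  (forall x, f (x, 0) + h (x, 0) <= 0) ->
  forall z, 0 <= z.2 -> f z + h z <= 0.
Proof.
move=> eps0 gL fc hc fs hs grow init.
apply: (@max_principle (fun z => f z + h z) eps (L / eps)) => //.
  by move=> w; apply: cvgD; [exact: fc|exact: hc].
move=> z z0; have [tau [sig [fj fle]]] := fs z z0.
have [tau' [sig' [hj hle]]] := hs z z0.
exists (tau + tau'), (fun i => sig i + sig' i); split; first exact: pjet_add.
move=> Wz; rewrite big_split /=.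
have := gL (f z / eps) (- h z / eps); rewrite -mulrBl normrM opprK.
rewrite (gtr0_norm Wz) gtr0_norm ?invr_gt0// ler_norml => /andP[_ H].
have EL : L / eps * (f z + h z) = L * ((f z + h z) / eps) by rewrite mulrAC mulrA.
have Eh : - (h z / eps) = - h z / eps by rewrite mulNr.
by rewrite EL; move: hle; rewrite /reflect_fun Eh; lra.
Qed.
End HeatComparison.

(** * Estimates uniform in eps *)

Section HeatEstimates.
Variables (R : realType) (n : nat).
Local Notation E := ('rV[R]_n * R)%type.
Implicit Types (x y p q : 'rV[R]_n) (z w v c zeta : E) (r s e eps K L B T M tau delta : R)
  (u f h W : E -> R) (g : R -> R) (sig : 'I_n -> R).

(** Solutions at scale eps, as pairs of one-sided conditions, so that they are
    stable under reflection ([heat_sol_refl]). *)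
Record heat_sol g eps f : Prop := HeatSol {
  hs_cont : {within @closed_half R n, continuous f};
  hs_grow : forall T, exists C, forall z, 0 <= z.2 <= T -> `|f z| <= C * (1 + `|z.1|);
  hs_sub : heat_sub g eps f;
  hs_super : heat_sub (reflect_fun g) eps (fun z => - f z) }.

Lemma within_half_opp f : {within @closed_half R n, continuous f} ->
  {within @closed_half R n, continuous (fun z => - f z)}.
Proof. by move=> fc w; apply: cvgN; exact: fc. Qed.

Lemma heat_sol_refl g eps f : heat_sol g eps f ->
  heat_sol (reflect_fun g) eps (fun z => - f z).
Proof.
move=> [fc fg fs fS]; split => //.
- exact: within_half_opp.
- by move=> T; have [C HC] := fg T; exists C => z zT; rewrite normrN; exact: HC.
rewrite reflect_funK; have -> // : (fun z => - - f z) = f.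
by apply/funext => z; rewrite opprK.
Qed.

Lemma pjet_opp f z tau sig : pjet f z tau sig ->
  pjet (fun w => - f w) z (- tau) (fun i => - sig i).
Proof.
move=> [ft fs]; split; first exact: (@is_deriveN _ _ _ f z _ tau ft).
move=> i; have [d [fd ds]] := fs i.
exists (fun w => - d w); split; last exact: (@is_deriveN _ _ _ d z _ _ ds).
by move=> w w0; exact: (@is_deriveN _ _ _ f w _ _ (fd w w0)).
Qed.

Lemma is_derive_translate f z v c (a l : R) : is_derive (z + c) v f l ->
  is_derive z v (fun w => f (w + c) + a) l.
Proof.
move=> /is_derive_epsP H; apply/is_derive_epsP => e e0.
have [r r0 Hr] := H e e0; exists r => // h hr.
by apply: norm_le_eq (Hr h hr) _; rewrite addrA; lra.
Qed.

Lemma pjet_translate f z tau sig c a : 0 <= c.2 -> pjet f (z + c) tau sig ->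
  pjet (fun w => f (w + c) + a) z tau sig.
Proof.
move=> c0 [ft fs]; split; first exact: is_derive_translate.
move=> i; have [d [fd ds]] := fs i; exists (fun w => d (w + c)); split.
  move=> w w0; apply: is_derive_translate; apply: fd.
  by rewrite /= ltr_wpDr.
have -> : (fun w => d (w + c)) = fun w => d (w + c) + 0.
  by apply/funext => w; rewrite addr0.
exact: is_derive_translate.
Qed.

Lemma classical_heat_sol g (u0 : 'rV[R]_n -> R) eps f :
  classical_solution g u0 eps f -> heat_sol g eps f.
Proof.
move=> [fc fC fg feq _].
have half : 0 < (2^-1 : R) < 1 by rewrite invr_gt0 ltr0n invf_lt1// ltr1n.
have [[fC1 fC2] _ _] := fC _ half.
have fj z : 0 < z.2 -> pjet f z (dt f z) (fun i => dx i (dx i f) z).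
  move=> z0; split; first by have [d _ _] := fC1 z z0; exact: derivableP.
  move=> i; exists (dx i f); split.
    by move=> w w0; have [_ _ /(_ i)[d _]] := fC1 w w0; exact: derivableP.
  by have [d _] := fC2 z z0 i i; exact: derivableP.
split => //.
- by move=> z z0; exists (dt f z), (fun i => dx i (dx i f) z); split;
    [exact: fj|have := feq z z0; rewrite /laplacian; lra].
move=> z z0; exists (- dt f z), (fun i => - dx i (dx i f) z); split.
  exact: pjet_opp (fj z z0).
have := feq z z0; rewrite /laplacian sumrN /reflect_fun mulNr opprK; lra.
Qed.

(** As g is 1-periodic, f + eps k solves the same equation as f for every
    integer k, and so does the translate of f by c. An ordering at time 0
    propagates. *)
Lemma shift_comparison g L eps f c (k : nat) : 0 < eps ->
  (forall a b : R, `|g a - g b| <= L * `|a - b|) -> periodic g 1 ->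
  heat_sol g eps f -> 0 <= c.2 ->
  (forall x, f ((x, 0) + c) <= f (x, 0) + eps * k%:R) ->
  forall z, 0 <= z.2 -> f (z + c) <= f z + eps * k%:R.
Proof.
move=> eps0 gL g1 [fc fg fs fS] c0 init z z0.
suff : (f (z + c) + - (eps * k%:R)) + - f z <= 0 by lra.
apply: (@heat_comparison _ _ g L eps (fun z => f (z + c) + - (eps * k%:R))
   (fun z => - f z)) z0 => //.
- apply/within_half_epsP => w w0 e e0.
  have wc : 0 <= (w + c).2 by rewrite addr_ge0.
  have [r r0 Hr] := (within_half_epsP f).1 fc (w + c) wc e e0.
  exists r => // w' w'0 ww'; have := Hr (w' + c).
  rewrite addr_ge0// [w + c]addrC addrKA => /(_ isT ww') H.
  by apply: norm_le_eq H _; rewrite [c + w]addrC; lra.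
- exact: within_half_opp.
- move=> w w0; have wc : 0 < (w + c).2 by rewrite /= ltr_wpDr.
  have [tau [sig [fj fle]]] := fs _ wc; exists tau, sig; split.
    exact: pjet_translate.
  apply: le_trans fle _.
  have -> : (f (w + c) + - (eps * k%:R)) / eps = f (w + c) / eps + (- k%:Z)%:~R.
    by rewrite mulrDl mulNr mulrAC divff ?gt_eqF// mul1r mulrNz.
  by rewrite periodic_int.
- move=> T; have [C HC] := fg (T + c.2); have [C' HC'] := fg T.
  exists (`|C| * (1 + `|c.1|) + `|C'|) => w /andP[w0 wT].
  have cw : 0 <= (w + c).2 <= T + c.2 by rewrite /= addr_ge0//= lerD.
  have H1 := le_trans (ler_norm _) (HC _ cw).
  have wT' : 0 <= w.2 <= T by rewrite w0.
  have H2 := le_trans (ler_norm (- f w)) _.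
  have {}H2 := H2 _ (_ : `|- f w| <= C' * (1 + `|w.1|)).
  rewrite normrN in H2; have {}H2 := H2 (HC' _ wT').
  have w10 : 0 <= 1 + `|w.1| by rewrite addr_ge0.
  have H3 : C' * (1 + `|w.1|) <= `|C'| * (1 + `|w.1|) by rewrite ler_wpM2r// ler_norm.
  have H4 : C * (1 + `|(w + c).1|) <= `|C| * ((1 + `|c.1|) * (1 + `|w.1|)).
    apply: le_trans (_ : `|C| * (1 + `|(w + c).1|) <= _).
      by rewrite ler_wpM2r ?ler_norm// addr_ge0.
    apply: ler_wpM2l => //; have := ler_normD w.1 c.1.
    have : 0 <= `|c.1| * `|w.1| by rewrite mulr_ge0.
    rewrite /=.
    lra.
  have : 0 <= eps * k%:R by rewrite mulr_ge0// ltW.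
  lra.
- by move=> x; have := init x; lra.
Qed.

(** The inequality |x| <= |x|^2 / (2 delta) + delta / 2 replaces the cone of
    slope K above u0 by a paraboloid, whose Laplacian costs eps n K / delta in
    speed. *)
Lemma heat_barrier g (u0 : 'rV[R]_n -> R) L M K eps delta f : 0 < eps -> 0 < delta -> 0 <= K ->
  (forall a b : R, `|g a - g b| <= L * `|a - b|) -> (forall y : R, `|g y| <= M) ->
  (forall x y, `|u0 x - u0 y| <= K * `|x - y|) ->
  heat_sol g eps f -> (forall x, f (x, 0) = u0 x) ->
  forall z, 0 <= z.2 ->
    f z <= u0 z.1 + K * delta / 2 + (M + eps * n%:R * K / delta) * z.2.
Proof.
move=> eps0 d0 K0 gL gM u0L [fc fg fs fS] f0 z0 z00.
pose ka := M + eps * n%:R * K / delta.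
have M0 : 0 <= M by exact: le_trans (gM 0).
have ka0 : 0 <= ka.
  by rewrite addr_ge0// divr_ge0 ?(ltW d0)// !mulr_ge0// ltW.
pose a0 := u0 z0.1 + K * delta / 2.
pose b := K / delta / 2.
have b0 : 0 <= b by rewrite !divr_ge0 ?(ltW d0).
(* The opposite of the barrier. *)
pose h z := - a0 - b * dotv (z.1 - z0.1) (z.1 - z0.1) - ka * z.2.
have hE s z v : h (s *: v + z) = h z +
    s * (- 2 * b * dotv (z.1 - z0.1) v.1 - ka * v.2) + s ^+ 2 * (- b * dotv v.1 v.1).
  rewrite /h /=; have -> : s *: v.1 + z.1 - z0.1 = s *: v.1 + (z.1 - z0.1) by rewrite addrA.
  have -> : s *: v.2 = s * v.2 by [].
  move: (z.1 - z0.1) => d.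
  by rewrite !(dotvDl, dotvDr, dotvZl, dotvZr) (dotvC v.1 d); lra.
have hd z v : is_derive z v h (- 2 * b * dotv (z.1 - z0.1) v.1 - ka * v.2).
  by apply: (is_derive_quadratic (k := - b * dotv v.1 v.1)) => s; exact: hE.
suff : f z0 + h z0 <= 0.
  by rewrite /h subrr -(scale0r 0) dotvZl mul0r mulr0 subr0 /a0 -/ka; lra.
apply: (@heat_comparison _ _ g L eps f h) z00 => //.
- have c1 : continuous h.
    move=> w; apply: cvgB; first apply: cvgB; first exact: cvg_cst.
      apply: cvgM; first exact: cvg_cst.
      by apply: cvg_dotv; (apply: cvgB; [apply: cvg_pr1; exact: cvg_id|exact: cvg_cst]).
    by apply: cvgM; [exact: cvg_cst|apply: cvg_pr2; exact: cvg_id].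
  exact: (continuous_subspaceT c1).
- move=> z zp; exists (- ka), (fun=> - 2 * b); split.
    split.
      have := hd z (time_dir R n); rewrite /= mulr1.
      by rewrite -(scale0r 0) dotvZr mul0r mulr0 sub0r.
    move=> i; exists (fun w => - 2 * b * (w.1 - z0.1) 0 i); split.
      move=> w _; have := hd w (space_dir R i).
      by rewrite /= mulr0 subr0 dotv_delta.
    apply: (is_derive_quadratic (k := 0)) => s.
    by rewrite /= !mxE !eqxx /=; lra.
  rewrite /reflect_fun.
  have := gM (- (h z / eps)); rewrite ler_norml => /andP[_ H].
  have -> : eps * \sum_(i < n) (- 2 * b) = - (eps * n%:R * K / delta).
    by rewrite sumr_const card_ord -[X in eps * X]mulr_natl /b; field; rewrite gt_eqF.
  by rewrite /ka; lra.
- move=> T; have [C HC] := fg T; exists (`|C| + `|a0|) => z /[dup] zT /andP[zp _].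
  have H1 := le_trans (ler_norm _) (HC z zT).
  have z1 : 0 <= 1 + `|z.1| by rewrite addr_ge0.
  have H2 : C * (1 + `|z.1|) <= `|C| * (1 + `|z.1|) by rewrite ler_wpM2r// ler_norm.
  have H3 : h z <= `|a0|.
    have : 0 <= b * dotv (z.1 - z0.1) (z.1 - z0.1) by rewrite mulr_ge0// dotv_ge0.
    have : 0 <= ka * z.2 by rewrite mulr_ge0.
    by have := ler_norm (- a0); rewrite normrN /h; lra.
  have : 0 <= `|a0| * `|z.1| by rewrite mulr_ge0.
  lra.
- move=> x; rewrite f0 /h /= mulr0 subr0 /a0.
  have := le_trans (ler_norm _) (u0L x z0.1) => H.
  have Hs := norm_sq_dotv (x - z0.1).
  have : b * `|x - z0.1| ^+ 2 <= b * dotv (x - z0.1) (x - z0.1) by rewrite ler_wpM2l.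
  have : K * `|x - z0.1| <= K * delta / 2 + b * `|x - z0.1| ^+ 2.
    have -> : K * delta / 2 + b * `|x - z0.1| ^+ 2 =
       K * ((delta ^+ 2 + `|x - z0.1| ^+ 2) / (2 * delta)).
      by rewrite /b; field; rewrite gt_eqF.
    apply: ler_wpM2l => //; rewrite ler_pdivlMr ?mulr_gt0//.
    by have := sqr_ge0 (delta - `|x - z0.1|); rewrite !expr2; lra.
  lra.
Qed.

Lemma nat_above (a : R) : 0 <= a -> exists k : nat, a <= k%:R <= a + 1.
Proof.
move=> a0; exists (Num.truncn a).+1.
have /andP[H1 H2] := truncn_itv a0.
by rewrite (ltW H2) -natr1 lerD2r.
Qed.

(** [heat_barrier] bounds f after time c.2 by the initial data; rounding this
    bound up to a multiple of eps makes [shift_comparison] applicable, at the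
    price of eps. *)
Lemma heat_shift_le g (u0 : 'rV[R]_n -> R) L M K eps delta f c :
  0 < eps -> 0 < delta -> 0 <= K ->
  (forall a b : R, `|g a - g b| <= L * `|a - b|) -> periodic g 1 ->
  (forall y : R, `|g y| <= M) ->
  (forall x y, `|u0 x - u0 y| <= K * `|x - y|) ->
  heat_sol g eps f -> (forall x, f (x, 0) = u0 x) -> 0 <= c.2 ->
  forall z, 0 <= z.2 ->
    f (z + c) <= f z + (K * `|c.1| + (M + eps * n%:R * K / delta) * c.2 +
      K * delta / 2 + eps).
Proof.
move=> eps0 d0 K0 gL g1 gM u0L fs f0 c0 z z0.
have M0 : 0 <= M by exact: le_trans (gM 0).
set ka := M + eps * n%:R * K / delta.
have ka0 : 0 <= ka.
  by rewrite addr_ge0// divr_ge0 ?(ltW d0)// !mulr_ge0// ltW.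
set a := K * `|c.1| + ka * c.2 + K * delta / 2.
have a0 : 0 <= a.
  by rewrite /a !addr_ge0 ?mulr_ge0 ?divr_ge0 ?(ltW d0).
have [|k /andP[k1 k2]] := @nat_above (a / eps); first by rewrite divr_ge0// ltW.
have ek1 : a <= eps * k%:R by rewrite mulrC -ler_pdivrMr.
have ek2 : eps * k%:R <= a + eps.
  have := k2; rewrite -(ler_pM2l eps0) mulrDr mulr1.
  by rewrite [eps * (a / eps)]mulrC divfK ?gt_eqF.
suff : f (z + c) <= f z + eps * k%:R by lra.
apply: (shift_comparison eps0 gL g1 fs c0) z0 => x.
apply: le_trans (_ : f (x, 0) + a <= _); last by rewrite lerD2l.
have xc2 : 0 <= ((x, 0) + c).2 by rewrite /= add0r.
apply: le_trans (heat_barrier eps0 d0 K0 gL gM u0L fs f0 xc2) _.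
rewrite f0 /= add0r -/ka.
have := le_trans (ler_norm _) (u0L (x + c.1) x); rewrite addrAC subrr add0r /a; lra.
Qed.

(** The opposite bound is the same estimate for the reflected equation, and
    exchanging the points makes the time increment nonnegative. *)
Lemma heat_modulus g (u0 : 'rV[R]_n -> R) L M K eps delta f :
  0 < eps -> 0 < delta -> 0 <= K ->
  (forall a b : R, `|g a - g b| <= L * `|a - b|) -> periodic g 1 ->
  (forall y : R, `|g y| <= M) ->
  (forall x y, `|u0 x - u0 y| <= K * `|x - y|) ->
  heat_sol g eps f -> (forall x, f (x, 0) = u0 x) ->
  forall z w, 0 <= z.2 -> 0 <= w.2 ->
    `|f z - f w| <= (K + (M + eps * n%:R * K / delta)) * `|z - w| +
      (K * delta / 2 + eps).
Proof.
move=> eps0 d0 K0 gL g1 gM u0L fs f0.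
suff H z w : 0 <= z.2 -> z.2 <= w.2 -> `|f z - f w| <=
    (K + (M + eps * n%:R * K / delta)) * `|z - w| + (K * delta / 2 + eps).
  move=> z w z0 w0; case/orP: (le_total z.2 w.2) => zw; first exact: H.
  by rewrite distrC [`|z - w|]distrC; exact: H.
move=> z0 zw; set c := w - z.
have c0 : 0 <= c.2 by rewrite /= subr_ge0.
have wE : w = z + c by rewrite /c addrC subrK.
have M0 : 0 <= M by exact: le_trans (gM 0).
have ka0 : 0 <= M + eps * n%:R * K / delta.
  by rewrite addr_ge0// divr_ge0 ?(ltW d0)// !mulr_ge0// ltW.
have c1n : K * `|c.1| <= K * `|z - w|.
  by rewrite ler_wpM2l// [leRHS]distrC; exact: (prod_norm1 c).
have c2n : (M + eps * n%:R * K / delta) * c.2 <=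
    (M + eps * n%:R * K / delta) * `|z - w|.
  rewrite ler_wpM2l// [leRHS]distrC; apply: le_trans (prod_norm2 c).
  exact: ler_norm.
have H1 := heat_shift_le eps0 d0 K0 gL g1 gM u0L fs f0 c0 z0.
have gM' (y : R) : `|reflect_fun g y| <= M by rewrite normrN.
have u0L' x y : `|- u0 x - - u0 y| <= K * `|x - y|.
  by rewrite opprK addrC distrC.
have f0' x : - f (x, 0) = - u0 x by rewrite f0.
have H2 := heat_shift_le eps0 d0 K0 (reflect_lipschitz gL) (reflect_periodic g1)
  gM' u0L' (heat_sol_refl fs) f0' c0 z0.
by rewrite -wE in H1 H2; rewrite ler_norml; apply/andP; split; lra.
Qed.
End HeatEstimates.

(** * The perturbed test function *)

Section PerturbedTest.
Variables (R : realType) (n : nat).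
Local Notation E := ('rV[R]_n * R)%type.
Implicit Types (x y p q : 'rV[R]_n) (z w v zeta : E) (r s e eps K L B T M tau delta : R)
  (u f h W : E -> R) (g : R -> R) (sig : 'I_n -> R).

(** Composition of the upper jet of X at y0 with the quadratic
    s |-> (s b + s^2 k) / eps, along one direction: the cubic and quartic terms
    are absorbed in e s^2. *)
Lemma perturbed_touch f z v (X : R -> R) (D A b k y0 eps rho r : R) :
  0 < eps -> 0 < rho -> 0 < r -> eps * X y0 = f z ->
  (forall s, `|s| < r -> X (y0 + s) <= X y0 + D * s + A / 2 * s ^+ 2) ->
  (forall s, `|s| < rho ->
     f (s *: v + z) <= eps * X (y0 + (s * b + s ^+ 2 * k) / eps)) ->
  forall e, 0 < e -> exists2 r', 0 < r' & forall s, `|s| < r' ->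
    f (s *: v + z) <= f z + D * b * s + (2 * D * k + A * b ^+ 2 / eps + e) / 2 * s ^+ 2.
Proof.
move=> eps0 rho0 r0 Xf jet fX e e0.
pose G := `|b| + `|k|; have G0 : 0 <= G by rewrite addr_ge0.
pose G2 := `|A| * (2 * `|b * k| + k ^+ 2); have G20 : 0 <= G2.
  by rewrite mulr_ge0// addr_ge0 ?sqr_ge0// mulr_ge0.
have Gp : 0 < G + 1 by rewrite ltr_wpDl.
have G2p : 0 < G2 + 1 by rewrite ltr_wpDl.
exists (Num.min (Num.min rho 1) (Num.min (r * eps / (G + 1)) (e * eps / (G2 + 1)))).
  by rewrite !lt_min rho0 ltr01 !divr_gt0// mulr_gt0.
move=> s; rewrite !lt_min => /andP[/andP[srho s1] /andP[sr se]].
apply: le_trans (fX s srho) _.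
have s0 := normr_ge0 s.
set d := (s * b + s ^+ 2 * k) / eps.
have s2 : s ^+ 2 <= `|s|.
  by rewrite -real_normK ?num_real// expr2 ler_piMl// ltW.
have dr : `|d| < r.
  rewrite /d normrM normfV (gtr0_norm eps0) ltr_pdivrMr//.
  apply: le_lt_trans (ler_normD _ _) _; rewrite (normrM s b) (normrM (s ^+ 2) k).
  have H1 : `|s ^+ 2| * `|k| <= `|s| * `|k|.
    by rewrite ler_wpM2r// ger0_norm ?sqr_ge0.
  have H2 : `|s| * (G + 1) < r * eps by rewrite -ltr_pdivlMr.
  by rewrite /G in H2; lra.
have := jet _ dr; rewrite -(ler_pM2l eps0) => H; apply: le_trans H _.
have -> : eps * (X y0 + D * d + A / 2 * d ^+ 2) =
    f z + D * b * s + (2 * D * k + A * b ^+ 2 / eps +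
      (A * (2 * (b * k) * s + k ^+ 2 * s ^+ 2)) / eps) / 2 * s ^+ 2.
  by rewrite -Xf /d; field; rewrite gt_eqF.
rewrite lerD2l ler_wpM2r ?sqr_ge0// ler_pM2r ?invr_gt0// lerD2l ler_pdivrMr//.
apply: le_trans (ler_norm _) _; rewrite normrM.
have H1 : `|2 * (b * k) * s + k ^+ 2 * s ^+ 2| <= (2 * `|b * k| + k ^+ 2) * `|s|.
  apply: le_trans (ler_normD _ _) _.
  rewrite (normrM _ s) (normrM 2) (normrM (k ^+ 2)) (ger0_norm (ler0n _ 2)) (ger0_norm (sqr_ge0 k)) (ger0_norm (sqr_ge0 s)).
  have : k ^+ 2 * s ^+ 2 <= k ^+ 2 * `|s| by rewrite ler_wpM2l ?sqr_ge0.
  lra.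
have H2 := ler_wpM2l (normr_ge0 A) H1.
have H3 : `|s| * (G2 + 1) < e * eps by rewrite -ltr_pdivlMr.
rewrite /G2 in H3; lra.
Qed.

Lemma unit_dir_norm w : w = time_dir R n \/ (exists i, w = space_dir R i) ->
  `|w| <= 1 /\ dote w w = 1.
Proof.
move=> [->|[i ->]]; split.
- by apply: prod_norm_le; rewrite /= ?normr0// normr1.
- by rewrite dote_time.
- apply: prod_norm_le; rewrite /= ?normr0//; apply: row_norm_le => // j.
  by rewrite mxE eqxx /=; case: (j == i); rewrite ?normr0 ?normr1.
- by rewrite dote_space mxE !eqxx.
Qed.

(** At a point where eps X(y0 + phi / eps) touches f from above, with phi a
    paraboloid of differential zeta, one has f_t = X' zeta.2 and
    eps Laplacian f <= X'' |zeta.1|^2 + 2 n eps K X'. The equation for f and the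
    cell inequality have the same term g(X), and what remains after dividing by
    X' >= m is zeta.2 <= c, up to the opening of phi and to the difference
    between |zeta.1|^2 and P. *)
Lemma corrector_touch g (P c : R) (X D : R -> R) (C m : R) eps f z tau sig (y0 : R)
    zeta K rho :
  upper_corrector g P c X D C m -> 0 < eps -> 0 < rho -> 0 < z.2 ->
  pjet f z tau sig -> tau - eps * \sum_(i < n) sig i <= g (f z / eps) ->
  eps * X y0 = f z ->
  (forall w, 0 <= w.2 -> `|w - z| <= rho ->
     f w <= eps * X (y0 + paraboloid zeta K z w / eps)) ->
  m * (zeta.2 - c - 2 * n%:R * eps * K) <= C * `|dotv zeta.1 zeta.1 - P|.
Proof.
move=> K0 eps0 rho0 z0 [ft fsp] feq Xy0 fle.
have Xg : f z / eps = X y0 by rewrite -Xy0 mulrAC divff ?mul1r// gt_eqF.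
rewrite {}Xg in feq; apply/ler_addgt0Pr => e e0.
have [A [AleC PA [r' r'0 jet]]] := corr_jet K0 y0 e0.
have m0 := corr_gt0 K0; have mD := corr_ge K0 y0.
have slice w : w = time_dir R n \/ (exists i, w = space_dir R i) ->
    forall e, 0 < e -> exists2 r'', 0 < r'' & forall s, `|s| < r'' ->
    f (s *: w + z) <= f z + D y0 * dote zeta w * s +
      (2 * D y0 * K + A * dote zeta w ^+ 2 / eps + e) / 2 * s ^+ 2.
  move=> /unit_dir_norm[w1 ww].
  have rho1 : 0 < Num.min rho z.2 by rewrite lt_min rho0.
  apply: (perturbed_touch eps0 rho1 r'0 Xy0 jet) => s.
  rewrite lt_min => /andP[sr sz].
  have sw : `|s *: w| <= `|s| by rewrite normrZ ler_piMr.
  have H0 : 0 <= (s *: w + z).2.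
    have := le_trans (prod_norm2 (s *: w)) sw; rewrite ler_norml /= => /andP[+ _].
    by clear -sz; lra.
  apply: le_trans (fle _ H0 _) _; first by rewrite addrK (le_trans sw)// ltW.
  have -> // : paraboloid zeta K z (s *: w + z) = s * dote zeta w + s ^+ 2 * K.
  by rewrite /paraboloid addrK !(doteZr, doteZl) ww; ring.
have tauE : tau = D y0 * zeta.2.
  have [r'' r''0 Hr''] := slice _ (or_introl (erefl _)) 1 ltr01.
  by rewrite -[in RHS](dote_time zeta); exact: (touch_first ft r''0 Hr'').
have sigle i : sig i <= 2 * D y0 * K + A * (zeta.1 0 i) ^+ 2 / eps.
  have [d [fd dsig]] := fsp i; rewrite -(dote_space zeta i).
  apply/ler_addgt0Pr => e' e'0.
  have [r'' r''0 Hr''] := slice (space_dir R i) (or_intror (ex_intro _ i (erefl _))) e' e'0.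
  apply: (touch_second (f := f) r''0 _ dsig Hr'') => s _.
  by apply: fd; rewrite /= scaler0 add0r.
have sumle : eps * \sum_(i < n) sig i <=
    2 * n%:R * eps * K * D y0 + A * dotv zeta.1 zeta.1.
  apply: le_trans (_ : eps * \sum_(i < n) (2 * D y0 * K + A * (zeta.1 0 i) ^+ 2 / eps) <= _).
    by rewrite ler_pM2l//; apply: ler_sum => i _; exact: sigle.
  rewrite big_split /= sumr_const card_ord.
  have -> : \sum_(i < n) A * zeta.1 0 i ^+ 2 / eps = A * dotv zeta.1 zeta.1 / eps.
    by rewrite -mulr_suml -mulr_sumr; congr (_ * _ / _); apply: eq_bigr => i _; rewrite expr2.
  rewrite mulrDr [eps * (_ / eps)]mulrC divfK ?gt_eqF// lerD2r.
  by rewrite -[X in eps * X]mulr_natl; clear; lra.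
have APQ : A * (dotv zeta.1 zeta.1 - P) <= C * `|dotv zeta.1 zeta.1 - P|.
  by apply: le_trans (ler_norm _) _; rewrite normrM ler_wpM2r.
have C00 : 0 <= C * `|dotv zeta.1 zeta.1 - P|.
  by rewrite mulr_ge0//; exact: le_trans AleC.
set a := zeta.2 - c - 2 * n%:R * eps * K.
have Da : D y0 * a <= C * `|dotv zeta.1 zeta.1 - P| + e.
  by rewrite tauE in feq; rewrite /a; clear -feq PA sumle APQ; lra.
(* The lower bound m <= D y0 can be inserted only if a >= 0. *)
have [a0|a0] := leP 0 a; first by apply: le_trans Da; exact: ler_wpM2r.
have : m * a <= 0 by rewrite pmulr_rle0// ltW.
by clear -C00 e0; lra.
Qed.

(** Let a paraboloid touch the limit u at z1 from above with zeta.2 > H(zeta.1),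
    and let X be the corrector of gradient zeta.1, with inverse h. The functions
    v = eps h(f / eps) also converge to u, so that, the contact being made
    strict by an increase of the opening K, v minus the paraboloid has an
    interior maximum close to z1. As X is increasing, this says that
    eps X((paraboloid + const) / eps) touches f from above at that point;
    [corrector_touch] then contradicts the choice of zeta when eps and the
    distance to z1 are small. *)
Lemma limit_prox_sub (F : set_system R) g (H : 'rV[R]_n -> R)
    (fe : R -> E -> R) u C0 :
  ProperFilter F -> periodic g 1 ->
  (forall e0, 0 < e0 -> \forall eps \near F, 0 < eps < e0) ->
  (forall eps, 0 < eps -> {within @closed_half R n, continuous (fe eps)}) ->
  (forall eps, 0 < eps -> heat_sub g eps (fe eps)) ->
  (forall p, exists X D C m, upper_corrector g (dotv p p) (H p) X D C m) ->
  lip_half C0 u ->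
  (forall z r delta, 0 < delta -> \forall eps \near F, forall w,
     0 <= w.2 -> `|w - z| <= r -> `|fe eps w - u w| <= delta) ->
  prox_sub H u.
Proof.
move=> FF g1 F0 fc fs corr uL conv z1 zeta K t1 uz.
rewrite leNgt; apply/negP => Hz.
have [X [D [C [m K0]]]] := corr zeta.1.
have [h [hX Xh h1 hL [B hB]]] := corrector_inverse K0.
have m0 := corr_gt0 K0.
(* The additional unit makes the contact at z1 strict. *)
pose K1 := `|K| + 1; have K10 : 0 < K1 by rewrite ltr_wpDl.
pose zt z := zeta + (2 * K1) *: (z - z1).
(* The defect of the limit inequality for the recentred paraboloid, which is
   positive at z1 and hence near z1. *)
pose psi z := m * ((zt z).2 - H zeta.1) -
  C * `|dotv (zt z).1 (zt z).1 - dotv zeta.1 zeta.1|.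
have psi1 : psi z1 = m * (zeta.2 - H zeta.1).
  by rewrite /psi /zt subrr scaler0 addr0 subrr normr0 mulr0 subr0.
have psi0 : 0 < psi z1 / 2 by rewrite divr_gt0// psi1 mulr_gt0// subr_gt0.
have ztc : continuous zt.
  move=> z; apply: cvgD; first exact: cvg_cst.
  apply: cvgZr; apply: cvgB; [exact: cvg_id|exact: cvg_cst].
have psic : continuous psi.
  move=> z; apply: cvgB; apply: cvgM; [exact: cvg_cst| |exact: cvg_cst|].
    by apply: cvgB; [apply: cvg_pr2; exact: ztc|exact: cvg_cst].
  apply: cvg_norm; apply: cvgB; last exact: cvg_cst.
  by apply: cvg_dotv; apply: cvg_pr1; exact: ztc.
have /cvgrPdist_le/(_ _ psi0)/nbhs_ballP[r0 /= r00 Hr0] := psic z1.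
pose r := Num.min (z1.2 / 2) (r0 / 2).
have r_gt0 : 0 < r by rewrite lt_min !divr_gt0.
have rt : r <= z1.2 / 2 by rewrite ge_min lexx.
have rr0 : r < r0.
  by apply: le_lt_trans (_ : r0 / 2 < r0); [rewrite ge_min lexx orbT|clear -r00; lra].
have psir z : `|z - z1| <= r -> psi z1 / 2 <= psi z.
  move=> zr; have : `|psi z1 - psi z| <= psi z1 / 2.
    by apply: Hr0; rewrite -ball_normE /ball_/= distrC; exact: le_lt_trans rr0.
  by rewrite ler_norml => /andP[_]; clear; lra.
have d0 : 0 < r ^+ 2 / 8 by rewrite divr_gt0// exprn_gt0.
pose B1 := `|B| + 1; have B10 : 0 < B1 by rewrite ltr_wpDl.
have BB1 : B <= B1 by rewrite /B1; apply: le_trans (ler_norm B) _; rewrite lerDl.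
pose N := m * (2 * n%:R * K1) + 1.
have N0 : 0 < N.
  by rewrite ltr_wpDl// mulr_ge0 ?(ltW m0)//; apply: mulr_ge0; [exact: mulr_ge0|exact: ltW].
have e0 : 0 < Num.min (r ^+ 2 / 8 / B1) (psi z1 / 2 / N).
  by rewrite lt_min; apply/andP; split; exact: divr_gt0.
(* Small enough for the distance eps B between v and f, and for the contribution
   of the opening K1 to the equation. *)
have [eps [conve /andP[eps0]]] := filter_ex (filterI (conv z1 r _ d0) (F0 _ e0)).
rewrite lt_min (ltr_pdivlMr _ _ B10) (ltr_pdivlMr _ _ N0) => /andP[epsB epsn].
have {}epsB : eps * B <= r ^+ 2 / 8.
  by apply: le_trans (ltW epsB); rewrite ler_pM2l.
set f := fe eps in conve *.
pose v w := eps * h (f w / eps).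
have vf w : `|v w - f w| <= r ^+ 2 / 8.
  have -> : v w - f w = eps * (h (f w / eps) - f w / eps).
    by rewrite /v mulrBr [eps * (f w / eps)]mulrC divfK// gt_eqF.
  rewrite normrM (gtr0_norm eps0); apply: le_trans epsB.
  by rewrite ler_pM2l.
have vu w : 0 <= w.2 -> `|w - z1| <= r -> `|v w - u w| <= r ^+ 2 / 4.
  move=> w0 wr; rewrite -[v w](subrK (f w)) -addrA.
  apply: le_trans (ler_normD _ _) _; move: (conve w w0 wr) (vf w).
  by clear; lra.
have vc : {within @closed_half R n, continuous v}.
  apply/within_half_epsP => w w0 e e0'.
  have me : 0 < m * e by rewrite mulr_gt0.
  have [r' r'0 Hr'] := (within_half_epsP f).1 (fc eps eps0) w w0 _ me.
  exists r' => // w' w'0 ww'.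
  rewrite /v -mulrBr normrM (gtr0_norm eps0).
  have := hL (f w' / eps) (f w / eps).
  rewrite -mulrBl normrM [`|eps^-1|]gtr0_norm ?invr_gt0// => H1.
  apply: le_trans (ler_wpM2l (ltW eps0) H1) _.
  have -> : eps * (`|f w' - f w| * eps^-1 / m) = `|f w' - f w| / m.
    by clear -eps0 m0; field; rewrite !gt_eqF.
  by rewrite ler_pdivrMr// mulrC; exact: Hr'.
pose Q w := paraboloid zeta K1 z1 w.
have uQ w : 0 <= w.2 -> u w <= u z1 + Q w - dote (w - z1) (w - z1).
  move=> w0; apply: le_trans (uz w w0) _; rewrite /Q /paraboloid.
  have : K * dote (w - z1) (w - z1) <= `|K| * dote (w - z1) (w - z1).
    by rewrite ler_wpM2r ?dote_ge0// ler_norm.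
  by rewrite /K1; clear; lra.
have vQc : {within @closed_half R n, continuous (fun w => v w - Q w)}.
  move=> w; apply: cvgB; first exact: vc.
  by apply: continuous_subspaceT; exact: paraboloid_continuous.
have [zb [zbr zb0 zbM]] := box_max (ltW r_gt0) (ltW t1) vQc.
have zbr' : `|zb - z1| < r.
  rewrite -(@ltr_pXn2r _ 2) ?nnegrE ?(ltW r_gt0)//.
  apply: le_lt_trans (norm_sq_dote _) _.
  have Q1 : Q z1 = 0 by rewrite /Q /paraboloid subrr !dote0r mulr0 addr0.
  have := zbM z1; rewrite subrr normr0 (ltW r_gt0) (ltW t1) Q1 => /(_ isT isT).
  have := vu z1 (ltW t1); rewrite subrr normr0 (ltW r_gt0) ler_norml => /(_ isT)/andP[+ _].
  move: (uQ zb zb0) (vu zb zb0 zbr); rewrite ler_norml => + /andP[_].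
  by clear -d0; lra.
have zbp : 0 < zb.2.
  have := le_trans (le_trans (prod_norm2 (zb - z1)) zbr) rt.
  by rewrite ler_norml /= => /andP[+ _]; clear -t1; lra.
have rho0 : 0 < r - `|zb - z1| by rewrite subr_gt0.
have [tau [sig [fj feq]]] := fs eps eps0 zb zbp.
have Xy0 : eps * X (h (f zb / eps)) = f zb by rewrite hX mulrC divfK// gt_eqF.
have touch w : 0 <= w.2 -> `|w - zb| <= r - `|zb - z1| ->
    f w <= eps * X (h (f zb / eps) + paraboloid (zt zb) K1 zb w / eps).
  move=> w0 wr.
  have wr1 : `|w - z1| <= r.
    rewrite -(subrK zb w) -addrA; apply: le_trans (ler_normD _ _) _.
    by rewrite -lerBrDr.
  have hle : h (f w / eps) <= h (f zb / eps) + paraboloid (zt zb) K1 zb w / eps.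
    rewrite -(ler_pM2l eps0) mulrDr [eps * (_ / eps)]mulrC divfK ?gt_eqF//.
    have := zbM w wr1 w0; rewrite /Q (paraboloid_recenter zeta K1 z1 zb w) -/(zt zb).
    by rewrite /v /paraboloid; clear; lra.
  have := derive_ge_growth (corr_derive K0) (corr_ge K0) hle.
  rewrite hX => HX.
  have : 0 <= m * (h (f zb / eps) + paraboloid (zt zb) K1 zb w / eps - h (f w / eps)).
    by rewrite mulr_ge0 ?(ltW m0)// subr_ge0.
  by move=> /le_trans/(_ HX); rewrite subr_ge0 ler_pdivrMr// [_ * eps]mulrC.
have := corrector_touch K0 eps0 rho0 zbp fj feq Xy0 touch.
rewrite leNgt => /negP; apply; have := psir zb zbr.
by move: epsn; rewrite /N /psi -/(psi z1); clear -eps0; lra.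
Qed.
End PerturbedTest.

(** * Limit points of the family *)

Section Limits.
Variable R : realType.

Lemma lipschitz_bound (V W : normedModType R) (f : V -> W) (A : set V) :
  [lipschitz f x | x in A] -> exists2 L : R, 0 <= L &
    forall x y, A x -> A y -> `|f x - f y| <= L * `|x - y|.
Proof.
move=> /pinfty_ex_gt0[L L0 HL]; exists L; first exact: ltW.
by move=> x y Ax Ay; exact: (HL (x, y) (conj Ax Ay)).
Qed.

(** Along an ultrafilter a bounded function has a limit, so that pointwise
    limits of the family exist without extraction of subsequences. *)
Lemma ultrafilter_limit (T : Type) (F : set_system T) (h : T -> R) (B : R) :
  UltraFilter F -> (\forall t \near F, `|h t| <= B) ->
  exists l : R, forall e, 0 < e -> \forall t \near F, `|h t - l| <= e.
Proof.
move=> FU hB; have hs : (h @ F) `[- B, B]%classic.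
  by apply: filterS hB => t /=; rewrite in_itv/= ler_norml.
have FP : ProperFilter F by exact: ultra_proper.
have [l [_ lcl]] := @segment_compact R (- B) B (h @ F) _ hs.
exists l => e e0.
have [//|H] := in_ultra_setVsetC [set t | `|h t - l| <= e] FU.
have hH : (h @ F) [set y | e < `|y - l|].
  suff : F [set t | e < `|h t - l|] by [].
  by apply: filterS H => t Ht; rewrite /= ltNge; apply/negP => Hle; exact: Ht.
have [y [/= Hy]] := lcl _ (ball l e) hH (nbhsx_ballx l e e0).
by rewrite -ball_normE /ball_/= distrC => /(lt_trans Hy); rewrite ltxx.
Qed.
End Limits.

Section Assembly.
Variables (R : realType) (n : nat).
Local Notation E := ('rV[R]_n * R)%type.
Implicit Types (x y p q : 'rV[R]_n) (z w c zeta : E) (r s e eps K L B T M : R)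
  (u f h : E -> R) (g : R -> R).

Lemma prox_lipschitz_viscosity (H : R -> R) (u0 : 'rV[R]_n -> R) u C0 :
  continuous (fun p : 'rV[R]_n => H (enorm p)) -> 0 <= C0 -> lip_half C0 u ->
  prox_sub (fun p => H (enorm p)) u ->
  prox_sub (fun p => - H (enorm (- p))) (fun z => - u z) ->
  (forall x, u (x, 0) = u0 x) -> lipschitz_viscosity_solution H u0 u.
Proof.
move=> Hc C00 uL us uS uE; split => //.
- apply: (@klipschitzW _ _ _ C0).
    by apply: (@globally_properfilter _ _ ((0, 0), (0, 0))); split; rewrite /closed_half /= lexx.
  by move=> [z w] [z0 w0]; exact: (uL z w z0 w0).
- move=> phi z phiC z0 uphi; rewrite subr_le0.
  apply: (prox_viscosity (zeta := (grad phi z, dt phi z)) us uL) (z0) uphi => //.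
    exact: Hc.
  by move=> e e0; exact: C1_first_order.
- move=> phi z phiC z0 uphi; rewrite subr_ge0.
  pose zeta : E := (grad phi z, dt phi z).
  suff : (- zeta).2 <= - H (enorm (- (- zeta).1)) by rewrite /= opprK lerN2.
  apply: (prox_viscosity (zeta := - zeta) (phi := fun w => - phi w) uS) => //.
  + by move=> w w' w0 w'0; rewrite -opprD normrN; apply: uL.
  + have Hn : continuous (fun p : 'rV[R]_n => H (enorm (- p))).
      by move=> p; exact: (continuous_comp (opp_continuous p) (Hc (- p))).
    exact: (cvgN (Hn (- zeta).1)).
  + move=> e e0; have [r r0 Hr] := C1_first_order phiC z0 e0.
    exists r => // w wr; apply: norm_le_eqN (Hr w wr) _.
    by rewrite doteNl -/zeta; lra.
  + by [].
  + by apply: filterS uphi => w; lra.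
Qed.

Lemma lipschitz_viscosity_prox (H : R -> R) (u0 : 'rV[R]_n -> R) u :
  lipschitz_viscosity_solution H u0 u ->
  exists C0, [/\ lip_half C0 u, prox_sub (fun p => H (enorm p)) u,
    prox_sub (fun p => - H (enorm (- p))) (fun z => - u z) &
    forall x, u (x, 0) = u0 x].
Proof.
move=> [/lipschitz_bound[C0 _ uL] us uS uE]; exists C0; split => //.
- exact: viscosity_sub_prox.
- exact: viscosity_super_prox.
Qed.

(** Both solutions have the same initial data, so comparison applies in both
    directions. *)
Lemma lipschitz_viscosity_unique (H : R -> R) (u0 : 'rV[R]_n -> R) (u v : E -> R) :
  continuous (fun p : 'rV[R]_n => H (enorm p)) ->
  lipschitz_viscosity_solution H u0 u -> lipschitz_viscosity_solution H u0 v ->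
  forall z, 0 <= z.2 -> v z = u z.
Proof.
move=> Hc /lipschitz_viscosity_prox[C1 [uL us uS uE]].
move=> /lipschitz_viscosity_prox[C2 [vL vs vS vE]] z z0.
have uL' := lip_half_weaken (_ : C1 <= Num.max C1 C2) uL.
have vL' := lip_half_weaken (_ : C2 <= Num.max C1 C2) vL.
have C1m : C1 <= Num.max C1 C2 by rewrite le_max lexx.
have C2m : C2 <= Num.max C1 C2 by rewrite le_max lexx orbT.
apply/eqP; rewrite eq_le; apply/andP; split.
  by apply: (prox_comparison Hc (vL' C2m) (uL' C1m) vs uS) z0 => x; rewrite uE vE.
by apply: (prox_comparison Hc (uL' C1m) (vL' C2m) us vS) z0 => x; rewrite uE vE.
Qed.

Lemma effective_speed_correctors g L M (cbar : R -> R) :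
  (forall a b : R, `|g a - g b| <= L * `|a - b|) -> (forall y : R, `|g y| <= M) ->
  periodic g 1 -> (forall y : R, 0 < g y) -> effective_speed n g cbar ->
  forall p : 'rV[R]_n, exists X D C m,
    upper_corrector g (dotv p p) (cbar (enorm p)) X D C m /\
    upper_corrector (reflect_fun g) (dotv p p) (- cbar (enorm p))
      (reflect_fun X) (fun t : R => D (- t)) C m.
Proof.
move=> gL gM g1 g0 cbarP p; have [[chi chiP] _] := cbarP p.
by rewrite dotv_sq; exact: cell_correctors chiP.
Qed.

(** [speed_comparison] in both directions, each time with the corrector at the
    fixed gradient p as the one that supplies the constants m and C. *)
Lemma effective_speed_continuous g L M (cbar : R -> R) :
  (forall a b : R, `|g a - g b| <= L * `|a - b|) -> (forall y : R, `|g y| <= M) ->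
  periodic g 1 -> (forall y : R, 0 < g y) -> effective_speed n g cbar ->
  continuous (fun p : 'rV[R]_n => cbar (enorm p)).
Proof.
move=> gL gM g1 g0 cbarP; apply: eps_continuous => p e e0.
have corr := effective_speed_correctors gL gM g1 g0 cbarP.
have [X [D [C [m [Ku Kl]]]]] := corr p.
have m0 := corr_gt0 Ku.
have C0 : 0 <= C.
  by have [A [AleC _ _]] := corr_jet Ku 0 ltr01; exact: le_trans AleC.
have e'0 : 0 < e * m / (C + 1) by rewrite divr_gt0 ?mulr_gt0// ltr_wpDl.
have dc : continuous (fun q : 'rV[R]_n => dotv q q).
  by move=> q; apply: (@cvg_dotv R n _ (nbhs q) _ id id q q); exact: cvg_id.
have /cvgrPdist_le/(_ _ e'0)/nbhs_ballP[r /= r0 Hr] := dc p.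
exists r => // q qp; have pq : `|dotv p p - dotv q q| <= e * m / (C + 1).
  by apply: Hr; rewrite -ball_normE /ball_/= distrC.
have [X' [D' [C' [m' [Ku' Kl']]]]] := corr q.
have H1 := speed_comparison g1 (dotv_ge0 q) Kl' Ku.
have Ku'' : upper_corrector (reflect_fun (reflect_fun g)) (dotv q q)
    (- - cbar (enorm q)) X' D' C' m' by rewrite reflect_funK opprK.
have H2 := speed_comparison (reflect_periodic g1) (dotv_ge0 q) Ku'' Kl.
have H3 : C * `|dotv q q - dotv p p| <= e * m.
  have : (C + 1) * `|dotv q q - dotv p p| <= e * m.
    by rewrite distrC mulrC -ler_pdivlMr// ltr_wpDl.
  by have := normr_ge0 (dotv q q - dotv p p); lra.
by rewrite ler_norml; apply/andP; split; rewrite -(ler_pM2r m0); lra.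
Qed.

Variables (g : R -> R) (u0 : 'rV[R]_n -> R) (cbar : R -> R) (ueps : R -> E -> R)
  (L M K : R).
Hypotheses (gL : forall a b : R, `|g a - g b| <= L * `|a - b|)
  (gM : forall y : R, `|g y| <= M) (g1 : periodic g 1) (g0 : forall y : R, 0 < g y)
  (K0 : 0 <= K) (u0L : forall x y, `|u0 x - u0 y| <= K * `|x - y|)
  (cbarP : effective_speed n g cbar)
  (uepsP : forall eps, 0 < eps -> classical_solution g u0 eps (ueps eps)).

Let C0 := K + (M + n%:R * K).

Let M0 : 0 <= M. Proof. exact: le_trans (gM 0). Qed.
Let C00 : 0 <= C0. Proof. by rewrite /C0 !addr_ge0// mulr_ge0. Qed.

(** In [heat_modulus] the barrier parameter delta, of order e, is fixed before
    eps, so that eps / delta <= 1 keeps the Lipschitz constant bounded while the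
    additive error is at most e. *)
Lemma ueps_modulus e : 0 < e -> exists2 e0, 0 < e0 & forall eps, 0 < eps < e0 ->
  forall z w, 0 <= z.2 -> 0 <= w.2 ->
    `|ueps eps z - ueps eps w| <= C0 * `|z - w| + e.
Proof.
move=> e0; pose delta := e / (K + 1).
have K1 : 0 < K + 1 by rewrite ltr_wpDl.
have d0 : 0 < delta by rewrite divr_gt0.
have Kd : K * delta <= e.
  have : (K + 1) * delta = e by rewrite mulrC divfK// gt_eqF.
  by have := ltW d0; lra.
exists (Num.min delta (e / 2)); first by rewrite lt_min d0 divr_gt0.
move=> eps /andP[eps0]; rewrite lt_min => /andP[ed ee] z w z0 w0.
have cs := uepsP eps0; have [_ _ _ _ f0] := cs.
have := heat_modulus eps0 d0 K0 gL g1 gM u0L (classical_heat_sol cs) f0 z0 w0.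
move=> /le_trans; apply; apply: lerD; last by lra.
apply: ler_wpM2r => //; rewrite /C0 lerD2l lerD2l ler_pdivrMr//.
have nK0 : 0 <= n%:R * K by exact: mulr_ge0.
by have := ler_wpM2l nK0 (ltW ed); lra.
Qed.

(** Pointwise limits along F are Lipschitz by [ueps_modulus], which also
    makes the convergence uniform on compact sets; [limit_prox_sub], for the
    family and for its reflection, identifies the equation. *)
Lemma ueps_subsequential_limit (F : set_system R) : UltraFilter F ->
  (forall e0, 0 < e0 -> \forall eps \near F, 0 < eps < e0) ->
  exists u, lipschitz_viscosity_solution cbar u0 u /\
    forall Q : set E, compact Q -> Q `<=` @closed_half R n ->
    forall e, 0 < e -> \forall eps \near F, forall z, Q z -> `|ueps eps z - u z| <= e.
Proof.
move=> FU F0; have FP : ProperFilter F by exact: ultra_proper.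
have modF e : 0 < e -> \forall eps \near F, forall z w, 0 <= z.2 -> 0 <= w.2 ->
    `|ueps eps z - ueps eps w| <= C0 * `|z - w| + e.
  by move=> e0; have [e1 e10 He] := ueps_modulus e0; apply: filterS (F0 _ e10).
have lim z : exists l : R, 0 <= z.2 -> forall e, 0 < e ->
    \forall eps \near F, `|ueps eps z - l| <= e.
  have [z0|z0] := leP 0 z.2; last by exists 0.
  have [|l Hl] := @ultrafilter_limit _ _ F (fun eps => ueps eps z)
      (`|u0 z.1| + (C0 * `|z - (z.1, 0)| + 1)) FU; last by exists l.
  apply: filterS (filterI (modF 1 ltr01) (F0 1 ltr01)) => eps [H /andP[eps0 _]].
  have [_ _ _ _ f0] := uepsP eps0.
  have := H z (z.1, 0) z0 (lexx 0); rewrite f0 => Hz.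
  rewrite -(subrK (u0 z.1) (ueps eps z)) addrC.
  by apply: le_trans (ler_normD _ _) _; rewrite lerD2l.
have [u uP] := choice lim.
have uE x : u (x, 0) = u0 x.
  apply/eqP; rewrite -subr_eq0 -normr_le0; apply/ler_addgt0Pr => e e0; rewrite add0r.
  have [eps [H /andP[eps0 _]]] := filter_ex (filterI (uP (x, 0) (lexx 0) e e0) (F0 1 ltr01)).
  by have [_ _ _ _ f0] := uepsP eps0; rewrite distrC -f0.
have uL : lip_half C0 u.
  move=> z w z0 w0; apply/ler_addgt0Pr => e e0.
  have e3 : 0 < e / 3 by rewrite divr_gt0.
  have [eps [Hm [Hz Hw]]] := filter_ex (filterI (modF _ e3)
    (filterI (uP z z0 _ e3) (uP w w0 _ e3))).
  have {}Hm := Hm z w z0 w0.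
  have -> : u z - u w = (ueps eps z - ueps eps w) - (ueps eps z - u z) + (ueps eps w - u w) by lra.
  apply: le_trans (ler_normD _ _) _; apply: le_trans (lerD (ler_normB _ _) (lexx _)) _.
  lra.
have conv (Q : set E) : compact Q -> Q `<=` @closed_half R n ->
    forall e, 0 < e -> \forall eps \near F, forall z, Q z -> `|ueps eps z - u z| <= e.
  move=> cQ Qh e e0.
  have e4 : 0 < e / 4 by rewrite divr_gt0.
  have C1 : 0 < C0 + 1 by rewrite ltr_wpDl.
  have rd : 0 < e / 4 / (C0 + 1) by rewrite divr_gt0.
  (* The uniform modulus upgrades convergence at z to a neighbourhood of z. *)
  have cover z : Q z -> \forall w \near z & eps \near F, Q w -> `|ueps eps w - u w| <= e.
    move=> Qz; have z0 := Qh _ Qz.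
    exists (ball z (e / 4 / (C0 + 1)), [set eps | `|ueps eps z - u z| <= e / 4 /\
       forall z w, 0 <= z.2 -> 0 <= w.2 -> `|ueps eps z - ueps eps w| <= C0 * `|z - w| + e / 4]).
      split; first exact: nbhsx_ballx.
      exact: filterI (uP z z0 _ e4) (modF _ e4).
    move=> [w eps] [/= + [Hz Hm]] Qw; have w0 := Qh _ Qw.
    rewrite -ball_normE /ball_/= => /ltW; rewrite ler_pdivlMr// => zw.
    have H1 := Hm w z w0 z0; have H2 := uL z w z0 w0.
    rewrite [`|w - z|]distrC in H1.
    have -> : ueps eps w - u w = (ueps eps w - ueps eps z) + (ueps eps z - u z) + (u z - u w) by lra.
    apply: le_trans (ler_normD _ _) _; apply: le_trans (lerD (ler_normD _ _) (lexx _)) _.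
    by have := normr_ge0 (z - w); lra.
  have := (near_covering_withinP _).2 ((compact_near_coveringP _).1 cQ) _ _
    (fun eps z => `|ueps eps z - u z| <= e) FP cover.
  by apply: filterS => eps H z; exact: H.
have convbox z r e : 0 < e -> \forall eps \near F, forall w,
    0 <= w.2 -> `|w - z| <= r -> `|ueps eps w - u w| <= e.
  move=> e0.
  have cA : compact ([set w : E | `|w - z| <= r] `&` @closed_half R n).
    by apply: compact_closedI; [exact: compact_box|exact: closed_closed_half].
  have := conv _ cA (@subIsetr _ _ _) e e0.
  by apply: filterS => eps H w w0 wr; apply: H.
have corr := effective_speed_correctors gL gM g1 g0 cbarP.
exists u; split => //.
have Hc := effective_speed_continuous gL gM g1 g0 cbarP.
apply: (prox_lipschitz_viscosity Hc C00 uL) uE.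
- apply: (@limit_prox_sub _ _ F g _ ueps u C0) => //.
  + by move=> eps eps0; have [] := uepsP eps0.
  + by move=> eps eps0; have [] := classical_heat_sol (uepsP eps0).
  + by move=> p; have [X [D [C [m [Ku _]]]]] := corr p; exists X, D, C, m.
- apply: (@limit_prox_sub _ _ F (reflect_fun g) _ (fun eps z => - ueps eps z) _ C0) => //.
  + exact: reflect_periodic.
  + by move=> eps eps0; apply: within_half_opp; have [] := uepsP eps0.
  + by move=> eps eps0; have [] := classical_heat_sol (uepsP eps0).
  + move=> p; have [X [D [C [m [_ Kl]]]]] := corr (- p).
    by exists (reflect_fun X), (fun t : R => D (- t)), C, m; rewrite -(opprK p) dotvNl dotvNr opprK opprK.
  + by move=> z w z0 w0; rewrite -opprD normrN; exact: uL.
  + move=> z r e e0; apply: filterS (convbox z r e e0) => eps H w w0 wr.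
    by rewrite -opprD normrN; exact: H.
Qed.
End Assembly.

(** * Convergence *)

Lemma lipschitz_periodic_bounded (R : realType) (g : R -> R) (L : R) :
  0 <= L -> (forall a b : R, `|g a - g b| <= L * `|a - b|) -> periodic g 1 ->
  forall y, `|g y| <= `|g 0| + L.
Proof.
move=> L0 gL g1; apply: (periodic_ext (Q := fun x => `|x| <= `|g 0| + L) g1).
move=> y /andP[y0 y1]; rewrite -(subrK (g 0) (g y)) addrC.
apply: le_trans (ler_normD _ _) _; rewrite lerD2l; apply: le_trans (gL _ _) _.
by rewrite subr0 ger0_norm// ler_piMr// ltW.
Qed.

Lemma uniform_cvg_eps (R : realType) (T : choiceType) (I : Type) (F : set_system I)
    (K : set T) (f : I -> T -> R) (l : T -> R) : Filter F ->
  (forall e : R, 0 < e -> \forall i \near F, forall t, K t -> `|l t - f i t| < e) ->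
  {uniform K, f i @[i --> F] --> l}.
Proof.
move=> FF H P /uniform_nbhs[D [entD DP]].
move: entD; rewrite -entourage_ballE => -[e /= e0 eD].
apply: filterS (H e e0) => i Hi; apply: DP => t Kt; apply: eD => /=.
by rewrite -ball_normE; exact: Hi.
Qed.

Theorem theorem5p2 (R : realType) (n : nat) (n_gt0 : (0 < n)%N)
    (g : R -> R) (u0 : 'rV[R]_n -> R) (cbar : R -> R)
    (ueps : R -> 'rV[R]_n * R -> R)
    (g_lip : lipschitz g) (g_per : periodic g 1) (g_pos : forall y, 0 < g y)
    (u0_lip : lipschitz u0)
    (cbarP : effective_speed n g cbar)
    (uepsP : forall eps, 0 < eps -> classical_solution g u0 eps (ueps eps)) :
  exists u : 'rV[R]_n * R -> R,
    [/\ lipschitz_viscosity_solution cbar u0 u,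
        forall v, lipschitz_viscosity_solution cbar u0 v ->
          forall z, 0 <= z.2 -> v z = u z &
        forall K : set ('rV[R]_n * R), compact K -> K `<=` @closed_half R n ->
          {uniform K, ueps eps @[eps --> 0^'+] --> u}].
Proof.
have [L L0 gL'] := lipschitz_bound g_lip.
have gL a b : `|g a - g b| <= L * `|a - b| by exact: gL'.
have [K K0 u0L'] := lipschitz_bound u0_lip.
have u0L x y : `|u0 x - u0 y| <= K * `|x - y| by exact: u0L'.
have gM := lipschitz_periodic_bounded L0 gL g_per.
have Hc := effective_speed_continuous gL gM g_per g_pos cbarP.
have limit F := @ueps_subsequential_limit R n g u0 cbar ueps _ _ _ gL gM g_per g_pos
  K0 u0L cbarP uepsP F.
have small (F : set_system R) : 0^'+ `<=` F -> forall e0, 0 < e0 ->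
    \forall eps \near F, 0 < eps < e0.
  move=> F0 e0 e00; apply: F0; near=> eps; apply/andP; split; near: eps.
    exact: nbhs_right_gt.
  exact: nbhs_right_lt.
have [G [GU G0]] := ultraFilterLemma (at_right_proper_filter (0 : R)).
have [u [uv uG]] := limit G GU (small G G0).
have uniq v : lipschitz_viscosity_solution cbar u0 v -> forall z, 0 <= z.2 -> v z = u z.
  by move=> vv; exact: lipschitz_viscosity_unique Hc uv vv.
exists u; split => // Q cQ Qh; apply: uniform_cvg_eps => e e0.
rewrite /prop_near1; apply: contrapT => NB.
(* Otherwise some ultrafilter of scales avoids B, and the limit along it,
   being the solution u as well, yields scales in B. *)
set B := [set eps | forall t, Q t -> `|u t - ueps eps t| < e] in NB.
have W : ProperFilter (within (~` B) 0^'+).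
  apply: Build_ProperFilter => H; apply: NB.
  have {}H : \forall eps \near 0^'+, (~` B) eps -> False by exact: H.
  by near=> eps; apply: contrapT; near: eps.
have [G' [GU' G'0]] := ultraFilterLemma W.
have [|u' [uv' uG']] := limit G' GU' _.
  by apply: small => A A0; apply: G'0; exact: (@filterS _ 0^'+ _ A _ (fun x Ax _ => Ax) A0).
have G'B : G' (~` B) by apply: G'0; exact: withinT.
have e2 : 0 < e / 2 by rewrite divr_gt0.
have [eps [NBe He]] := filter_ex (filterI G'B (uG' Q cQ Qh _ e2)).
apply: NBe => t Qt; rewrite -(uniq _ uv' t (Qh _ Qt)) distrC.
by apply: le_lt_trans (He t Qt) _; lra.
Unshelve. all: by end_near. Qed.
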